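(* Let $\sigma$ be a Hopf vector field on the unit sphere $S^3$. The eigenvalues of the vertical Jacobi operator $\mathcal{J}^v_\sigma$ are $n(n+2)+2k$, where $n$ is a non-negative integer and $k\in\{-n,-n+2,\dots,n-2,n\}$. The multiplicity (real dimension of the eigenspace) of the eigenvalue for given $n$ and $k$ is $2(n+1)$.
   Context: $S^3\subset\mathbb{R}^4\cong\mathbb{C}^2$ has its standard metric. The canonical Hopf vector field is $x\mapsto ix$; a Hopf vector field is any unit vector field congruent to it (its image under an isometry of $S^3$). Let $\mathcal{V}_\sigma$ be the real vector space of smooth vector fields on $S^3$ pointwise orthogonal to $\sigma$. The vertical Jacobi operator is the second order linear elliptic operator on $\mathcal{V}_\sigma$ given by $$\mathcal{J}^v_\sigma(\alpha)=\nabla^*\nabla\alpha-|\nabla\sigma|^2\alpha-2\langle\nabla\sigma,\nabla\alpha\rangle\,\sigma,$$ where $\nabla$ is the Levi-Civita connection, $\nabla^*\nabla=-\operatorname{Tr}\nabla^2$, $|\nabla\sigma|^2=\sum_j|\nabla_{E_j}\sigma|^2$ and $\langle\nabla\sigma,\nabla\alpha\rangle=\sum_j\langle\nabla_{E_j}\sigma,\nabla_{E_j}\alpha\rangle$ for a local orthonormal frame $\{E_j\}$. It extends uniquely to a self-adjoint operator on the Hilbert space of $L^2$ vector fields orthogonal to $\sigma$. *)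

(* Defs.v *)
From mathcomp Require Import all_boot all_order all_algebra.
From mathcomp Require Import all_classical all_reals all_analysis.

Set Implicit Arguments.
Unset Strict Implicit.
Unset Printing Implicit Defensive.
Import Order.TTheory GRing.Theory Num.Theory numFieldNormedType.Exports.
Local Open Scope classical_set_scope.
Local Open Scope ring_scope.

(* The norm `|x| that MathComp-Analysis puts on row vectors is the sup norm;
   Euclidean geometry goes through [dotp]. *)
Definition dotp (R : realType) (m : nat) (u v : 'rV[R]_m) : R :=
  \sum_(i < m) u 0 i * v 0 i.

Definition S3 (R : realType) : Type := {x : 'rV[R]_4 | dotp x x == 1}.

Lemma pole_subproof (R : realType) :
  dotp (delta_mx 0 0 : 'rV[R]_4) (delta_mx 0 0) == 1.
Proof.
rewrite /dotp (bigD1 (0 : 'I_4)) //= big1 => [|i i0].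
  by rewrite mxE !eqxx mulr1 addr0.
by rewrite mxE (negbTE i0) andbF mulr0.
Qed.

Definition pole (R : realType) : S3 R := Sub (delta_mx 0 0) (pole_subproof R).

(* x |-> x / |x|; the value [pole] is used at x = 0 only. *)
Definition retract (R : realType) (x : 'rV[R]_4) : S3 R :=
  insubd (pole R) ((Num.sqrt (dotp x x))^-1 *: x).

(* The extension of X, constant along rays, to R^4 minus the origin. *)
Definition ext (R : realType) (X : S3 R -> 'rV[R]_4) : 'rV[R]_4 -> 'rV[R]_4 :=
  fun x => X (retract x).

(* C^k on an open set U. *)
Fixpoint Ck (R : realType) (m n : nat) (k : nat) (U : set 'rV[R]_m)
    (f : 'rV[R]_m -> 'rV[R]_n) : Prop :=
  match k with
  | 0 => forall x, U x -> {for x, continuous f}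
  | k'.+1 => (forall x, U x -> differentiable f x) /\
             (forall v, Ck k' U (fun x => 'D_v f x))
  end.

(* A map on the sphere is smooth iff its composite with the smooth retraction
   x |-> x / |x| of R^4 minus the origin is smooth. *)
Definition smooth (R : realType) (X : S3 R -> 'rV[R]_4) : Prop :=
  forall k, Ck k [set x | x != 0] (ext X).

Definition tangent (R : realType) (p : S3 R) (v : 'rV[R]_4) : Prop :=
  dotp v (val p) = 0.

Definition tproj (R : realType) (p : S3 R) (w : 'rV[R]_4) : 'rV[R]_4 :=
  w - dotp w (val p) *: val p.

(* The differential at p of X : S^3 -> R^4, for v tangent at p. *)
Definition sdiff (R : realType) (X : S3 R -> 'rV[R]_4) (p : S3 R)
    (v : 'rV[R]_4) : 'rV[R]_4 := 'D_v (ext X) (val p).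

Definition vector_field (R : realType) (X : S3 R -> 'rV[R]_4) : Prop :=
  smooth X /\ forall p, tangent p (X p).

(* nabla_V X: the Levi-Civita connection of a submanifold of Euclidean space is
   the tangential part of the ambient derivative. *)
Definition covd (R : realType) (V X : S3 R -> 'rV[R]_4) : S3 R -> 'rV[R]_4 :=
  fun p => tproj p (sdiff X p (V p)).

(* S^3 is parallelizable, so orthonormal frames can be taken global. *)
Definition orthonormal_frame (R : realType) (E : 'I_3 -> S3 R -> 'rV[R]_4) :
    Prop :=
  (forall j, vector_field (E j)) /\
  (forall p i j, dotp (E i p) (E j p) = (i == j)%:R).

(* - Tr nabla^2, where
   nabla^2_{V,W} = nabla_V nabla_W - nabla_{nabla_V W}. *)
Definition rough_laplacian (R : realType) (E : 'I_3 -> S3 R -> 'rV[R]_4)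
    (a : S3 R -> 'rV[R]_4) : S3 R -> 'rV[R]_4 :=
  fun p => - \sum_(j < 3) (covd (E j) (covd (E j) a) p
                           - covd (covd (E j) (E j)) a p).

Definition nabla_dot (R : realType) (E : 'I_3 -> S3 R -> 'rV[R]_4)
    (s a : S3 R -> 'rV[R]_4) (p : S3 R) : R :=
  \sum_(j < 3) dotp (covd (E j) s p) (covd (E j) a p).

Definition vjacobi (R : realType) (E : 'I_3 -> S3 R -> 'rV[R]_4)
    (s a : S3 R -> 'rV[R]_4) : S3 R -> 'rV[R]_4 :=
  fun p => rough_laplacian E a p - nabla_dot E s s p *: a p
           - (2 * nabla_dot E s a p) *: s p.

(* Multiplication by i under (x0, x1, x2, x3) <-> (x0 + i x1, x2 + i x3). *)
Definition mul_i (R : realType) (x : 'rV[R]_4) : 'rV[R]_4 :=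
  \row_(j < 4) [:: - x 0 1; x 0 0; - x 0 3; x 0 2]`_j.

Definition canonical_hopf (R : realType) (p : S3 R) : 'rV[R]_4 :=
  mul_i (val p).

Definition isometry (R : realType) (f : S3 R -> S3 R) : Prop :=
  [/\ smooth (fun p => val (f p)),
      exists g : S3 R -> S3 R,
        [/\ smooth (fun p => val (g p)), cancel f g & cancel g f] &
      forall p u v, tangent p u -> tangent p v ->
        dotp (sdiff (fun q => val (f q)) p u) (sdiff (fun q => val (f q)) p v)
        = dotp u v].

Definition hopf (R : realType) (s : S3 R -> 'rV[R]_4) : Prop :=
  exists2 f : S3 R -> S3 R, isometry f &
    forall p, s (f p) = sdiff (fun q => val (f q)) p (canonical_hopf p).

Definition vertical (R : realType) (s : S3 R -> 'rV[R]_4) :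
    set (S3 R -> 'rV[R]_4) :=
  [set a | vector_field a /\ forall p, dotp (a p) (s p) = 0].

Section Eigen.
Variables (K : fieldType) (V : lmodType K).

Definition eigenspace_of (D : set V) (T : V -> V) (l : K) : set V :=
  [set a | D a /\ T a = l *: a].

Definition eigenvalue_of (D : set V) (T : V -> V) (l : K) : Prop :=
  exists2 a, eigenspace_of D T l a & a != 0.

Definition has_dim (A : set V) (d : nat) : Prop :=
  exists b : 'I_d -> V,
    (forall c : 'I_d -> K, \sum_(i < d) c i *: b i = 0 -> forall i, c i = 0) /\
    (forall v, A v <-> exists c : 'I_d -> K, v = \sum_(i < d) c i *: b i).

End Eigen.

(* -n, -n+2, ..., n-2, n *)
Definition weights (n : nat) : seq int :=
  [seq - n%:Z + 2 * j%:Z | j <- iota 0 n.+1].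

(* Main.v *)
Require Import Defs.
From mathcomp Require Import all_boot all_order all_algebra.
From mathcomp Require Import all_classical all_reals all_analysis.
From mathcomp Require Import complex.
From mathcomp Require Import ring lra zify.

(* An isometry of the sphere extends to x |-> |x| f(x/|x|), a Euclidean contraction away
   from the origin; so does its inverse, hence it preserves scalar products and is linear.
   A Hopf field is therefore s(x) = x M_0 with M_0, M_1, M_2 skew matrices satisfying the
   quaternion relations.  In the orthonormal frame x M_0, x M_1, x M_2 let D_k be the
   derivative along x M_k.  A field orthogonal to s is f (x M_1) + g (x M_2), and on
   h = f + i g the Jacobi operator becomes J h = - (D_0^2 + D_1^2 + D_2^2) h + 2 i D_0 h.

   In complex coordinates put X = z1 + t z2 and Y = conj z2 - t conj z1, with t a formal
   variable.  Then D_0 X = i X, D_0 Y = - i Y, D_1 X = - Y, D_1 Y = X, D_2 X = - i Y,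
   D_2 Y = - i X, so that the p + q + 1 coefficients of X^p Y^q are eigenfunctions of J with
   eigenvalue n(n+2) + 2(q-p), n = p + q.  As conj z1 X + z2 Y = 1 on the sphere, the
   derivative of X^p Y^q in t expresses the product of a coefficient with z1, z2 or their
   conjugates through other coefficients; hence these span all polynomials on the sphere.

   Integration makes each D_k skew and J symmetric, so that an eigenfunction minus its
   projection on the matching family is orthogonal to all polynomials, in particular to
   the peaks (1 + <x,p>)^m, and vanishes. *)

Set Implicit Arguments.
Unset Strict Implicit.
Unset Printing Implicit Defensive.
Import Order.TTheory GRing.Theory Num.Theory numFieldNormedType.Exports.
Local Open Scope classical_set_scope.
Local Open Scope ring_scope.

(** * Smooth functions on the sphere *)

(** An explicit family of eigenfields excludes neither further eigenvalues nor larger eigenspaces,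
    so completeness is the real obstacle. It only takes a linear functional on continuous functions
    on the sphere that is strictly positive and annihilates derivatives along x |-> x M with M skew.
    No measure is built: Riemann sums over a grid in R^4, passed to the limit along an ultrafilter,
    give linearity and positivity at once, and estimates are needed only for strict positivity and
    for the vanishing on derivatives. The peaks replace an approximation theorem: they are
    polynomials that concentrate at p, so the sign of a function at p can be read off its integrals
    against them.

    The multiplicity is exact because the families do not merge: with n = p + q the eigenvalue
    equals n^2 + 4q, 0 <= q <= n, and this number determines p and q. Each family has complex
    dimension n + 1, hence real dimension 2(n + 1), the operator on h = f + i g being complex
    linear. *)

Section Congruence.
Variables (R : realType) (V W : normedModType R).

Lemma near_eq_differentiable (f g : V -> W) x :
  {near x, f =1 g} -> differentiable f x -> differentiable g x.
Proof.
move=> fg df; have fgx : f x = g x := nbhs_singleton fg.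
have [cdf ef] := (diff_locallyP _ _).1 df.
have eg : g \o shift x = cst (g x) + 'd f x +o_ (0 : V) id.
  apply/eqaddoP => e e0.
  move/eqaddoP : ef => /(_ e e0).
  have : \forall y \near (0 : V), f (y + x) = g (y + x).
    by have := fg; rewrite (near_shift 0) /= subr0.
  move=> H1 H2; near=> y.
  suff -> : (g \o shift x - (cst (g x) + 'd f x)) y =
            (f \o shift x - (cst (f x) + 'd f x)) y by near: y.
  rewrite -fgx; congr (_ - _); rewrite /=; apply/esym.
  by near: y.
have dg := diff_unique cdf eg.
by apply/diff_locallyP; rewrite dg.
Unshelve. all: by end_near. Qed.
End Congruence.

Section Cn.
Variables (R : realType) (V : normedModType R) (U : set V).

(** Scalar counterpart of [Ck], for which sums, products, inverses and square roots are treated by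
    induction on the order; [Ck_coord] translates back to row vectors. *)
Fixpoint Cn (k : nat) (f : V -> R) : Prop :=
  match k with
  | 0 => forall x, U x -> {for x, continuous f}
  | k'.+1 => (forall x, U x -> differentiable f x) /\
             (forall v, Cn k' (fun x => 'D_v f x))
  end.

Definition Cinf (f : V -> R) := forall k, Cn k f.

Hypothesis oU : open U.

Lemma near_open (W : Type) (f g : V -> W) x :
  U x -> (forall y, U y -> f y = g y) -> {near x, f =1 g}.
Proof.
move=> Ux fg; have /filterS : nbhs x U by exact: open_nbhs_nbhs.
by apply => y Uy; apply: fg.
Qed.

(** Openness of [U] turns equality on [U] into equality near each of its points, which derivatives
    respect. This allows derivative formulas valid only on [U] to be used inside the recursion. *)
Lemma Cn_eq k (f g : V -> R) :
  (forall x, U x -> f x = g x) -> Cn k f -> Cn k g.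
Proof.
elim: k f g => [|k IH] f g fg /=.
  move=> cf x Ux; have := cf x Ux; rewrite /prop_for /continuous_at (fg _ Ux).
  by apply: cvg_trans; apply: near_eq_cvg; exact: near_open.
move=> [df Df]; split=> [x Ux|v].
  exact: near_eq_differentiable (near_open Ux fg) (df x Ux).
apply: IH (Df v) => x Ux.
exact: near_eq_derive (near_open Ux fg).
Qed.

Lemma Cinf_eq (f g : V -> R) :
  (forall x, U x -> f x = g x) -> Cinf f -> Cinf g.
Proof. by move=> fg cf k; apply: Cn_eq fg (cf k). Qed.

Lemma CnS k (f : V -> R) : Cn k.+1 f -> Cn k f.
Proof.
elim: k f => [|k IH] f [df Df] /=.
  by move=> x Ux; apply: differentiable_continuous; exact: df.
by split=> // v; apply: IH; exact: Df.
Qed.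

Lemma Cn_cst k c : Cn k (fun=> c).
Proof.
elim: k c => [|k IH] c /=; first by move=> x _; exact: cvg_cst.
split=> [x _|v]; first exact: differentiable_cst.
by apply: Cn_eq (IH 0) => x _; rewrite derive_cst.
Qed.

Lemma CnD k (f g : V -> R) : Cn k f -> Cn k g -> Cn k (fun x => f x + g x).
Proof.
elim: k f g => [|k IH] f g /=.
  by move=> cf cg x Ux; apply: continuousD; [exact: cf|exact: cg].
move=> [df Df] [dg Dg]; split=> [x Ux|v].
  by apply: differentiableD; [exact: df|exact: dg].
apply: Cn_eq (IH _ _ (Df v) (Dg v)) => x Ux.
by rewrite -deriveD //; apply: diff_derivable; [exact: df|exact: dg].
Qed.

Lemma CnM k (f g : V -> R) : Cn k f -> Cn k g -> Cn k (fun x => f x * g x).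
Proof.
elim: k f g => [|k IH] f g.
  by move=> cf cg x Ux; apply: continuousM; [exact: cf|exact: cg].
move=> cf cg; have [df Df] := cf; have [dg Dg] := cg; split=> [x Ux|v].
  by apply: differentiableM; [exact: df|exact: dg].
apply: Cn_eq (CnD (IH _ _ (CnS cf) (Dg v)) (IH _ _ (CnS cg) (Df v))) => x Ux.
by rewrite [RHS]deriveM //; apply: diff_derivable; [exact: df|exact: dg].
Qed.

(** The derivative - f' / f^2 involves 1/f only to the previous order, so the induction closes;
    [Cn_sqrt] works in the same way. *)
Lemma CnV k (f : V -> R) : (forall x, U x -> f x != 0) ->
  Cn k f -> Cn k (fun x => (f x)^-1).
Proof.
move=> f0; elim: k => [|k IH].
  by move=> cf x Ux; apply: continuousV; [exact: f0|exact: cf].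
move=> cf; have [df Df] := cf; split=> [x Ux|v].
  by apply: differentiableV; [exact: df|exact: f0].
have cV := IH (CnS cf).
apply: Cn_eq (CnM (Cn_cst k (-1)) (CnM (CnM cV cV) (Df v))) => x Ux.
rewrite deriveV; [|exact: f0|by apply: diff_derivable; exact: df].
by rewrite /GRing.scale /= mulN1r mulNr -invfM -expr2.
Qed.

Lemma differentiable_sqrt (f : V -> R) x : 0 < f x -> differentiable f x ->
  differentiable (fun y => Num.sqrt (f y)) x.
Proof.
move=> fx df; apply: (@differentiable_comp _ _ _ _ f Num.sqrt) => //.
by apply/derivable1_diffP; have [] := is_derive1_sqrt fx.
Qed.

Lemma derive_sqrt_comp (f : V -> R) x v : 0 < f x -> differentiable f x ->
  'D_v (fun y => Num.sqrt (f y)) x = 'D_v f x * (2 * Num.sqrt (f x))^-1.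
Proof.
move=> fx df; have [ds eds] := is_derive1_sqrt fx.
have ds' : differentiable (Num.sqrt : R -> R) (f x) by apply/derivable1_diffP.
rewrite [LHS](deriveE v (@differentiable_comp _ _ _ _ f Num.sqrt _ df ds')).
rewrite (diff_comp df ds') /= deriv1E // derive1E eds.
by rewrite deriveE.
Qed.

Lemma Cn_sqrt k (f : V -> R) : (forall x, U x -> 0 < f x) ->
  Cn k f -> Cn k (fun x => Num.sqrt (f x)).
Proof.
move=> f0; elim: k => [|k IH].
  move=> cf x Ux; apply: (@continuous_comp _ _ _ f Num.sqrt); first exact: cf.
  exact: sqrt_continuous.
move=> cf; have [df Df] := cf; split=> [x Ux|v].
  by apply: differentiable_sqrt; [exact: f0|exact: df].
have s0 x : U x -> 2 * Num.sqrt (f x) != 0.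
  by move=> /f0 fx; rewrite mulf_neq0 // gt_eqF ?sqrtr_gt0.
have cV := CnV s0 (CnM (Cn_cst k 2) (IH (CnS cf))).
apply: Cn_eq (CnM (Df v) cV) => x Ux.
by rewrite derive_sqrt_comp //; [exact: f0|exact: df].
Qed.

Lemma Cinf_cst c : Cinf (fun=> c). Proof. by move=> k; exact: Cn_cst. Qed.
Lemma CinfD f g : Cinf f -> Cinf g -> Cinf (fun x => f x + g x).
Proof. by move=> cf cg k; exact: CnD. Qed.
Lemma CinfM f g : Cinf f -> Cinf g -> Cinf (fun x => f x * g x).
Proof. by move=> cf cg k; exact: CnM. Qed.
Lemma Cinf_sum n (f : 'I_n -> V -> R) :
  (forall i, Cinf (f i)) -> Cinf (fun x => \sum_i f i x).
Proof.
move=> cf; elim: n f cf => [|n IH] f cf.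
  by apply: Cinf_eq (Cinf_cst 0) => x _; rewrite big_ord0.
apply: Cinf_eq (CinfD (IH _ (fun i => cf (widen_ord (leqnSn n) i))) (cf ord_max)).
by move=> x _; rewrite big_ord_recr.
Qed.
Lemma Cinf_diff f x : Cinf f -> U x -> differentiable f x.
Proof. by move=> /(_ 1%N) []; auto. Qed.
Lemma Cinf_derive f v : Cinf f -> Cinf (fun x => 'D_v f x).
Proof. by move=> cf k; have [_] := cf k.+1; apply. Qed.
End Cn.

Section Coordinates.
Variables (R : realType) (m n : nat).
Implicit Types (U : set 'rV[R]_m).

Lemma derive_coord (x v : 'rV[R]_m) i : 'D_v (fun y : 'rV[R]_m => y 0 i) x = v 0 i.
Proof.
have h := @derive_mx R _ _ _ id x v (@derivable_id _ _ x v).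
by have := congr1 (fun w : 'rV[R]_m => w 0 i) h; rewrite derive_id mxE.
Qed.

Lemma Cinf_coord U i : open U -> Cinf U (fun y : 'rV[R]_m => y 0 i).
Proof.
move=> oU [|k] /=; first by move=> x _; exact: coord_continuous.
split=> [x _|v]; first exact: differentiable_coord.
by apply: Cn_eq (Cn_cst oU k (v 0 i)) => // x _; rewrite derive_coord.
Qed.

Lemma differentiable_rowP (V : normedModType R) (f : V -> 'rV[R]_n) x :
  differentiable f x <-> forall i, differentiable (fun y => f y 0 i : R) x.
Proof.
split=> [df i|df].
  apply: (@differentiable_comp _ _ _ _ f (fun y : 'rV[R]_n => y 0 i : R)) => //.
  exact: differentiable_coord.
have -> : f = \sum_(i < n) (fun y => f y 0 i *: (delta_mx 0 i : 'rV[R]_n)).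
  by apply/funext => y; rewrite fct_sumE -row_sum_delta.
by apply: differentiable_sum => i; exact: differentiableZl.
Qed.

Lemma derive_row (V : normedModType R) (f : V -> 'rV[R]_n) x v i :
  differentiable f x -> ('D_v f x) 0 i = 'D_v (fun y => f y 0 i) x.
Proof. by move=> df; rewrite derive_mx ?mxE //; exact: diff_derivable. Qed.

Lemma continuous_rowP (V : normedModType R) (f : V -> 'rV[R]_n) x :
  {for x, continuous f} <-> forall i, {for x, continuous (fun y => f y 0 i : R)}.
Proof.
split=> [cf i|cf].
  exact: (@continuous_comp _ _ _ f (fun y : 'rV[R]_n => y 0 i) _ cf (@coord_continuous _ _ _ _ _ _)).
have -> : f = \sum_(i < n) (fun y => f y 0 i *: (delta_mx 0 i : 'rV[R]_n)).
  by apply/funext => y; rewrite fct_sumE -row_sum_delta.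
elim/big_ind : _ => [|g h cg ch|i _]; first exact: cvg_cst.
  exact: continuousD.
by apply: continuousZ; [exact: cf|exact: cvg_cst].
Qed.

Lemma Ck_coord U k (f : 'rV[R]_m -> 'rV[R]_n) : open U ->
  Ck k U f <-> forall i, Cn U k (fun y => f y 0 i).
Proof.
move=> oU; elim: k f => [|k IH] f /=.
  split=> [cf i x Ux|cf x Ux]; first exact: (continuous_rowP _ _).1 (cf x Ux) i.
  by apply/continuous_rowP => i; exact: cf.
split=> [[df Df] i|cf].
  split=> [x Ux|v]; first exact: (differentiable_rowP _ _).1 (df x Ux) i.
  apply: Cn_eq ((IH _).1 (Df v) i) => // x Ux.
  by rewrite derive_row //; exact: df.
have df x : U x -> differentiable f x.
  by move=> Ux; apply/differentiable_rowP => i; have [+ _] := cf i; apply.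
split=> // v; apply/IH => i.
have [_ /(_ v)] := cf i; apply: Cn_eq => // x Ux.
by rewrite derive_row //; exact: df.
Qed.

End Coordinates.

(** * Algebra of the Euclidean scalar product *)

Section Dotp.
Variables (R : realType) (m : nat).
Implicit Types (u v w : 'rV[R]_m) (M : 'M[R]_m) (c : R).

Lemma dotp_mx u v : dotp u v = (u *m v^T) 0 0.
Proof. by rewrite mxE; apply: eq_bigr => i _; rewrite mxE. Qed.

Lemma dotpC u v : dotp u v = dotp v u.
Proof. by apply: eq_bigr => i _; rewrite mulrC. Qed.

Lemma dotpDl u v w : dotp (u + v) w = dotp u w + dotp v w.
Proof. by rewrite !dotp_mx mulmxDl mxE. Qed.
Lemma dotpZl c u w : dotp (c *: u) w = c * dotp u w.
Proof. by rewrite !dotp_mx -scalemxAl mxE. Qed.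
Lemma dotpDr u v w : dotp w (u + v) = dotp w u + dotp w v.
Proof. by rewrite !(dotpC w) dotpDl. Qed.
Lemma dotpZr c u w : dotp w (c *: u) = c * dotp w u.
Proof. by rewrite !(dotpC w) dotpZl. Qed.
Lemma dotpNl u w : dotp (- u) w = - dotp u w.
Proof. by rewrite -scaleN1r dotpZl mulN1r. Qed.
Lemma dotpNr u w : dotp w (- u) = - dotp w u.
Proof. by rewrite !(dotpC w) dotpNl. Qed.
Lemma dotpBl u v w : dotp (u - v) w = dotp u w - dotp v w.
Proof. by rewrite dotpDl dotpNl. Qed.
Lemma dotpBr u v w : dotp w (u - v) = dotp w u - dotp w v.
Proof. by rewrite dotpDr dotpNr. Qed.
Lemma dotp0l w : dotp 0 w = 0.
Proof. by rewrite -(scale0r 0) dotpZl mul0r. Qed.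
Lemma dotp0r w : dotp w 0 = 0.
Proof. by rewrite dotpC dotp0l. Qed.
Lemma dotp_suml n (F : 'I_n -> 'rV[R]_m) w :
  dotp (\sum_i F i) w = \sum_i dotp (F i) w.
Proof. by elim/big_rec2 : _ => [|i y x _ <-]; rewrite ?dotp0l ?dotpDl. Qed.
Lemma dotp_sumr n (F : 'I_n -> 'rV[R]_m) w :
  dotp w (\sum_i F i) = \sum_i dotp w (F i).
Proof. by rewrite dotpC dotp_suml; apply: eq_bigr => i _; rewrite dotpC. Qed.
Lemma dotp_mulmx u v M : dotp (u *m M) v = dotp u (v *m M^T).
Proof. by rewrite !dotp_mx trmx_mul trmxK mulmxA. Qed.

Lemma dotp_ge0 u : 0 <= dotp u u.
Proof. by apply: sumr_ge0 => i _; rewrite -expr2 sqr_ge0. Qed.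

Lemma dotp_eq0 u : (dotp u u == 0) = (u == 0).
Proof.
apply/idP/eqP => [|->]; last by rewrite dotp0l.
rewrite psumr_eq0 => [|i _]; last by rewrite -expr2 sqr_ge0.
move=> /allP h; apply/rowP => i; rewrite mxE.
have := h i (mem_index_enum i).
by rewrite mulf_eq0 orbb => /eqP.
Qed.

Lemma dotp_gt0 u : (0 < dotp u u) = (u != 0).
Proof. by rewrite lt_def dotp_eq0 dotp_ge0 andbT. Qed.

Lemma dotp_skew u M : M^T = - M -> dotp (u *m M) u = 0.
Proof.
move=> sM; have := dotp_mulmx u u M.
rewrite sM mulmxN dotpNr (dotpC u) => h; lra.
Qed.

Lemma dotp_delta u i : dotp u (delta_mx 0 i) = u 0 i.
Proof.
rewrite /dotp (bigD1 i) //= big1 => [|j ji].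
  by rewrite mxE !eqxx mulr1 addr0.
by rewrite mxE (negbTE ji) andbF mulr0.
Qed.

Lemma dotp_CS u v : dotp u v ^+ 2 <= dotp u u * dotp v v.
Proof.
have [->|v0] := eqVneq v 0; first by rewrite !dotp0r expr0n mulr0.
have := dotp_ge0 (dotp v v *: u - dotp u v *: v).
rewrite !(dotpBl, dotpBr, dotpZl, dotpZr) (dotpC v u).
have vv : 0 < dotp v v by rewrite dotp_gt0.
move=> h; rewrite -subr_ge0 -(pmulr_rge0 _ vv); apply: le_trans h _.
rewrite le_eqVlt; apply/orP; left; apply/eqP; ring.
Qed.
End Dotp.

Lemma derive_linear (R : realType) (V W : normedModType R) (F : V -> W) x n
    (a : 'I_n -> R) (v : 'I_n -> V) : differentiable F x ->
  'D_(\sum_i a i *: v i) F x = \sum_i a i *: 'D_(v i) F x.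
Proof.
move=> dF; rewrite deriveE // linear_sum; apply: eq_bigr => i _.
by rewrite linearZ /= deriveE.
Qed.

Lemma deriveDZ (R : realType) (V W : normedModType R) (F : V -> W) x v c w :
  differentiable F x -> 'D_(v + c *: w) F x = 'D_v F x + c *: 'D_w F x.
Proof. by move=> dF; rewrite !(deriveE _ dF) linearD linearZ. Qed.

Lemma derive_comp (R : realType) (U V W : normedModType R) (f : V -> W) (g : U -> V) x v :
  differentiable g x -> differentiable f (g x) ->
  'D_v (f \o g) x = 'D_('D_v g x) f (g x).
Proof.
move=> dg df; rewrite (deriveE v (differentiable_comp dg df)).
by rewrite (deriveE _ df) (deriveE _ dg) (diff_comp dg df).
Qed.

(** * Calculus on the sphere through extensions that are constant along rays *)

Section Sphere.
Variable R : realType.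
Local Notation V4 := 'rV[R]_4.
Local Notation S := (S3 R).
Definition punctured : set V4 := [set x | x != 0].

Lemma open_punctured : open punctured.
Proof.
rewrite openE => x /= x0; apply/(@nbhs_normP R V4); exists `|x|; first by rewrite /= normr_gt0.
move=> y /= h; rewrite /punctured /=; apply/eqP => y0.
by move: h; rewrite /ball_ /= y0 subr0 ltxx.
Qed.

Lemma S3_dotp (p : S) : dotp (val p) (val p) = 1.
Proof. by apply/eqP; exact: (valP p). Qed.

Lemma S3_neq0 (p : S) : punctured (val p).
Proof. by rewrite /punctured /= -dotp_gt0 S3_dotp. Qed.

Definition nrm (x : V4) : R := Num.sqrt (dotp x x).

Lemma nrm_gt0 x : punctured x -> 0 < nrm x.
Proof. by move=> x0; rewrite sqrtr_gt0 dotp_gt0. Qed.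

Lemma nrm_sqr x : nrm x ^+ 2 = dotp x x.
Proof. by rewrite sqr_sqrtr // dotp_ge0. Qed.

Lemma nrm_S3 (p : S) : nrm (val p) = 1.
Proof. by rewrite /nrm S3_dotp sqrtr1. Qed.

Lemma nrmZ c x : 0 <= c -> nrm (c *: x) = c * nrm x.
Proof.
move=> c0; rewrite /nrm dotpZl dotpZr mulrA -expr2 sqrtrM ?sqr_ge0 //.
by rewrite sqrtr_sqr ger0_norm.
Qed.

Lemma val_retract x : punctured x -> val (retract x) = (nrm x)^-1 *: x.
Proof.
move=> x0; rewrite /retract val_insubd dotpZl dotpZr mulrA -expr2.
by rewrite exprVn nrm_sqr mulVf ?eqxx // dotp_eq0.
Qed.

Lemma retract_val (p : S) : retract (val p) = p.
Proof.
by apply: val_inj; rewrite val_retract ?nrm_S3 ?invr1 ?scale1r //; exact: S3_neq0.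
Qed.

Lemma retractZ c (x : V4) : 0 < c -> retract (c *: x) = retract x.
Proof.
move=> c0; have [->|x0] := eqVneq x 0; first by rewrite scaler0.
apply: val_inj; rewrite !val_retract //; last by rewrite /punctured /= scaler_eq0 (gt_eqF c0).
rewrite nrmZ ?ltW // scalerA invfM mulrAC mulVf ?gt_eqF // mul1r //.
Qed.

Definition exts (u : S -> R) (x : V4) : R := u (retract x).
Definition sfun (u : S -> R) := Cinf punctured (exts u).

Lemma extsZ u c x : 0 < c -> exts u (c *: x) = exts u x.
Proof. by move=> c0; rewrite /exts retractZ. Qed.

Lemma exts_val u (p : S) : exts u (val p) = u p.
Proof. by rewrite /exts retract_val. Qed.

(** Scaling the point and the direction together leaves every difference quotient unchanged. *)
Lemma derive_extsZ u c x v : 0 < c ->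
  'D_(c *: v) (exts u) (c *: x) = 'D_v (exts u) x.
Proof.
move=> c0; rewrite /derive.
have -> : (fun h => h^-1 *: ((exts u \o shift (c *: x)) (h *: (c *: v)) - exts u (c *: x))) =
          (fun h => h^-1 *: ((exts u \o shift x) (h *: v) - exts u x)) => //.
apply/funext => h /=.
by rewrite scalerA mulrC -scalerA -scalerDr !extsZ.
Qed.

Lemma derive_exts_radial u x : 'D_x (exts u) x = 0.
Proof.
have h0 : (fun=> 0 : R) @ (0 : R)^' --> (0 : R) by exact: cvg_cst.
rewrite /derive; apply/cvg_lim => //; apply: (cvg_trans _ h0).
apply: near_eq_cvg; near=> h; rewrite /=.
have -> : h *: x + x = (h + 1) *: x by rewrite scalerDl scale1r.
rewrite extsZ ?subrr ?scaler0 //.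
suff : `|h| < 1 by rewrite ltr_norml => /andP[]; lra.
by near: h; exact: dnbhs0_lt.
Unshelve. all: by end_near. Qed.

Lemma sfun_diff u x : sfun u -> punctured x -> differentiable (exts u) x.
Proof. exact: Cinf_diff. Qed.

Lemma sfun_diffp u (p : S) : sfun u -> differentiable (exts u) (val p).
Proof. by move=> su; apply: sfun_diff => //; exact: S3_neq0. Qed.

Lemma sfun_cst c : sfun (fun=> c). Proof. exact: Cinf_cst open_punctured c. Qed.
Lemma sfunD u v : sfun u -> sfun v -> sfun (fun p => u p + v p).
Proof. exact: CinfD open_punctured _ _. Qed.
Lemma sfunM u v : sfun u -> sfun v -> sfun (fun p => u p * v p).
Proof. exact: CinfM open_punctured _ _. Qed.
Lemma sfunN u : sfun u -> sfun (fun p => - u p).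
Proof.
move=> su; have := sfunM (sfun_cst (-1)) su; congr sfun.
by apply/funext => p; rewrite mulN1r.
Qed.
Lemma sfunB u v : sfun u -> sfun v -> sfun (fun p => u p - v p).
Proof. by move=> su sv; apply: sfunD => //; apply: sfunN. Qed.
Lemma sfun_sum n (f : 'I_n -> S -> R) :
  (forall i, sfun (f i)) -> sfun (fun p => \sum_i f i p).
Proof. exact: Cinf_sum open_punctured _ _. Qed.

Definition lie (M : 'M[R]_4) (u : S -> R) (p : S) : R :=
  'D_(val p *m M) (exts u) (val p).

(** The direction [x *m M] scales with [x], so the derivative of a ray-constant extension is again
    ray-constant. This is what allows [lie M] to be iterated and computed away from the sphere. *)
Lemma exts_lie M u x : punctured x -> exts (lie M u) x = 'D_(x *m M) (exts u) x.
Proof.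
move=> x0; rewrite /exts /lie val_retract // -scalemxAl.
by rewrite derive_extsZ // invr_gt0 nrm_gt0.
Qed.

Lemma sfun_lie M u : sfun u -> sfun (lie M u).
Proof.
move=> su; have oU := open_punctured.
have h (i : 'I_4) : Cinf punctured (fun x => (x *m M) 0 i * 'D_(delta_mx 0 i) (exts u) x).
  apply: CinfM => //; last exact: Cinf_derive.
  have h0 : Cinf punctured (fun x => \sum_j x 0 j * M j i).
    by apply: Cinf_sum => // j; apply: CinfM => //; [exact: Cinf_coord|exact: Cinf_cst].
  by apply: Cinf_eq h0 => // x _; rewrite mxE.
apply: Cinf_eq (Cinf_sum oU h) => // x x0.
rewrite exts_lie // [in RHS](row_sum_delta (x *m M)) derive_linear //.
exact: sfun_diff.
Qed.

Lemma derive_extsD u v w (p : S) : sfun u -> sfun v ->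
  'D_w (exts (fun q => u q + v q)) (val p) =
  'D_w (exts u) (val p) + 'D_w (exts v) (val p).
Proof. by move=> su sv; apply: deriveD; apply: diff_derivable; exact: sfun_diffp. Qed.

Lemma derive_extsM u v w (p : S) : sfun u -> sfun v ->
  'D_w (exts (fun q => u q * v q)) (val p) =
  u p * 'D_w (exts v) (val p) + v p * 'D_w (exts u) (val p).
Proof.
move=> su sv; rewrite -[in RHS](exts_val u) -[in RHS](exts_val v).
by apply: deriveM; apply: diff_derivable; exact: sfun_diffp.
Qed.

Lemma derive_exts_cst c w (p : S) : 'D_w (exts (fun=> c)) (val p) = 0.
Proof. exact: derive_cst. Qed.

Lemma lieD M u v : sfun u -> sfun v ->
  lie M (fun q => u q + v q) = (fun q => lie M u q + lie M v q).
Proof. by move=> su sv; apply/funext => p; exact: derive_extsD. Qed.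
Lemma lieM M u v : sfun u -> sfun v ->
  lie M (fun q => u q * v q) = (fun q => u q * lie M v q + v q * lie M u q).
Proof. by move=> su sv; apply/funext => p; exact: derive_extsM. Qed.
Lemma lie_cst M c : lie M (fun=> c) = fun=> 0.
Proof. by apply/funext => p; exact: derive_exts_cst. Qed.
Lemma lieZ M c u : sfun u -> lie M (fun q => c * u q) = (fun q => c * lie M u q).
Proof.
move=> su; rewrite lieM //; last exact: sfun_cst.
by rewrite lie_cst; apply/funext => p; rewrite mulr0 addr0.
Qed.
Lemma lieN M u : sfun u -> lie M (fun q => - u q) = (fun q => - lie M u q).
Proof.
move=> su; have := lieZ M (-1) su.
have -> : (fun q => -1 * u q) = (fun q => - u q) by apply/funext => p; rewrite mulN1r.
by move=> ->; apply/funext => p; rewrite mulN1r.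
Qed.
Lemma lieB M u v : sfun u -> sfun v ->
  lie M (fun q => u q - v q) = (fun q => lie M u q - lie M v q).
Proof. by move=> su sv; rewrite lieD ?lieN //; exact: sfunN. Qed.
Lemma lie_sum M n (f : 'I_n -> S -> R) : (forall i, sfun (f i)) ->
  lie M (fun p => \sum_i f i p) = (fun p => \sum_i lie M (f i) p).
Proof.
move=> sf; elim: n f sf => [|n IH] f sf.
  have -> : (fun p => \sum_i f i p) = fun=> 0 by apply/funext => p; rewrite big_ord0.
  by rewrite lie_cst; apply/funext => p; rewrite big_ord0.
have -> : (fun p => \sum_i f i p) =
  (fun p => (\sum_(i < n) f (widen_ord (leqnSn n) i) p) + f ord_max p).
  by apply/funext => p; rewrite big_ord_recr.
rewrite lieD // ?IH //; last by apply: sfun_sum => i; exact: sf.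
by apply/funext => p; rewrite big_ord_recr.
Qed.

Definition coordS (i : 'I_4) (p : S) : R := val p 0 i.

Lemma Cinf_dotp : Cinf punctured (fun x : V4 => dotp x x).
Proof.
have oU := open_punctured.
apply: Cinf_sum => // i; apply: CinfM => //; exact: Cinf_coord.
Qed.

Lemma Cinf_nrmV : Cinf punctured (fun x : V4 => (nrm x)^-1).
Proof.
have oU := open_punctured; move=> k; apply: CnV => //.
  by move=> x /nrm_gt0 h; rewrite gt_eqF.
by apply: Cn_sqrt => //; [move=> x; rewrite dotp_gt0|exact: Cinf_dotp].
Qed.

Lemma exts_coordS i x : punctured x -> exts (coordS i) x = (nrm x)^-1 * x 0 i.
Proof. by move=> x0; rewrite /exts /coordS val_retract // mxE. Qed.

Lemma sfun_coordS i : sfun (coordS i).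
Proof.
have oU := open_punctured.
apply: Cinf_eq (CinfM oU Cinf_nrmV (@Cinf_coord _ _ _ i oU)) => // x x0.
by rewrite exts_coordS.
Qed.

Lemma derive_dotp (x v : V4) : 'D_v (fun y => dotp y y) x = 2 * dotp x v.
Proof.
have -> : (fun y => dotp y y) = \sum_(i < 4) ((fun y : V4 => y 0 i) * (fun y : V4 => y 0 i)).
  by apply/funext => y; rewrite fct_sumE.
have dc i : derivable (fun y : V4 => y 0 i) x v.
  by apply: diff_derivable; exact: differentiable_coord.
rewrite derive_sum => [|i]; last exact: derivableM.
rewrite /dotp mulr_sumr; apply: eq_bigr => i _.
by rewrite deriveM // derive_coord /GRing.scale /= -mulr2n mulr_natl.
Qed.

Lemma differentiable_dotp (x : V4) : differentiable (fun y => dotp y y) x.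
Proof.
have -> : (fun y => dotp y y) = \sum_(i < 4) ((fun y : V4 => y 0 i) * (fun y : V4 => y 0 i)).
  by apply/funext => y; rewrite fct_sumE.
by apply: differentiable_sum => i; apply: differentiableM; exact: differentiable_coord.
Qed.

Lemma derive_nrm x v : punctured x -> 'D_v nrm x = dotp x v * (nrm x)^-1.
Proof.
move=> x0; rewrite derive_sqrt_comp ?dotp_gt0 //; last exact: differentiable_dotp.
by rewrite derive_dotp invfM mulrACA divff ?mul1r.
Qed.

Lemma differentiable_nrm x : punctured x -> differentiable nrm x.
Proof.
by move=> x0; apply: differentiable_sqrt; rewrite ?dotp_gt0 //; exact: differentiable_dotp.
Qed.

(** The extension of a coordinate is x_i / |x|, and 1 / |x| has zero derivative in directions
    tangent to the sphere. *)
Lemma derive_coordS i (p : S) v : tangent p v -> 'D_v (exts (coordS i)) (val p) = v 0 i.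
Proof.
move=> tv; have p0 := S3_neq0 p.
rewrite (@near_eq_derive _ _ _ _ ((fun x : V4 => (nrm x)^-1) * (fun x : V4 => x 0 i))); last first.
  by apply: (near_open open_punctured) p0 _ => x; exact: exts_coordS.
have dn : derivable nrm (val p) v by apply: diff_derivable; exact: differentiable_nrm.
rewrite deriveM; last 2 first.
- by apply: derivableV => //; rewrite nrm_S3 oner_eq0.
- by apply: diff_derivable; exact: differentiable_coord.
rewrite derive_coord deriveV ?nrm_S3 ?oner_eq0 //.
rewrite derive_nrm // (dotpC _ v) tv mul0r scaler0 invr1 scale1r.
by rewrite scaler0 addr0.
Qed.

Lemma tangent_skew (M : 'M[R]_4) (p : S) : M^T = - M -> tangent p (val p *m M).
Proof. exact: dotp_skew. Qed.

Lemma lie_coordS (M : 'M[R]_4) i : M^T = - M -> lie M (coordS i) = fun p => (val p *m M) 0 i.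
Proof. by move=> sM; apply/funext => p; apply: derive_coordS; exact: tangent_skew. Qed.

End Sphere.

(** * The vertical Jacobi operator in a quaternionic frame *)

Section Orthonormal.
Variables (R : realType) (n : nat) (e : 'I_n -> 'rV[R]_n).
Hypothesis he : forall i j, dotp (e i) (e j) = (i == j)%:R.

(** A square matrix with orthonormal rows has orthonormal columns, since a right inverse is a left
    inverse. *)
Lemma orthonormal_dual a b : \sum_i e i 0 a * e i 0 b = (a == b)%:R.
Proof.
pose B : 'M[R]_n := \matrix_(i, j) e i 0 j.
have BB : B *m B^T = 1%:M.
  apply/matrixP => i j; rewrite !mxE -he; apply: eq_bigr => k _; by rewrite !mxE.
have := congr1 (fun A : 'M[R]_n => A a b) (mulmx1C BB).
by rewrite !mxE => <-; apply: eq_bigr => k _; rewrite !mxE.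
Qed.

Lemma orthonormal_expand v : v = \sum_i dotp v (e i) *: e i.
Proof.
apply/rowP => a; rewrite summxE.
under eq_bigr => i _ do rewrite mxE /dotp mulr_suml.
rewrite exchange_big /= (bigD1 a) //= [X in _ + X]big1 => [|b ba].
  under eq_bigr => i _ do rewrite -mulrA.
  by rewrite -mulr_sumr orthonormal_dual eqxx mulr1 addr0.
under eq_bigr => i _ do rewrite -mulrA.
by rewrite -mulr_sumr orthonormal_dual (negbTE ba) mulr0.
Qed.
End Orthonormal.

Lemma sum_I3 (W : nmodType) (F : 'I_3 -> W) : \sum_k F k = F 0 + F 1 + F 2.
Proof.
rewrite !big_ord_recl big_ord0 addr0 addrA.
by congr (F _ + F _ + F _); exact: val_inj.
Qed.

Section Frame.
Variable R : realType.
Local Notation V4 := 'rV[R]_4.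
Local Notation S := (S3 R).
Implicit Types (p : S) (X a : S -> V4).

Definition sfield (X : S -> V4) := forall i, sfun (fun p => X p 0 i).

Lemma smoothE X : smooth X <-> sfield X.
Proof.
have h k := Ck_coord k (ext X) (@open_punctured R).
split=> [sX i k|sX k]; first by have [+ _] := h k => /(_ (sX k) i).
by have [_] := h k; apply => i; exact: sX.
Qed.

Lemma sfield_diff X p : sfield X -> differentiable (ext X) (val p).
Proof. by move=> sX; apply/differentiable_rowP => i; exact: (sfun_diffp p (sX i)). Qed.

Lemma sdiffE X p v i : sfield X ->
  sdiff X p v 0 i = 'D_v (exts (fun q => X q 0 i)) (val p).
Proof. by move=> sX; rewrite /sdiff derive_row //; exact: sfield_diff. Qed.

Lemma sdiff_sum X p n (c : 'I_n -> R) (v : 'I_n -> V4) : sfield X ->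
  sdiff X p (\sum_k c k *: v k) = \sum_k c k *: sdiff X p (v k).
Proof. by move=> sX; apply: derive_linear; exact: sfield_diff. Qed.

Lemma sfieldD X Y : sfield X -> sfield Y -> sfield (fun p => X p + Y p).
Proof.
move=> sX sY i; have := sfunD (sX i) (sY i); congr sfun.
by apply/funext => p; rewrite mxE.
Qed.
Lemma sfieldZ u X : sfun u -> sfield X -> sfield (fun p => u p *: X p).
Proof.
move=> su sX i; have := sfunM su (sX i); congr sfun.
by apply/funext => p; rewrite mxE.
Qed.
Lemma sfield_sum n (X : 'I_n -> S -> V4) : (forall k, sfield (X k)) ->
  sfield (fun p => \sum_k X k p).
Proof.
move=> sX i; have := sfun_sum (fun k => sX k i); congr sfun.
by apply/funext => p; rewrite summxE.
Qed.
Lemma sfield_val : sfield (fun p => val p).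
Proof. by move=> i; exact: sfun_coordS. Qed.
Lemma sfun_dotp X Y : sfield X -> sfield Y -> sfun (fun p => dotp (X p) (Y p)).
Proof. by move=> sX sY; apply: sfun_sum => i; apply: sfunM. Qed.

(** The ambient derivative along x |-> x M, not projected to the tangent space, so that it can be
    iterated without differentiating projections. *)
Definition lieV (M : 'M[R]_4) X p : V4 := sdiff X p (val p *m M).

Lemma lieVE M X p i : sfield X -> lieV M X p 0 i = lie M (fun q => X q 0 i) p.
Proof. by move=> sX; rewrite /lieV sdiffE. Qed.

Lemma sfield_lieV M X : sfield X -> sfield (lieV M X).
Proof.
move=> sX i; have := sfun_lie M (sX i); congr sfun.
by apply/funext => p; rewrite lieVE.
Qed.

Lemma lieVD M X Y : sfield X -> sfield Y ->
  lieV M (fun p => X p + Y p) = (fun p => lieV M X p + lieV M Y p).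
Proof.
move=> sX sY; apply/funext => p; apply/rowP => i.
rewrite mxE !lieVE //; last exact: sfieldD.
have -> : (fun q => (X q + Y q) 0 i) = (fun q => X q 0 i + Y q 0 i).
  by apply/funext => q; rewrite mxE.
by rewrite lieD.
Qed.
Lemma lieVZ M u X : sfun u -> sfield X ->
  lieV M (fun p => u p *: X p) = (fun p => u p *: lieV M X p + lie M u p *: X p).
Proof.
move=> su sX; apply/funext => p; apply/rowP => i.
rewrite !mxE !lieVE //; last exact: sfieldZ.
have -> : (fun q => (u q *: X q) 0 i) = (fun q => u q * X q 0 i).
  by apply/funext => q; rewrite mxE.
by rewrite lieM // (mulrC (X p 0 i)).
Qed.
Lemma lieV_sum M n (X : 'I_n -> S -> V4) : (forall k, sfield (X k)) ->
  lieV M (fun p => \sum_k X k p) = (fun p => \sum_k lieV M (X k) p).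
Proof.
move=> sX; apply/funext => p; apply/rowP => i.
rewrite lieVE; last exact: sfield_sum.
have -> : (fun q => (\sum_k X k q) 0 i) = (fun q => \sum_k X k q 0 i).
  by apply/funext => q; rewrite summxE.
rewrite lie_sum; last by move=> k; exact: sX.
by rewrite summxE; apply: eq_bigr => k _; rewrite lieVE.
Qed.
Lemma lieV_val M : M^T = - M -> lieV M (fun p => val p) = fun p => val p *m M.
Proof.
move=> sM; apply/funext => p; apply/rowP => i.
rewrite lieVE; last exact: sfield_val.
by rewrite (lie_coordS i sM).
Qed.

Lemma sfield_mul X (N : 'M[R]_4) : sfield X -> sfield (fun p => X p *m N).
Proof.
move=> sX i; have := sfun_sum (fun k => sfunM (sX k) (sfun_cst (N k i))); congr sfun.
by apply/funext => p; rewrite mxE.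
Qed.
Lemma lieV_mul M X (N : 'M[R]_4) : sfield X ->
  lieV M (fun p => X p *m N) = fun p => lieV M X p *m N.
Proof.
move=> sX; apply/funext => p; apply/rowP => i.
rewrite lieVE; last exact: sfield_mul.
have -> : (fun q => (X q *m N) 0 i) = (fun q => \sum_k X q 0 k * N k i).
  by apply/funext => q; rewrite mxE.
rewrite lie_sum => [|k]; last by apply: sfunM => //; exact: sfun_cst.
rewrite mxE; apply: eq_bigr => k _; rewrite lieM //; last exact: sfun_cst.
by rewrite lie_cst mulr0 add0r mulrC lieVE.
Qed.
Lemma lie_dotp M X Y p : sfield X -> sfield Y ->
  lie M (fun q => dotp (X q) (Y q)) p = dotp (X p) (lieV M Y p) + dotp (lieV M X p) (Y p).
Proof.
move=> sX sY; rewrite lie_sum => [|i]; last exact: sfunM.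
rewrite /dotp -big_split /=; apply: eq_bigr => i _.
by rewrite lieM // !lieVE // (mulrC (Y p 0 i)).
Qed.

Lemma tprojD p v w : tproj p (v + w) = tproj p v + tproj p w.
Proof. by rewrite /tproj dotpDl scalerDl opprD addrACA. Qed.
Lemma tprojZ p c v : tproj p (c *: v) = c *: tproj p v.
Proof. by rewrite /tproj dotpZl scalerBr scalerA. Qed.
Lemma tprojN p v : tproj p (- v) = - tproj p v.
Proof. by rewrite -scaleN1r tprojZ scaleN1r. Qed.
Lemma tproj_sum p n (F : 'I_n -> V4) :
  tproj p (\sum_i F i) = \sum_i tproj p (F i).
Proof.
elim/big_rec2 : _ => [|i y x _ <-]; last by rewrite tprojD.
by rewrite /tproj dotp0l scale0r subr0.
Qed.
Lemma tproj_val p : tproj p (val p) = 0.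
Proof. by rewrite /tproj S3_dotp scale1r subrr. Qed.
Lemma tproj_tangent p v : tangent p v -> tproj p v = v.
Proof. by rewrite /tproj => ->; rewrite scale0r subr0. Qed.
Lemma tangent_tproj p v : tangent p (tproj p v).
Proof. by rewrite /tangent /tproj dotpBl dotpZl S3_dotp mulr1 subrr. Qed.
Lemma dotp_tprojl p v w : tangent p w -> dotp (tproj p v) w = dotp v w.
Proof. by move=> tw; rewrite /tproj dotpBl dotpZl (dotpC (val p)) tw mulr0 subr0. Qed.

(** Obtained by differentiating <a(q), q> = 0 along v; this is the second fundamental form of the
    sphere. *)
Lemma dotp_sdiff_val a p v : sfield a -> (forall q, tangent q (a q)) -> tangent p v ->
  dotp (sdiff a p v) (val p) = - dotp (a p) v.
Proof.
move=> sa ta tv; apply/eqP; rewrite -addr_eq0; apply/eqP.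
have h : (fun q => \sum_i a q 0 i * coordS i q) = fun=> 0.
  by apply/funext => q; exact: ta q.
have : 'D_v (exts (fun q => \sum_i a q 0 i * coordS i q)) (val p) = 0.
  by rewrite h; exact: derive_exts_cst.
have -> : exts (fun q => \sum_i a q 0 i * coordS i q) =
  \sum_(i < 4) exts (fun q => a q 0 i * coordS i q) by apply/funext => q; rewrite fct_sumE.
rewrite derive_sum => [|i].
  move=> D0; rewrite /dotp -big_split /= -[RHS]D0; apply: eq_bigr => i _.
  rewrite derive_extsM //; last exact: sfun_coordS.
  by rewrite derive_coordS // -sdiffE // [LHS]addrC [X in _ + X = _]mulrC.
by apply: diff_derivable; apply: sfun_diffp; apply: sfunM => //; exact: sfun_coordS.
Qed.

Section Quaternion.
Variable M : 'I_3 -> 'M[R]_4.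

Hypothesis skM : forall k, (M k)^T = - M k.
Hypothesis sqM : forall k, M k *m M k = - 1%:M.
Hypothesis M01 : M 0 *m M 1 = - M 2.
Hypothesis M12 : M 1 *m M 2 = - M 0.
Hypothesis M20 : M 2 *m M 0 = - M 1.

(** Transposition reverses a product of skew matrices, which yields the three remaining
    relations. *)
Lemma M10 : M 1 *m M 0 = M 2.
Proof. by apply: trmx_inj; rewrite trmx_mul !skM mulmxN mulNmx opprK M01. Qed.
Lemma M21 : M 2 *m M 1 = M 0.
Proof. by apply: trmx_inj; rewrite trmx_mul !skM mulmxN mulNmx opprK M12. Qed.
Lemma M02 : M 0 *m M 2 = M 1.
Proof. by apply: trmx_inj; rewrite trmx_mul !skM mulmxN mulNmx opprK M20. Qed.

Lemma I3P (P : 'I_3 -> Prop) : P 0 -> P 1 -> P 2 -> forall k, P k.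
Proof.
move=> h0 h1 h2 [[|[|[|//]]] hk].
- by have -> : Ordinal hk = 0 by exact: val_inj.
- by have -> : Ordinal hk = 1 by exact: val_inj.
- by have -> : Ordinal hk = 2 by exact: val_inj.
Qed.

Definition qframe (k : 'I_3) (p : S) : V4 := val p *m M k.

Lemma tangent_qframe k p : tangent p (qframe k p).
Proof. exact: tangent_skew. Qed.

(** Moving [M i] across the scalar product leaves <x, x N> with N plus or minus the identity, or
    plus or minus one of the skew matrices, and the latter pair x with a vector orthogonal to it. *)
Lemma dotp_qframe i j p : dotp (qframe i p) (qframe j p) = (i == j)%:R.
Proof.
have nn : dotp (val p) (val p) = 1 := S3_dotp p.
have sk k : dotp (val p) (val p *m M k) = 0 by rewrite dotpC; exact: dotp_skew.
rewrite /qframe dotp_mulmx -mulmxA skM mulmxN.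
move: i; apply: I3P; move: j; apply: I3P => /=;
  rewrite ?sqM ?M01 ?M12 ?M20 ?M10 ?M21 ?M02 ?opprK ?mulmx1 ?mulmxN ?dotpNr ?nn
    ?sk ?oppr0 //.
Qed.

(** The tangent frame completed by the normal vector to an orthonormal basis of R^4. *)
Definition fr4 p (i : 'I_4) : V4 := if unlift 0 i is Some k then qframe k p else val p.

Lemma fr4_orthonormal p i j : dotp (fr4 p i) (fr4 p j) = (i == j)%:R.
Proof.
rewrite /fr4; case: (unliftP 0 i) => [i'|] ->; case: (unliftP 0 j) => [j'|] ->.
- by rewrite dotp_qframe (inj_eq (@lift_inj _ _)).
- by rewrite [LHS]tangent_qframe eq_sym (negbTE (neq_lift _ _)).
- by rewrite dotpC [LHS]tangent_qframe (negbTE (neq_lift _ _)).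
- by rewrite S3_dotp eqxx.
Qed.

Lemma tangent_expand p v : tangent p v -> v = \sum_k dotp v (qframe k p) *: qframe k p.
Proof.
move=> tv; rewrite [LHS](orthonormal_expand (fr4_orthonormal p)) big_ord_recl.
rewrite {1}/fr4 unlift_none tv scale0r add0r.
by apply: eq_bigr => k _; rewrite /fr4 liftK.
Qed.

Lemma sfield_qframe k : sfield (qframe k).
Proof. by apply: sfield_mul; exact: sfield_val. Qed.

Lemma lieV_qframe m k : lieV (M m) (qframe k) = fun p => val p *m M m *m M k.
Proof. by rewrite /qframe lieV_mul ?lieV_val //; exact: sfield_val. Qed.

Lemma covdE V a p : sfield a -> tangent p (V p) ->
  covd V a p = tproj p (\sum_k dotp (V p) (qframe k p) *: lieV (M k) a p).
Proof. by move=> sa tV; rewrite /covd {1}(tangent_expand tV) sdiff_sum. Qed.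

(** The projection is written out as an explicit normal term, because this expression is to be
    differentiated a second time. *)
Lemma covdE' V a p : sfield a -> (forall q, tangent q (a q)) -> tangent p (V p) ->
  covd V a p = (\sum_k dotp (V p) (qframe k p) *: lieV (M k) a p) + dotp (a p) (V p) *: val p.
Proof.
move=> sa ta tV; rewrite /covd /tproj dotp_sdiff_val // scaleNr opprK.
by rewrite {1}(tangent_expand tV) sdiff_sum.
Qed.

(* The derivatives of E cancel: the second covariant derivative is tensorial in E. *)
Lemma hess_term E a p : sfield E -> (forall q, tangent q (E q)) ->
  sfield a -> (forall q, tangent q (a q)) ->
  covd E (covd E a) p - covd (covd E E) a p =
  tproj p (\sum_m \sum_k (dotp (E p) (qframe m p) * dotp (E p) (qframe k p)) *:
              lieV (M m) (lieV (M k) a) p) + dotp (a p) (E p) *: E p.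
Proof.
move=> sE tE sa ta.
pose e k q := dotp (E q) (qframe k q).
have se k : sfun (e k) by apply: sfun_dotp => //; exact: sfield_qframe.
have saE : sfun (fun q => dotp (a q) (E q)) by exact: sfun_dotp.
have cE : covd E a = fun q => (\sum_k e k q *: lieV (M k) a q) + dotp (a q) (E q) *: val q.
  by apply/funext => q; rewrite covdE'.
have sk k : sfield (fun q => e k q *: lieV (M k) a q).
  by apply: sfieldZ => //; exact: sfield_lieV.
have sx : sfield (fun q => dotp (a q) (E q) *: val q).
  by apply: sfieldZ => //; exact: sfield_val.
have sca : sfield (covd E a) by rewrite cE; apply: sfieldD => //; exact: sfield_sum.
have Lc m : lieV (M m) (covd E a) p =
   (\sum_k (e k p *: lieV (M m) (lieV (M k) a) p + lie (M m) (e k) p *: lieV (M k) a p))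
   + (dotp (a p) (E p) *: qframe m p + lie (M m) (fun q => dotp (a q) (E q)) p *: val p).
  rewrite cE lieVD //; last exact: sfield_sum.
  rewrite lieV_sum // lieVZ ?lieV_val //; last exact: sfield_val.
  congr (_ + _); apply: eq_bigr => k _; rewrite lieVZ //; exact: sfield_lieV.
have eL k : dotp (covd E E p) (qframe k p) = \sum_m e m p * lie (M m) (e k) p.
  rewrite covdE // dotp_tprojl; last exact: tangent_qframe.
  rewrite dotp_suml.
  transitivity (\sum_m (e m p * lie (M m) (e k) p - e m p * dotp (E p) (val p *m M m *m M k))).
    apply: eq_bigr => m _; rewrite dotpZl -mulrBr; congr (_ * _).
    rewrite /e lie_dotp //; last exact: sfield_qframe.
    by rewrite lieV_qframe; ring.
  rewrite sumrB [X in _ - X](_ : _ = 0) ?subr0 //.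
  (* The derivatives of the frame itself add up to <E, E M_k>, which is zero as M_k is skew. *)
  transitivity (dotp (E p) (E p *m M k)); last by rewrite dotpC; exact: dotp_skew.
  rewrite [in X in dotp _ X](tangent_expand (tE p)) mulmx_suml dotp_sumr.
  by apply: eq_bigr => m _; rewrite -scalemxAl dotpZr.
rewrite covdE //.
have -> : covd (covd E E) a p = tproj p (\sum_k \sum_m (e m p * lie (M m) (e k) p) *: lieV (M k) a p).
  rewrite covdE //; last exact: tangent_tproj.
  by congr tproj; apply: eq_bigr => k _; rewrite eL scaler_suml.
have -> : dotp (a p) (E p) *: E p =
    tproj p (\sum_m e m p *: (dotp (a p) (E p) *: qframe m p + lie (M m) (fun q => dotp (a q) (E q)) p *: val p)).
  rewrite tproj_sum [X in _ *: X = _](tangent_expand (tE p)) scaler_sumr.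
  apply: eq_bigr => m _; rewrite tprojZ tprojD !tprojZ tproj_val scaler0 addr0.
  rewrite tproj_tangent; last exact: tangent_qframe.
  by rewrite !scalerA (mulrC (dotp (a p) (E p))).
apply/eqP; rewrite subr_eq; apply/eqP.
rewrite -!tprojD; congr tproj.
rewrite [X in _ = _ + X]exchange_big /= -!big_split /=; apply: eq_bigr => m _.
rewrite Lc scalerDr addrAC; congr (_ + _).
rewrite scaler_sumr -big_split /=; apply: eq_bigr => k _.
by rewrite scalerDr !scalerA.
Qed.

Section WithFrame.
Variable E : 'I_3 -> S -> V4.
Hypothesis hE : orthonormal_frame E.

Let sE j : sfield (E j). Proof. by apply/smoothE; exact: (hE.1 j).1. Qed.
Let tE j q : tangent q (E j q). Proof. exact: (hE.1 j).2. Qed.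

(** The transition matrix between [E] and the quaternionic frame is orthogonal, so its columns are
    orthonormal as well. *)
Lemma frame_dual p m k :
  \sum_j dotp (E j p) (qframe m p) * dotp (E j p) (qframe k p) = (m == k)%:R.
Proof.
pose e (j : 'I_3) : 'rV[R]_3 := \row_k dotp (E j p) (qframe k p).
have he i j : dotp (e i) (e j) = (i == j)%:R.
  rewrite -(hE.2 p) [in RHS](tangent_expand (tE i p)) dotp_suml.
  by apply: eq_bigr => l _; rewrite !mxE dotpZl (dotpC (qframe l p)).
by rewrite -(orthonormal_dual he); apply: eq_bigr => j _; rewrite !mxE.
Qed.

(** A trace does not depend on the orthonormal frame: this replaces the given [E] by [qframe] in the
    rough Laplacian and in [nabla_dot]. *)
Lemma frame_trace (W : lmodType R) p (F : 'I_3 -> 'I_3 -> W) :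
  \sum_j \sum_m \sum_k (dotp (E j p) (qframe m p) * dotp (E j p) (qframe k p)) *: F m k
  = \sum_k F k k.
Proof.
rewrite exchange_big /=; apply: eq_bigr => m _.
rewrite exchange_big /= (bigD1 m) //= -scaler_suml frame_dual eqxx scale1r.
rewrite big1 ?addr0 // => k km.
by rewrite -scaler_suml frame_dual eq_sym (negbTE km) scale0r.
Qed.

Lemma rough_laplacianE a p : sfield a -> (forall q, tangent q (a q)) ->
  rough_laplacian E a p =
  - (tproj p (\sum_k lieV (M k) (lieV (M k) a) p) + a p).
Proof.
move=> sa ta; rewrite /rough_laplacian; congr (- _).
under eq_bigr => j _ do rewrite (hess_term p (sE j) (tE j) sa ta).
rewrite big_split /= -tproj_sum frame_trace; congr (_ + _).
transitivity (\sum_j \sum_m \sum_k (dotp (E j p) (qframe m p) * dotp (E j p) (qframe k p)) *: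
   (dotp (a p) (qframe m p) *: qframe k p)).
  apply: eq_bigr => j _; rewrite [in LHS](tangent_expand (tE j p)) dotp_sumr.
  rewrite scaler_suml; apply: eq_bigr => m _.
  rewrite scaler_sumr; apply: eq_bigr => k _.
  by rewrite !scalerA dotpZr mulrAC.
by rewrite frame_trace -(tangent_expand (ta p)).
Qed.

Lemma nabla_dotE s a p : sfield s -> sfield a ->
  nabla_dot E s a p =
  \sum_k dotp (tproj p (lieV (M k) s p)) (tproj p (lieV (M k) a p)).
Proof.
move=> ss sa; rewrite -(@frame_trace R^o p (fun m k =>
   dotp (tproj p (lieV (M m) s p)) (tproj p (lieV (M k) a p)))).
apply: eq_bigr => j _; rewrite !covdE //.
rewrite !tproj_sum dotp_suml; apply: eq_bigr => m _.
rewrite dotp_sumr; apply: eq_bigr => k _.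
by rewrite !tprojZ dotpZl dotpZr mulrA.
Qed.

(** Along x M_0 the derivative of the Hopf field is - x, which is normal; along x M_1 and x M_2 it
    is x M_2 and - x M_1, of norm one each. *)
Lemma nabla_dot_hopf p : nabla_dot E (qframe 0) (qframe 0) p = 2.
Proof.
rewrite nabla_dotE; try exact: sfield_qframe.
rewrite sum_I3 !lieV_qframe /=.
rewrite -!mulmxA sqM M10 M20 !mulmxN mulmx1.
rewrite -scaleN1r -(scaleN1r (_ *m M 1)) !tprojZ tproj_val scaler0 dotp0l add0r.
rewrite !(tproj_tangent (tangent_qframe _ p)) -/(qframe 1 p) -/(qframe 2 p).
by rewrite dotpZl dotpZr !dotp_qframe !eqxx mulN1r mulN1r opprK.
Qed.

Definition vf (f g : S -> R) : S -> V4 := fun p => f p *: qframe 1 p + g p *: qframe 2 p.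

Definition lap (u : S -> R) (p : S) : R := - \sum_k lie (M k) (lie (M k) u) p.

Lemma sfield_vf f g : sfun f -> sfun g -> sfield (vf f g).
Proof. by move=> sf sg; apply: sfieldD; apply: sfieldZ => //; exact: sfield_qframe. Qed.

Lemma tangent_vf f g p : tangent p (vf f g p).
Proof. by rewrite /tangent dotpDl !dotpZl !tangent_qframe !mulr0 addr0. Qed.

Lemma lieV_vf f g k : sfun f -> sfun g -> lieV (M k) (vf f g) =
  fun p => (f p *: (val p *m M k *m M 1) + lie (M k) f p *: qframe 1 p) +
           (g p *: (val p *m M k *m M 2) + lie (M k) g p *: qframe 2 p).
Proof.
move=> sf sg; rewrite lieVD; try by apply: sfieldZ => //; exact: sfield_qframe.
by apply/funext => p; rewrite !lieVZ ?lieV_qframe //; exact: sfield_qframe.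
Qed.

(** The Leibniz rule twice; the terms [- f p] and [- g p] come from M_k^2 = -1. *)
Lemma lieV2_vf f g k p : sfun f -> sfun g -> lieV (M k) (lieV (M k) (vf f g)) p =
  (lie (M k) (lie (M k) f) p - f p) *: qframe 1 p + (lie (M k) (lie (M k) g) p - g p) *: qframe 2 p
  + (2 * lie (M k) f p) *: (val p *m M k *m M 1)
  + (2 * lie (M k) g p) *: (val p *m M k *m M 2).
Proof.
move=> sf sg; rewrite lieV_vf //.
have sv := @sfield_val.
have sm l m : sfield (fun p => val p *m M l *m M m) by do 2![apply: sfield_mul].
have sL u : sfun u -> sfun (lie (M k) u) by exact: sfun_lie.
have h u m : sfun u -> lieV (M k) (fun p => u p *: (val p *m M k *m M m) + lie (M k) u p *: qframe m p) p
   = (lie (M k) (lie (M k) u) p - u p) *: qframe m p + (2 * lie (M k) u p) *: (val p *m M k *m M m).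
  move=> su; rewrite lieVD; try by apply: sfieldZ; auto; exact: sfield_qframe.
  rewrite !lieVZ ?lieV_qframe; auto; last exact: sfield_qframe.
  rewrite lieV_mul; last exact: sfield_mul.
  rewrite lieV_mul // lieV_val // -[val p *m M k *m M k]mulmxA sqM mulmxN mulmx1 mulNmx.
  rewrite -/(qframe m p); move: (qframe m p) (val p *m M k *m M m) => y z.
  by apply/rowP => i; rewrite !mxE; ring.
rewrite lieVD; try by apply: sfieldD; apply: sfieldZ; auto; exact: sfield_qframe.
by rewrite !h // addrACA !addrA.
Qed.

(** The terms of order zero cancel: the three second derivatives and the trace of the second
    fundamental form leave 2a in the rough Laplacian, and |nabla s|^2 = 2. The components along s,
    produced by M_2 M_1 = M_0 and M_1 M_2 = - M_0, are removed by the last term of the operator.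
    What couples f and g is M_0 M_1 = - M_2 and M_0 M_2 = M_1. *)
Lemma vjacobi_vf f g : sfun f -> sfun g ->
  vjacobi E (qframe 0) (vf f g) =
  vf (fun p => lap f p - 2 * lie (M 0) g p) (fun p => lap g p + 2 * lie (M 0) f p).
Proof.
move=> sf sg; apply/funext => p; rewrite /vjacobi nabla_dot_hopf.
rewrite rough_laplacianE; [|exact: sfield_vf|by move=> q; exact: tangent_vf].
rewrite nabla_dotE; [|exact: sfield_qframe|exact: sfield_vf].
rewrite {2}/vf /lap.
under eq_bigr => k _ do rewrite lieV2_vf //.
under [X in _ - _ - (2 * X) *: _]eq_bigr => k _ do rewrite lieV_qframe lieV_vf //.
rewrite !sum_I3 -!mulmxA !sqM ?M10 ?M20 ?M01 ?M12 ?M21 ?M02 !mulmxN ?mulmx1.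
rewrite -/(qframe 0 p) -/(qframe 1 p) -/(qframe 2 p).
have tb k : tproj p (qframe k p) = qframe k p := tproj_tangent (tangent_qframe k p).
rewrite /vf /= 2!sum_I3.
move: (tb 0) (tb 1) (tb 2) (dotp_qframe 2 1 p) (dotp_qframe 2 2 p) (dotp_qframe 1 1 p) (dotp_qframe 1 2 p)
  (dotp_qframe 2 0 p) (dotp_qframe 1 0 p).
move: (qframe 0 p) (qframe 1 p) (qframe 2 p) (f p) (g p) => x y z fp gp.
move: (lie _ (lie (M 0) f) p) (lie _ (lie (M 1) f) p) (lie _ (lie (M 2) f) p).
move: (lie _ (lie (M 0) g) p) (lie _ (lie (M 1) g) p) (lie _ (lie (M 2) g) p).
move: (lie _ f p) (lie _ f p) (lie _ f p) (lie _ g p) (lie _ g p) (lie _ g p).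
move=> f0 f1 f2 g0 g1 g2 g00 g11 g22 f00 f11 f22 tx ty tz zy zz yy yz zx yx.
rewrite !(tprojD, tprojZ, tprojN) !tproj_val !(tx, ty, tz) !(scaler0, oppr0, addr0, add0r, dotp0l).
rewrite !(dotpNl, dotpDr, dotpZr, dotpNr) !(zy, zz, yy, yz, zx, yx) /=.
by apply/rowP => i; rewrite !mxE; ring.
Qed.

End WithFrame.
End Quaternion.
End Frame.

(** * Isometries of the sphere are linear *)

Lemma is_derive_line (R : realType) (V : normedModType R) (f : V -> R) x v (t : R) :
  differentiable f (t *: v + x) ->
  is_derive t 1 (fun s => f (s *: v + x)) ('D_v f (t *: v + x)).
Proof.
move=> df; have dv : derivable f (t *: v + x) v by exact: diff_derivable.
have e : (fun h => h^-1 *: (((fun s => f (s *: v + x)) \o shift t) (h *: (1 : R)) - f (t *: v + x))) =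
         (fun h => h^-1 *: ((f \o shift (t *: v + x)) (h *: v) - f (t *: v + x))).
  apply/funext => h /=; congr (_ *: (f _ - _)).
  by rewrite [_%:A]mulr1 scalerDl addrA.
split; first by rewrite /derivable e.
by rewrite /derive e.
Qed.

Section Isometry.
Variable R : realType.
Local Notation V4 := 'rV[R]_4.
Local Notation S := (S3 R).

(** The extension is constant along rays, so the normal part of the direction contributes
    nothing. *)
Lemma sdiff_tproj (X : S -> V4) p v : sfield X -> sdiff X p v = sdiff X p (tproj p v).
Proof.
move=> sX; have dX := sfield_diff p sX.
have r : sdiff X p (val p) = 0.
  by apply/rowP => i; rewrite sdiffE // mxE derive_exts_radial.
have {1}-> : v = tproj p v + dotp v (val p) *: val p by rewrite /tproj subrK.
by rewrite /sdiff (deriveDZ _ _ _ dX) -/(sdiff _ _ _) -/(sdiff _ _ _) r scaler0 addr0.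
Qed.

Section Contraction.
Variable F : S -> V4.
Hypothesis sF : sfield F.
Hypothesis F1 : forall p, dotp (F p) (F p) = 1.
Hypothesis dF : forall p v, tangent p v -> dotp (sdiff F p v) (sdiff F p v) = dotp v v.

Let dF_orth p v : dotp (F p) (sdiff F p v) = 0.
Proof.
have : 'D_v (exts (fun q => \sum_i F q 0 i * F q 0 i)) (val p) = 0.
  have -> : (fun q => \sum_i F q 0 i * F q 0 i) = fun=> 1 by apply/funext => q; exact: F1.
  exact: derive_exts_cst.
have -> : exts (fun q => \sum_i F q 0 i * F q 0 i) =
  \sum_(i < 4) exts (fun q => F q 0 i * F q 0 i) by apply/funext => q; rewrite fct_sumE.
rewrite derive_sum => [|i]; last first.
  by apply: diff_derivable; apply: sfun_diffp; apply: sfunM.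
move=> h; suff : dotp (F p) (sdiff F p v) + dotp (F p) (sdiff F p v) = 0 by lra.
rewrite -[RHS]h /dotp -big_split /=; apply: eq_bigr => i _.
by rewrite derive_extsM // sdiffE.
Qed.

(* The map x |-> |x| F(x/|x|) is a Euclidean contraction along segments that
   avoid the origin; its component along u is differentiated here. *)
Let cone_derive (u x v : V4) : punctured x ->
  'D_v (fun y => nrm y * exts (fun q => dotp (F q) u) y) x ^+ 2 <= dotp v v * dotp u u.
Proof.
move=> x0; set G := fun q : S3 R => dotp (F q) u; pose p := retract x.
have sG : sfun G by apply: sfun_sum => i; apply: sfunM => //; exact: sfun_cst.
have dn : derivable (@nrm R) x v by apply: diff_derivable; exact: differentiable_nrm.
have dG : derivable (exts G) x v by apply: diff_derivable; exact: sfun_diff.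
have r0 := nrm_gt0 x0.
pose w := dotp (val p) v *: F p + sdiff F p v.
have -> : 'D_v (fun y => nrm y * exts G y) x = dotp w u.
  rewrite [LHS](deriveM dn dG) derive_nrm // dotpDl dotpZl addrC; congr (_ + _).
    have -> : dotp (val p) v = dotp x v * (nrm x)^-1 by rewrite val_retract // dotpZl mulrC.
    exact: mulrC.
  have := derive_extsZ G x v (_ : 0 < (nrm x)^-1); rewrite invr_gt0 => /(_ r0) <-.
  rewrite -val_retract // -/p.
  have -> : dotp (sdiff F p v) u = 'D_v (exts G) (val p).
    have -> : exts G = \sum_(i < 4) exts (fun q => F q 0 i * u 0 i).
      by apply/funext => q; rewrite fct_sumE.
    rewrite derive_sum => [|i]; last first.
      apply: diff_derivable; apply: sfun_diffp; apply: sfunM => //; exact: sfun_cst.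
    apply: eq_bigr => i _; rewrite derive_extsM //; last exact: sfun_cst.
    by rewrite derive_exts_cst mulr0 add0r mulrC sdiffE.
  have dGp := sfun_diffp p sG.
  rewrite -[(nrm x)^-1 *: v]add0r (deriveDZ _ _ _ dGp) derive0 add0r.
  by rewrite /GRing.scale /= mulrA divff ?mul1r // gt_eqF.
(* The radial and the tangential part of w are orthogonal, the first because F has unit length, and
   each has the norm of the corresponding part of v; Cauchy-Schwarz then gives the bound. *)
have <- : dotp w w = dotp v v; last exact: dotp_CS.
rewrite /w !(dotpDl, dotpDr, dotpZl, dotpZr) F1 (dotpC _ (F p)) dF_orth.
rewrite sdiff_tproj // dF; last exact: tangent_tproj.
rewrite /tproj !(dotpBl, dotpBr, dotpZl, dotpZr) S3_dotp (dotpC v); ring.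
Qed.

(** The hypothesis excludes antipodal points, so the segment from p to q misses the origin. The mean
    value theorem for the component along u = F q - F p gives |u| <= |q - p|, which for unit vectors
    is the stated inequality. *)
Lemma contraction_dotp p q : -1 < dotp (val p) (val q) ->
  dotp (val p) (val q) <= dotp (F p) (F q).
Proof.
move=> pq.
set x := val p; set v := val q - val p; set u := F q - F p.
pose H y := nrm y * exts (fun q => dotp (F q) u) y.
have sG : sfun (fun q => dotp (F q) u).
  by apply: sfun_sum => i; apply: sfunM => //; exact: sfun_cst.
(* With c = <p, q>, the squared norm on the segment is 1 - 2 t (1 - t) (1 - c), and t (1 - t) <= 1/4
   bounds it below by (1 + c) / 2 > 0 when c <= 1. *)
have seg t : t \in `[(0:R), 1] -> punctured (t *: v + x).
  rewrite in_itv /= => /andP[t0 t1].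
  rewrite /punctured /= -dotp_gt0 /v /x !(dotpDl, dotpDr, dotpNl, dotpNr, dotpZl, dotpZr).
  rewrite !S3_dotp (dotpC (val q)); move: pq; move: (dotp _ _) => c pq.
  have h : t * (1 - t) <= 1 / 4.
    by rewrite -subr_ge0; have := sqr_ge0 (2 * t - 1); rewrite expr2; lra.
  have h' : 0 <= t * (1 - t) by rewrite mulr_ge0 ?subr_ge0.
  have [c1|c1] := leP c 1; last first.
    have : 0 <= t * (1 - t) * (c - 1) by rewrite mulr_ge0 // subr_ge0 ltW.
    by lra.
  suff : t * (1 - t) * (1 - c) <= 1 / 4 * (1 - c) by lra.
  by apply: ler_wpM2r => //; rewrite subr_ge0.
pose h (t : R) := H (t *: v + x); pose dh (t : R) := 'D_v H (t *: v + x).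
have dH t : t \in `[(0:R), 1] -> is_derive t 1 h (dh t).
  move=> /seg st; apply: is_derive_line; apply: differentiableM.
    exact: differentiable_nrm.
  exact: sfun_diff.
have ch : {within `[(0:R), 1], continuous h}.
  apply: derivable_within_continuous => t tI; by have [] := dH t tI.
have dH' t : t \in `](0:R), 1[ -> is_derive t 1 h (dh t).
  by move=> tI; apply: dH; apply: subset_itv_oo_cc.
have [c cI] := MVT_segment ler01 dH' ch.
rewrite /h /dh.
rewrite subr0 mulr1 scale0r scale1r add0r /v subrK => e.
have := cone_derive u v (seg _ cI); rewrite -/H /v -e.
rewrite /H !nrm_S3 !mul1r !exts_val -dotpBl -/u -/v.
have uu := dotp_ge0 u; rewrite expr2 => hu.
have : dotp u u <= dotp v v.
  have [u0|u0] := eqVneq (dotp u u) 0; first by rewrite u0; exact: dotp_ge0.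
  by rewrite -(ler_pM2r (_ : 0 < dotp u u)) // lt_def u0.
rewrite /u /v !(dotpBl, dotpBr) !F1 !S3_dotp (dotpC (F q)) (dotpC (val q)); lra.
Qed.
End Contraction.

Lemma sdiff_val p v : tangent p v -> sdiff (fun q : S => val q) p v = v.
Proof.
move=> tv; apply/rowP => i; rewrite sdiffE; last exact: sfield_val.
exact: derive_coordS.
Qed.

Lemma sdiff_comp (f g : S -> S) p v :
  sfield (fun q => val (f q)) -> sfield (fun q => val (g q)) ->
  sdiff (fun q => val (f (g q))) p v =
  sdiff (fun q => val (f q)) (g p) (sdiff (fun q => val (g q)) p v).
Proof.
move=> sf sg; have df := sfield_diff (g p) sf; have dg := sfield_diff p sg.
have gp : ext (fun q => val (g q)) (val p) = val (g p) by rewrite /ext retract_val.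
rewrite -gp in df.
have e : ext (fun q => val (f (g q))) =
    ext (fun q => val (f q)) \o ext (fun q => val (g q)).
  by apply/funext => x; rewrite /ext /= retract_val.
by rewrite /sdiff e (derive_comp _ dg df) gp.
Qed.

Lemma dotp_S3_ge (p q : S) : -1 <= dotp (val p) (val q).
Proof.
have := dotp_ge0 (val p + val q).
by rewrite !(dotpDl, dotpDr) !S3_dotp (dotpC (val q)) => ?; lra.
Qed.

Lemma sdiff_tangent (f : S -> S) p v : sfield (fun q => val (f q)) ->
  tangent (f p) (sdiff (fun q => val (f q)) p v).
Proof.
move=> sf; rewrite /tangent dotpC.
have h : (fun q => dotp (val (f q)) (val (f q))) = fun=> 1.
  by apply/funext => q; rewrite S3_dotp.
have : 'D_v (exts (fun q => \sum_i val (f q) 0 i * val (f q) 0 i)) (val p) = 0.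
  rewrite -[fun q => _]/(fun q => dotp (val (f q)) (val (f q))) h; exact: derive_exts_cst.
have -> : exts (fun q => \sum_i val (f q) 0 i * val (f q) 0 i) =
  \sum_(i < 4) exts (fun q => val (f q) 0 i * val (f q) 0 i).
  by apply/funext => q; rewrite fct_sumE.
have sfi i : sfun (fun q => val (f q) 0 i) by exact: sf.
rewrite derive_sum => [|i]; last first.
  by apply: diff_derivable; apply: sfun_diffp; apply: sfunM.
move=> h0; set d := dotp _ _; suff : d + d = 0 by lra.
rewrite -[RHS]h0 /d /dotp -big_split /=; apply: eq_bigr => i _.
rewrite derive_extsM // sdiffE //.
Qed.

(** The inverse preserves the metric too, by the chain rule on f o g = id, so the contraction
    estimate holds in both directions. *)
Lemma isometry_dotp (f : S -> S) : Defs.isometry f ->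
  forall p q, dotp (val (f p)) (val (f q)) = dotp (val p) (val q).
Proof.
move=> [/smoothE sf [g [/smoothE sg fg gf]] If].
have cf := @contraction_dotp (fun q => val (f q)) sf (fun p => S3_dotp (f p)) (fun p v tv => If p v v tv tv).
have Ig p v : tangent p v ->
    dotp (sdiff (fun q => val (g q)) p v) (sdiff (fun q => val (g q)) p v) = dotp v v.
  move=> tv; set w := sdiff _ _ _.
  have tw : tangent (g p) w by exact: sdiff_tangent.
  rewrite -(If _ _ _ tw tw) /w -sdiff_comp //.
  have -> : (fun q => val (f (g q))) = (fun q => val q) by apply/funext => q; rewrite gf.
  by rewrite sdiff_val.
have cg := @contraction_dotp (fun q => val (g q)) sg (fun p => S3_dotp (g p)) Ig.
(* Antipodal pairs escape the estimate for f. If <p, q> = -1 and <f p, f q> > -1, the estimate for g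
   yields <f p, f q> <= <p, q>. *)
move=> p q; have := dotp_S3_ge p q; rewrite le_eqVlt => /orP[/eqP e|h].
  have := dotp_S3_ge (f p) (f q); rewrite le_eqVlt => /orP[/eqP <- //|h'].
  have := cg _ _ h'; rewrite !fg => ?; apply/eqP; rewrite eq_le -e.
  by lra.
have h1 := cf _ _ h; have h2 := cg _ _ (lt_le_trans h h1); rewrite !fg in h2.
by apply/eqP; rewrite eq_le h1 h2.
Qed.

Lemma dotp_deltas (i j : 'I_4) :
  dotp (delta_mx 0 i : V4) (delta_mx 0 j) = (i == j)%:R.
Proof. by rewrite dotp_delta mxE eqxx eq_sym. Qed.

Lemma delta_S3 (i : 'I_4) : dotp (delta_mx 0 i : V4) (delta_mx 0 i) == 1.
Proof. by rewrite dotp_deltas eqxx. Qed.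

(** The images of the standard basis are orthonormal, and the coefficients of f p in that basis are
    <f p, f e_i> = <p, e_i>, the coordinates of p. *)
Lemma isometry_linear (f : S -> S) : Defs.isometry f ->
  exists2 O : 'M[R]_4, O *m O^T = 1%:M & forall p, val (f p) = val p *m O.
Proof.
move=> /isometry_dotp If.
pose e i : S := Sub (delta_mx 0 i) (delta_S3 i).
have he i j : dotp (val (f (e i))) (val (f (e j))) = (i == j)%:R.
  by rewrite If dotp_deltas.
exists (\matrix_i val (f (e i))).
  apply/matrixP => i j; rewrite !mxE -he.
  by apply: eq_bigr => k _; rewrite !mxE.
move=> p; rewrite [LHS](orthonormal_expand he) mulmx_sum_row.
by apply: eq_bigr => i _; rewrite rowK If dotp_delta.
Qed.

(* Left multiplications by the quaternions i, j, k; matrices act on row vectors from the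
   right, so that products come in reverse order: quat1 *m quat2 = - quat3. *)
Definition quat1 : 'M[R]_4 := \matrix_(i, j)
  nth 0 (nth [::] [:: [:: 0; 1; 0; 0]; [:: -1; 0; 0; 0]; [:: 0; 0; 0; 1]; [:: 0; 0; -1; 0]] i) j.
Definition quat2 : 'M[R]_4 := \matrix_(i, j)
  nth 0 (nth [::] [:: [:: 0; 0; 1; 0]; [:: 0; 0; 0; -1]; [:: -1; 0; 0; 0]; [:: 0; 1; 0; 0]] i) j.
Definition quat3 : 'M[R]_4 := \matrix_(i, j)
  nth 0 (nth [::] [:: [:: 0; 0; 0; 1]; [:: 0; 0; 1; 0]; [:: 0; -1; 0; 0]; [:: -1; 0; 0; 0]] i) j.

Definition Iq (k : 'I_3) : 'M[R]_4 := nth 0 [:: quat1; quat2; quat3] k.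

Ltac mx4 := apply/matrixP;
  do 2![case=> [[|[|[|[|//]]]] ?]]; rewrite ?mxE ?big_ord_recl ?big_ord0 ?mxE /=; ring.

Lemma Iq_sk k : (Iq k)^T = - Iq k.
Proof. move: k; apply: I3P; rewrite /Iq /=; mx4. Qed.
Lemma Iq_sq k : Iq k *m Iq k = - 1%:M.
Proof. move: k; apply: I3P; rewrite /Iq /=; mx4. Qed.
Lemma Iq01 : Iq 0 *m Iq 1 = - Iq 2. Proof. rewrite /Iq /=; mx4. Qed.
Lemma Iq12 : Iq 1 *m Iq 2 = - Iq 0. Proof. rewrite /Iq /=; mx4. Qed.
Lemma Iq20 : Iq 2 *m Iq 0 = - Iq 1. Proof. rewrite /Iq /=; mx4. Qed.

Lemma mul_iE (x : V4) : mul_i x = x *m Iq 0.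
Proof.
apply/rowP; case=> [[|[|[|[|//]]]] i4]; rewrite !mxE !big_ord_recl big_ord0 !mxE /=.
all: rewrite ?mulr0 ?mulr1 ?mulrN1 ?add0r ?addr0; congr (_ x _ _) || congr (- x _ _).
all: exact: val_inj.
Qed.

(** The conjugate for which the map x |-> x O carries the field x [Iq k] to the field x [Mo O k]. *)
Definition Mo (O : 'M[R]_4) (k : 'I_3) := O^T *m Iq k *m O.

Section Conj.
Variable O : 'M[R]_4.
Hypothesis OO : O *m O^T = 1%:M.

Let MoM k l : Mo O k *m Mo O l = O^T *m (Iq k *m Iq l) *m O.
Proof. by rewrite /Mo !mulmxA -(mulmxA _ O O^T) OO mulmx1. Qed.

Lemma Mo_sk k : (Mo O k)^T = - Mo O k.
Proof. by rewrite /Mo !trmx_mul trmxK Iq_sk mulNmx mulmxN mulmxA. Qed.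
Lemma Mo_sq k : Mo O k *m Mo O k = - 1%:M.
Proof. by rewrite MoM Iq_sq mulmxN mulmx1 mulNmx (mulmx1C OO). Qed.
Lemma Mo01 : Mo O 0 *m Mo O 1 = - Mo O 2.
Proof. by rewrite MoM Iq01 mulmxN mulNmx. Qed.
Lemma Mo12 : Mo O 1 *m Mo O 2 = - Mo O 0.
Proof. by rewrite MoM Iq12 mulmxN mulNmx. Qed.
Lemma Mo20 : Mo O 2 *m Mo O 0 = - Mo O 1.
Proof. by rewrite MoM Iq20 mulmxN mulNmx. Qed.
End Conj.

Lemma hopf_linear (s : S -> V4) : hopf s ->
  exists2 O : 'M[R]_4, O *m O^T = 1%:M & s = qframe (Mo O) 0.
Proof.
move=> [f If sf]; have [A AA fA] := isometry_linear If.
case: (If) => _ [g [_ fg gf]] _.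
exists A => //; apply/funext => q; rewrite -(gf q) sf.
have e : (fun p => val (f p)) = (fun p => val p *m A) by apply/funext => p; exact: fA.
rewrite e /canonical_hopf mul_iE -[sdiff _ _ _]/(lieV (Iq 0) (fun p => val p *m A) (g q)).
rewrite lieV_mul; last exact: sfield_val.
by rewrite lieV_val ?Iq_sk // /qframe fA /Mo !mulmxA -(mulmxA _ A A^T) AA mulmx1.
Qed.

End Isometry.

(** * Integration over the sphere *)

(** The image ultrafilter lives on a compact segment, has a cluster point there, and an ultrafilter
    converges to each of its cluster points. *)
Lemma ultra_bounded_cvg (R : realType) (T : Type) (F : set_system T) (f : T -> R) (M : R) :
  UltraFilter F -> (forall n, `|f n| <= M) -> cvg (f @ F).
Proof.
move=> UF fM; have PF : ProperFilter F by exact: ultra_proper.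
have FK : (f @ F) `[- M, M]%classic.
  rewrite /fmap /=; apply: filterE => n; rewrite /= in_itv /=.
  by rewrite -ler_norml; exact: fM.
have [p [_ cp]] := @segment_compact R (- M) M (f @ F) _ FK.
apply/cvg_ex; exists p => V nV.
have [//|FV] := in_ultra_setVsetC (f @^-1` V) UF.
have [y [nVy Vy]] := cp (~` V) V FV nV.
by [].
Qed.

(** * A cutoff profile of class C^1 *)

Section Psi.
Variable R : realType.

(** The squared positive part is C^1 and vanishes on a half-line; one continuous derivative is all
    that [gsum_derive] asks for. *)
Definition psi (y : R) : R := Num.max 0 y ^+ 2.

Lemma psi_le0 y : y <= 0 -> psi y = 0.
Proof. by move=> y0; rewrite /psi max_l // expr0n. Qed.
Lemma psi_ge0 y : 0 <= psi y.
Proof. exact: sqr_ge0. Qed.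
Lemma psi_gt0 y : 0 < y -> 0 < psi y.
Proof. by move=> y0; rewrite /psi max_r ?ltW // exprn_gt0. Qed.

Lemma is_derive_psi (y : R) : is_derive y 1 psi (2 * Num.max 0 y).
Proof.
have [y0|y0|y0] := ltgtP 0 y.
- apply: (@near_eq_is_derive _ _ _ (fun z : R => z ^+ 2)).
    near=> z; rewrite /psi max_r // ltW //; near: z; exact: lt_nbhsr.
  have h := is_deriveX 2 (is_derive_id y (1 : R)).
  by rewrite [_%:A]mulr1 expr1 exprfctE in h.
- rewrite mulr0.
  apply: (@near_eq_is_derive _ _ _ (fun z : R => 0)).
    near=> z; rewrite psi_le0 // ltW //; near: z; exact: lt_nbhsl.
- rewrite -y0 mulr0.
  have h : (fun h : R => h^-1 *: ((psi \o shift 0) (h *: (1:R)) - psi 0)) @ 0^' --> (0 : R).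
    apply/cvgr0Pnorm_lt => e e0; near=> z.
    have z0 : z != 0 by near: z; exact: nbhs_dnbhs_neq.
    rewrite /= addr0 [_%:A]mulr1 [psi 0]psi_le0 // subr0 normrM normfV.
    rewrite ltr_pdivrMl ?normr_gt0 // /psi normrX.
    have zz : `|Num.max 0 z| <= `|z|.
      have [z1|z1] := leP 0 z; first by rewrite lexx.
      by rewrite normr0.
    apply: le_lt_trans (_ : `|z| ^+ 2 < _); first by rewrite lerXn2r // nnegrE.
    rewrite expr2 ltr_pM2l ?normr_gt0 //.
    by near: z; exact: dnbhs0_lt.
  by split; [apply/cvg_ex; exists 0|exact: cvg_lim h].
Unshelve. all: by end_near. Qed.

Lemma differentiable_psi y : differentiable psi y.
Proof. by apply/derivable1_diffP; have [] := is_derive_psi y. Qed.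

Lemma Cn1_psi (V : normedModType R) (U : set V) (f : V -> R) : open U ->
  Cn U 1 f -> Cn U 1 (fun x => psi (f x)).
Proof.
move=> oU [df Df].
have dpf x : U x -> differentiable (psi \o f) x.
  by move=> Ux; apply: differentiable_comp; [exact: df|exact: differentiable_psi].
split=> [x Ux|v]; first exact: dpf.
have h : Cn U 0 (fun x => 2 * Num.max 0 (f x) * 'D_v f x).
  apply: CnM => //=; last exact: Df.
  move=> x Ux; apply: continuousM; first exact: cvg_cst.
  apply: (@continuous_comp _ _ _ f (fun y => Num.max 0 y)).
    by apply: differentiable_continuous; exact: df.
  by apply: continuous_max; [exact: cvg_cst|exact: cvg_id].
apply: Cn_eq h => // x Ux.
rewrite [RHS](derive_comp v (df x Ux) (differentiable_psi _)).
have -> : 'D_v f x = 'D_v f x *: (1 : R) by rewrite [_%:A]mulr1.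
rewrite -[in RHS](add0r (_ *: 1)) (deriveDZ _ _ _ (differentiable_psi _)) derive0 add0r.
by rewrite (@derive_val _ _ _ _ _ _ _ (is_derive_psi (f x))) [_%:A]mulr1 mulrC.
Qed.
End Psi.

(** * Riemann sums over a grid in the cube [-2, 2]^4 *)

Section Grid.
Variable R : realType.
Local Notation V4 := 'rV[R]_4.
Local Notation S := (S3 R).

(** The grid has step 1 / (n + 1) and 4 (n + 1) points on each axis: the face -2 is included and the
    face 2 is not. *)
Definition gidx n := {ffun 'I_4 -> 'I_(4 * n.+1)}.
Definition gpt n (k : gidx n) : V4 := \row_i ((k i)%:R / n.+1%:R - 2).
Definition gsum n (G : V4 -> R) : R := (n.+1%:R ^- 4) * \sum_(k : gidx n) G (gpt k).

Lemma gsumD n G H : gsum n (fun x => G x + H x) = gsum n G + gsum n H.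
Proof. by rewrite /gsum big_split mulrDr. Qed.
Lemma gsumZ n c G : gsum n (fun x => c * G x) = c * gsum n G.
Proof. by rewrite /gsum -mulr_sumr mulrCA. Qed.
Lemma gsum_ge0 n G : (forall x, 0 <= G x) -> 0 <= gsum n G.
Proof. by move=> G0; rewrite mulr_ge0 ?sumr_ge0 // invr_ge0 exprn_ge0. Qed.

Lemma gidx_card n : n.+1%:R ^- 4 * (#|{: gidx n}|)%:R = 4 ^+ 4 :> R.
Proof.
rewrite card_ffun !card_ord natrX natrM exprMn mulrCA mulVf.
  by rewrite mulr1.
by rewrite expf_neq0 // pnatr_eq0.
Qed.

Lemma gsum_norm n G M : (forall k : gidx n, `|G (gpt k)| <= M) -> `|gsum n G| <= 4 ^+ 4 * M.
Proof.
move=> GM; rewrite normrM ger0_norm ?invr_ge0 ?exprn_ge0 //.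
apply: le_trans (ler_wpM2l _ (ler_norm_sum _ _ _)) _; first by rewrite invr_ge0 exprn_ge0.
have -> : 4 ^+ 4 * M = n.+1%:R ^- 4 * \sum_(k : gidx n) M.
  by rewrite sumr_const -[M *+ _]mulr_natl mulrA -(gidx_card n).
by apply: ler_wpM2l; [rewrite invr_ge0 exprn_ge0|apply: ler_sum => k _].
Qed.

Definition cube : set V4 := [set x | forall i, -2 <= x 0 i <= 2].

Lemma gpt_cube n (k : gidx n) : cube (gpt k).
Proof.
move=> i; rewrite mxE.
have h : (k i)%:R / n.+1%:R < 4 :> R.
  by rewrite ltr_pdivrMr ?ltr0n // -natrM ltr_nat ltn_ord.
have h0 : 0 <= (k i)%:R / n.+1%:R :> R by rewrite divr_ge0.
by move: h h0; move: (_ / _) => a h h0; apply/andP; split; lra.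
Qed.

Lemma cube_compact : compact cube.
Proof.
have := @rV_compact R 4 (fun=> `[-2, 2]%classic) (fun _ => @segment_compact R (-2) 2).
by congr compact; apply/seteqP; split=> x /= h i; have := h i; rewrite in_itv.
Qed.

Section Telescope.
Variables (G : V4 -> R) (j : 'I_4).
Let e : V4 := delta_mx 0 j.
Hypothesis G0 : forall x : V4, ~~ (`|x 0 j| < 2) -> G x = 0.

(** A shift by one grid step permutes the indices cyclically. It is exact except at the wrap-around,
    where one point lies on the face 2 and the other on the face -2, and [G] is zero on both. *)
Lemma gsum_shift n : gsum n (fun x => G (n.+1%:R^-1 *: e + x)) = gsum n G.
Proof.
rewrite /gsum; congr (_ * _).
pose sh (k : gidx n) : gidx n := [ffun i => if i == j then ordS (k i) else k i].
have sh_inj : injective sh.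
  move=> k l /ffunP h; apply/ffunP => i; have := h i; rewrite !ffunE.
  by case: eqP => // _ /ordS_inj.
rewrite [RHS](reindex_inj sh_inj) /=; apply: eq_bigr => k _.
have [lt|ge] := ltnP (k j).+1 (4 * n.+1).
  congr G; apply/rowP => i; rewrite !mxE ffunE eqxx /=.
  case: eqP => [->|_] /=; last by rewrite mulr0 add0r.
  by rewrite mulr1 modn_small // -[(k j).+1]addn1 natrD mulrDl mul1r; ring.
have kj : (k j).+1 = (4 * n.+1)%N by apply/eqP; rewrite eqn_leq ltn_ord ge.
rewrite !G0 //.
  by rewrite mxE ffunE eqxx /= kj modnn mul0r add0r normrN normr_nat ltxx.
rewrite !mxE !eqxx mulr1 -leNgt.
have -> : n.+1%:R^-1 + ((k j)%:R / n.+1%:R - 2) = 2 :> R; last by rewrite normr_nat.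
have : (k j)%:R + 1 = 4 * n.+1%:R :> R by rewrite -natrM natr1 kj.
have n0 : n.+1%:R != 0 :> R by rewrite pnatr_eq0.
move=> h; have -> : (k j)%:R = 4 * n.+1%:R - 1 :> R by rewrite -h addrK.
by field; rewrite addrC natr1.
Qed.

Hypothesis dG : forall x : V4, differentiable G x.
Hypothesis cG : continuous (fun x => 'D_e G x).

(* By the mean value theorem the sum is close to a sum of increments of G, which vanishes
   since G is zero on the faces of the cube. *)
Lemma gsum_derive : gsum n (fun x => 'D_e G x) @[n --> \oo] --> (0 : R).
Proof.
apply/cvgr0Pnorm_le => eps0 eps00.
pose eps := eps0 / 4 ^+ 4.
have epsgt : 0 < eps by rewrite divr_gt0 // exprn_gt0.
have epsE : eps0 = 4 ^+ 4 * eps by rewrite /eps mulrCA divff ?mulr1 // expf_neq0 // pnatr_eq0.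
pose P (n : nat) (x : V4) := forall t : R, 0 <= t <= n.+1%:R^-1 ->
  `|'D_e G (t *: e + x) - 'D_e G x| <= eps.
(* Uniform continuity of the partial derivative, by compactness: near each x, points within d / 2
   moved by at most 1 / (n + 1) < d / 2 stay within d of x. *)
have unif : \forall n \near \oo, cube `<=` P n.
  have /compact_near_coveringP ncov := cube_compact.
  apply: (ncov _ \oo P) => x _.
  have e2 : 0 < eps / 2 by rewrite divr_gt0.
  move: (cG) => /(_ x) /cvgrPdist_lt /(_ _ e2) /(@nbhs_normP R V4) [d /= d0 hd].
  have hx : \forall x' \near x, `|x - x'| < d / 2.
    by apply/(@nbhs_normP R V4); exists (d / 2) => //=; rewrite divr_gt0.
  have hn : \forall n \near \oo, (n.+1%:R)^-1 < d / 2.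
    have /cvgrPdist_lt /(_ (d / 2)) := @cvg_harmonic R.
    rewrite divr_gt0 // => /(_ isT); apply: filterS => n.
    by rewrite sub0r normrN ger0_norm /harmonic ?invr_ge0.
  exists ([set x' | `|x - x'| < d / 2], [set n | (n.+1%:R)^-1 < d / 2]) => //=.
  move=> [x' n] /= [xx' nd] t /andP[t0 tn].
  have h1 := hd x' _; have h2 := hd (t *: e + x') _.
  have d1 : `|x - x'| < d by lra.
  have e1 : `|e| <= 1.
    rewrite /Num.Def.normr /= mx_normrE; apply: bigmax_le => // -[a b] _ /=.
    by rewrite !mxE ger0_norm // lern1 leq_b1.
  have d2 : `|x - (t *: e + x')| < d.
    rewrite opprD addrCA addrC; apply: le_lt_trans (ler_normD _ _) _.
    rewrite normrN normrZ ger0_norm //.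
    have : t * `|e| <= t by rewrite ler_piMr.
    by move=> te; rewrite (splitr d) ltrD //; apply: le_lt_trans te (le_lt_trans tn nd).
  have := h1 d1; have := h2 d2; rewrite /= => ? ?.
  rewrite -(subrKA ('D_e G x)) (le_trans (ler_normD _ _)) //.
  rewrite distrC; lra.
near=> n.
have Pn : cube `<=` P n by near: n.
have n0 : (0:R) < n.+1%:R by rewrite ltr0n.
have -> : gsum n (fun x => 'D_e G x) = gsum n (fun x => 'D_e G x -
   n.+1%:R * (G (n.+1%:R^-1 *: e + x) - G x)).
  have -> : (fun x => 'D_e G x - n.+1%:R * (G (n.+1%:R^-1 *: e + x) - G x)) =
    (fun x => 'D_e G x + (- n.+1%:R) * (G (n.+1%:R^-1 *: e + x) + (-1) * G x)).
    by apply/funext => x; ring.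
  by rewrite gsumD gsumZ gsumD gsumZ gsum_shift mulN1r subrr mulr0 addr0.
rewrite epsE; apply: gsum_norm => k; set x := gpt k.
pose h (t : R) := G (t *: e + x); pose dh (t : R) := 'D_e G (t *: e + x).
have dH (t : R) : is_derive t (1 : R) h (dh t) by exact: is_derive_line.
have ch : {within `[(0:R), n.+1%:R^-1], continuous h}.
  by apply: derivable_within_continuous => t _; have [] := dH t.
have nV : (0:R) <= n.+1%:R^-1 by rewrite invr_ge0.
have [c] := MVT_segment nV (fun t _ => dH t) ch.
rewrite in_itv /= => cI; rewrite /h scale0r add0r subr0 => ->.
rewrite mulrCA divff ?gt_eqF // mulr1 distrC.
exact: Pn (gpt_cube k) _ cI.
Unshelve. all: by end_near. Qed.
End Telescope.
End Grid.

(** * The positive functional on continuous functions *)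

Section Functional.
Variable R : realType.
Local Notation V4 := 'rV[R]_4.
Local Notation S := (S3 R).
Implicit Types (u v : S -> R).

Definition contS u := forall x, punctured x -> {for x, continuous (exts u)}.

Lemma sfun_cont u : sfun u -> contS u.
Proof. exact: (fun su : sfun u => su 0%N). Qed.
Lemma contS_cst c : contS (fun=> c).
Proof. by apply: sfun_cont; exact: sfun_cst. Qed.
Lemma contSD u v : contS u -> contS v -> contS (fun p => u p + v p).
Proof. by move=> cu cv x x0; apply: continuousD; [exact: cu|exact: cv]. Qed.
Lemma contSM u v : contS u -> contS v -> contS (fun p => u p * v p).
Proof. by move=> cu cv x x0; apply: continuousM; [exact: cu|exact: cv]. Qed.
Lemma contS_max u v : contS u -> contS v -> contS (fun p => Num.max (u p) (v p)).
Proof. by move=> cu cv x x0; apply: continuous_max; [exact: cu|exact: cv]. Qed.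

Lemma compact_sphere : compact [set x : V4 | dotp x x = 1].
Proof.
apply: bounded_closed_compact.
  exists 1; split; first exact: num_real.
  move=> M M1 x /= x1; rewrite /Num.Def.normr /= mx_normrE.
  apply: bigmax_le => [|[i j] _ /=]; first by lra.
  rewrite ord1; apply: le_trans (ltW M1).
  rewrite -(@ler_pXn2r _ 2) ?nnegrE // expr1n real_normK ?num_real // -x1 /dotp (bigD1 j) //= -expr2.
  by rewrite lerDl sumr_ge0 // => k _; rewrite -expr2 sqr_ge0.
have -> : [set x : V4 | dotp x x = 1] = (fun x => dotp x x) @^-1` [set 1] by [].
apply: closed_comp; last exact: closed_eq.
by move=> x _; apply: differentiable_continuous; exact: differentiable_dotp.
Qed.

Lemma contS_bounded u : contS u -> exists M, forall p, `|u p| <= M.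
Proof.
move=> cu; pose A := [set x : V4 | dotp x x = 1].
have A0 : A !=set0 by exists (val (pole R)); exact: S3_dotp.
have cA : {within A, continuous (fun x => `|exts u x|)}.
  apply: continuous_in_subspaceT => x /set_mem x1.
  apply: (@continuous_comp _ _ _ (exts u) (fun y => `|y|)); last exact: norm_continuous.
  by apply: cu; rewrite /punctured /= -dotp_gt0 x1.
have [c _ h] := EVT_max_rV A0 compact_sphere cA.
exists `|exts u c| => p; rewrite -exts_val; apply: h; apply/mem_set; exact: S3_dotp.
Qed.

(** A radial bump supported in the shell 1 <= |x| <= 2. It hides the singularity of ray-constant
    extensions at the origin and vanishes on the faces of the cube. *)
Definition phi (x : V4) : R := psi ((dotp x x - 1) * (4 - dotp x x)).

Lemma phi_ge0 x : 0 <= phi x. Proof. exact: psi_ge0. Qed.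

Lemma phi_le x : phi x <= 9.
Proof.
rewrite /phi /psi; set y := (_ * _).
(* With t = |x|^2, (t - 1) (4 - t) = (9 - (2t - 5)^2) / 4 <= 9/4; the rounder bound 3 suffices. *)
have y3 : Num.max 0 y <= 3.
  rewrite ge_max; apply/andP; split; first by lra.
  rewrite /y; move: (dotp x x) => t; have := sqr_ge0 (2 * t - 5); rewrite expr2; nra.
have -> : 9 = 3 ^+ 2 :> R by rewrite -natrX.
by rewrite lerXn2r // nnegrE ?le_max ?lexx.
Qed.

Lemma phi_inner x : dotp x x <= 1 -> phi x = 0.
Proof. by move=> x1; rewrite /phi psi_le0 //; apply: mulr_le0_ge0; lra. Qed.

Lemma phi_outer (x : V4) i : ~~ (`|x 0 i| < 2) -> phi x = 0.
Proof.
rewrite -leNgt => xi; rewrite /phi psi_le0 //.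
have h : 4 <= dotp x x.
  rewrite /dotp (bigD1 i) //= -expr2 -real_normK ?num_real //.
  have : 0 <= \sum_(j < 4 | j != i) x 0 j * x 0 j.
    by apply: sumr_ge0 => j _; rewrite -expr2 sqr_ge0.
  have : 4 <= `|x 0 i| ^+ 2 by rewrite expr2; nra.
  lra.
nra.
Qed.

Lemma Cn1_phi : Cn setT 1 phi.
Proof.
have oT : open (@setT V4) by exact: openT.
have h : Cinf setT (fun x : V4 => dotp x x).
  by apply: Cinf_sum => // i; apply: CinfM => //; exact: Cinf_coord.
apply: Cn1_psi => //.
have hN : Cinf setT (fun x : V4 => -1 * dotp x x) by apply: CinfM => //; exact: Cinf_cst.
have -> : (fun x : V4 => (dotp x x - 1) * (4 - dotp x x)) =
  (fun x => (dotp x x + (-1)) * (4 + -1 * dotp x x)).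
  by apply/funext => x; rewrite mulN1r.
by apply: CnM => //; apply: CnD => //; try exact: Cn_cst.
Qed.

Lemma derive_phi (x v : V4) : dotp x v = 0 -> 'D_v phi x = 0.
Proof.
move=> xv; pose f (y : V4) := (dotp y y - 1) * (4 - dotp y y).
have dd y : differentiable (fun y : V4 => dotp y y) y by exact: differentiable_dotp.
have d1 : differentiable (fun y : V4 => dotp y y - 1) x.
  by apply: differentiableB => //; exact: differentiable_cst.
have d2 : differentiable (fun y : V4 => 4 - dotp y y) x.
  by apply: differentiableB => //; exact: differentiable_cst.
have df : differentiable f x by exact: differentiableM.
have dq : derivable (fun y : V4 => dotp y y) x v by exact: diff_derivable.
have dc1 : derivable (fun _ : V4 => 1 : R) x v by exact: derivable_cst.
have dc4 : derivable (fun _ : V4 => 4 : R) x v by exact: derivable_cst.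
have e0 : 'D_v f x = 0.
  have D1 : 'D_v (fun y : V4 => dotp y y - 1) x = 0.
    rewrite [LHS](deriveB dq dc1).
    by rewrite derive_dotp xv mulr0 derive_cst subr0.
  have D2 : 'D_v (fun y : V4 => 4 - dotp y y) x = 0.
    rewrite [LHS](deriveB dc4 dq).
    by rewrite derive_dotp xv mulr0 derive_cst subr0.
  rewrite [LHS]deriveM; try exact: diff_derivable.
  by rewrite D1 D2 !scaler0 addr0.
rewrite -[phi]/(@psi R \o f) (derive_comp _ df (differentiable_psi _)) e0.
exact: derive0.
Qed.

Definition wext u (x : V4) : R := phi x * exts u x.

Definition ultra_oo : set_system nat := sval (cid (@ultraFilterLemma nat \oo _)).
Lemma ultra_oo_ultra : UltraFilter ultra_oo. Proof. by rewrite /ultra_oo; case: cid => ? []. Qed.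
#[global] Instance ultra_oo_proper : ProperFilter ultra_oo. Proof. exact: (@ultra_proper _ _ ultra_oo_ultra). Qed.
#[global] Instance ultra_oo_filter : Filter ultra_oo. Proof. exact: filter_filter. Qed.
Lemma oo_sub_ultra_oo : \oo `<=` ultra_oo. Proof. by rewrite /ultra_oo; case: cid => ? []. Qed.

(* Riemann sums of phi(x) u(x/|x|) over [-2,2]^4, with phi a radial cutoff; their limit
   along an ultrafilter is used as a multiple of the integral of u over the sphere. *)
Definition sint u : R := lim (gsum n (wext u) @[n --> ultra_oo]).

Lemma sint_cvg u : contS u -> gsum n (wext u) @[n --> ultra_oo] --> sint u.
Proof.
move=> cu; have [M uM] := contS_bounded cu.
have b n : `|gsum n (wext u)| <= 4 ^+ 4 * (9 * M).
  apply: gsum_norm => k; rewrite normrM ler_pM //; last exact: uM.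
  by rewrite ger0_norm ?phi_ge0 // phi_le.
exact: (ultra_bounded_cvg ultra_oo_ultra b).
Qed.

Lemma sintD u v : contS u -> contS v -> sint (fun p => u p + v p) = sint u + sint v.
Proof.
move=> cu cv; rewrite [LHS]/sint; apply: cvg_lim => //.
have := @cvgD _ _ _ _ ultra_oo_filter _ _ _ _ (sint_cvg cu) (sint_cvg cv).
apply: cvg_trans; apply: near_eq_cvg; apply: nearW => n.
rewrite -[LHS]/(gsum n (wext u) + gsum n (wext v)) -gsumD.
by congr gsum; apply/funext => x; rewrite /wext /exts mulrDr.
Qed.

Lemma sintZ c u : contS u -> sint (fun p => c * u p) = c * sint u.
Proof.
move=> cu; rewrite [LHS]/sint; apply: cvg_lim => //.
have h := @cvgM _ _ _ ultra_oo_filter _ _ _ _ (@cvg_cst _ c _ ultra_oo ultra_oo_filter) (sint_cvg cu).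
move: h.
apply: cvg_trans; apply: near_eq_cvg; apply: nearW => n.
rewrite -[LHS]/(c * gsum n (wext u)) -gsumZ.
by congr gsum; apply/funext => x; rewrite /wext /exts mulrCA.
Qed.

Lemma sint_ge0 u : contS u -> (forall p, 0 <= u p) -> 0 <= sint u.
Proof.
move=> cu u0; apply: limr_ge; first by apply/cvg_ex; exists (sint u); exact: sint_cvg.
apply: nearW => n; apply: gsum_ge0 => x; rewrite mulr_ge0 ?phi_ge0 //; exact: u0.
Qed.

(** Ordinary convergence passes to the finer ultrafilter; this is how the vanishing on derivatives
    is obtained. *)
Lemma sint_null u : gsum n (wext u) @[n --> \oo] --> (0 : R) -> sint u = 0.
Proof.
move=> h; rewrite /sint; apply: cvg_lim => //; apply: cvg_trans h.
by move=> A; exact: oo_sub_ultra_oo.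
Qed.
End Functional.

(** The condition is tested point by point. It is used with the complement of the origin, where the
    product rule applies, and the open unit ball, where the cutoff is zero. *)
Lemma Cn_setU (R : realType) (V : normedModType R) (U W : set V) k (f : V -> R) :
  Cn U k f -> Cn W k f -> Cn (U `|` W) k f.
Proof.
elim: k f => [|k IH] f /=; first by move=> cU cW x [/cU|/cW].
by move=> [dU DU] [dW DW]; split=> [x [/dU|/dW] //|v]; apply: IH.
Qed.

(** * Vanishing on derivatives along rotations, and strict positivity *)

Section Functional.
Variable R : realType.
Local Notation V4 := 'rV[R]_4.
Local Notation S := (S3 R).
Implicit Types (u v : S -> R).

Definition uball : set V4 := [set x | dotp x x < 1].

Lemma open_uball : open uball.
Proof.
have -> : uball = (fun x => dotp x x) @^-1` [set y | y < 1] by [].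
apply: open_comp; last exact: open_lt.
by move=> x _; apply: differentiable_continuous; exact: differentiable_dotp.
Qed.

Lemma punctured_uball : @punctured R `|` uball = setT.
Proof.
apply/seteqP; split=> // x _.
have [->|x0] := eqVneq x 0; last by left.
by right; rewrite /uball /= dotp0l.
Qed.

Lemma Cn_uball0 k (f : V4 -> R) : (forall x, uball x -> f x = 0) -> Cn uball k f.
Proof.
by move=> f0; apply: (Cn_eq open_uball _ (Cn_cst open_uball k 0)) => x Ux; rewrite f0.
Qed.

Lemma derive_mulmx (M : 'M[R]_4) (x w : V4) j :
  'D_w (fun y : V4 => (y *m M) 0 j) x = (w *m M) 0 j.
Proof.
have -> : (fun y : V4 => (y *m M) 0 j) = \sum_k (fun y : V4 => y 0 k * M k j).
  by apply/funext => y; rewrite fct_sumE mxE.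
have dc k : derivable (fun y : V4 => y 0 k) x w.
  by apply: diff_derivable; exact: differentiable_coord.
have dM k : derivable (fun y : V4 => M k j) x w by exact: derivable_cst.
rewrite derive_sum => [|k]; last exact: (derivableM (dc k) (dM k)).
rewrite mxE; apply: eq_bigr => k _.
by rewrite [LHS](deriveM (dc k) (dM k)) derive_cst scaler0 add0r derive_coord mulrC.
Qed.

Lemma Cinf_mulmx (U : set V4) (M : 'M[R]_4) j : open U ->
  Cinf U (fun y : V4 => (y *m M) 0 j).
Proof.
move=> oU.
have h0 : Cinf U (fun x : V4 => \sum_k x 0 k * M k j).
  by apply: Cinf_sum => // k; apply: CinfM => //; [exact: Cinf_coord|exact: Cinf_cst].
by apply: Cinf_eq h0 => // x _; rewrite mxE.
Qed.

Section Stokes.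
Variables (M : 'M[R]_4) (u : S -> R).
Hypotheses (sM : M^T = - M) (su : sfun u).
Let oU := @open_punctured R.

Let wext0 x : uball x -> wext u x = 0.
Proof. by move=> x1; rewrite /wext phi_inner ?mul0r // ltW. Qed.

Let dphi (x : V4) : differentiable (@phi R) x.
Proof. by have [+ _] := @Cn1_phi R; apply. Qed.

Let Cphi : Cn (@punctured R) 1 (@phi R).
Proof.
have [d D] := @Cn1_phi R; split=> [x _|v x _]; first exact: d.
exact: D.
Qed.

Let Gj j (x : V4) : R := (x *m M) 0 j * wext u x.

Let CGj j : Cn setT 1 (Gj j).
Proof.
rewrite -punctured_uball; apply: Cn_setU.
  exact: (CnM oU (Cinf_mulmx M j oU 1) (CnM oU Cphi (su 1))).
by apply: Cn_uball0 => x /wext0 h; rewrite /Gj h mulr0.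
Qed.

(* The field x |-> x M is divergence free and tangent to the spheres. *)
Let div_Gj x : wext (lie M u) x = \sum_j 'D_(delta_mx 0 j) (Gj j) x.
Proof.
have [->|x0] := eqVneq x 0.
  have Z : uball (0 : V4) by rewrite /uball /= dotp0l.
  rewrite /wext phi_inner ?mul0r; last exact: ltW.
  rewrite big1 // => j _.
  rewrite (@near_eq_derive _ _ _ _ (fun=> 0)) ?derive_cst //.
  by apply: (near_open open_uball) Z _ => y y1; rewrite /Gj wext0 ?mulr0.
have dH : differentiable (wext u) x.
  by apply: differentiableM; [exact: dphi|exact: sfun_diff].
have dA j : differentiable (fun y : V4 => (y *m M) 0 j) x by exact: (Cinf_diff (Cinf_mulmx M j oU)).
have eA j : 'D_(delta_mx 0 j) (Gj j) x = (x *m M) 0 j * 'D_(delta_mx 0 j) (wext u) x.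
  rewrite [LHS](deriveM (diff_derivable (dA j)) (diff_derivable dH)) derive_mulmx.
  (* The diagonal of a skew matrix is zero: this is the absence of divergence. *)
  have -> : ((delta_mx 0 j : V4) *m M) 0 j = 0.
    rewrite -rowE mxE; have := congr1 (fun A : 'M[R]_4 => A j j) sM; rewrite !mxE => h; lra.
  by rewrite scaler0 addr0.
under eq_bigr => j _ do rewrite eA.
rewrite -(derive_linear (fun j => (x *m M) 0 j) (fun j => delta_mx 0 j) dH) -row_sum_delta.
have dphi1 : derivable (@phi R) x (x *m M) by apply: diff_derivable; exact: dphi.
have du1 : derivable (exts u) x (x *m M) by apply: diff_derivable; exact: sfun_diff.
rewrite [RHS](deriveM dphi1 du1) derive_phi; last by rewrite dotpC dotp_skew.
by rewrite scaler0 addr0 /wext exts_lie.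
Qed.

Lemma sint_lie : sint (lie M u) = 0.
Proof.
apply: sint_null.
have -> : (fun n => gsum n (wext (lie M u))) =
    \sum_j (fun n => gsum n (fun x => 'D_(delta_mx 0 j) (Gj j) x)).
  apply/funext => n; rewrite fct_sumE.
  have -> : wext (lie M u) = fun x => \sum_j 'D_(delta_mx 0 j) (Gj j) x.
    by apply/funext => x; exact: div_Gj.
  rewrite /gsum exchange_big /= mulr_sumr //.
have h j : gsum n (fun x => 'D_(delta_mx 0 j) (Gj j) x) @[n --> \oo] --> (0 : R).
  apply: gsum_derive => [x xj|x|x].
  - by rewrite /Gj /wext (phi_outer xj) mul0r mulr0.
  - by have [+ _] := CGj j; apply.
  - by have [_ /(_ (delta_mx 0 j))] := CGj j; apply.
rewrite !big_ord_recl big_ord0 addr0.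
have -> : (0 : R) = 0 + (0 + (0 + 0)) by rewrite !addr0.
by do 3![apply: cvgD => //].
Qed.
End Stokes.

(** About [eta] N consecutive grid points, N = n + 1, start next to y; the factor 1/2 absorbs the
    rounding. The bounds 3/2 and 1/4 keep these points inside [-2, 2). *)
Lemma grid_count n (y eta : R) : `|y| <= 3/2 -> 0 < eta <= 1/4 ->
  n.+1%:R^-1 <= eta / 2 ->
  eta / 2 <= n.+1%:R^-1 * \sum_(j < 4 * n.+1) (`|(j%:R / n.+1%:R - 2 : R) - y| <= eta)%R%:R.
Proof.
rewrite ler_norml => /andP[y1 y2] /andP[eta0 eta1]; set N : R := n.+1%:R => hN.
have N0 : 0 < N by rewrite ltr0n.
have NV0 : 0 < N^-1 by rewrite invr_gt0.
pose j0 := Num.truncn ((y + 2) * N); pose K := Num.truncn (eta * N).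
have yN : 0 <= (y + 2) * N by rewrite mulr_ge0 ?ltW //; lra.
have eN : 0 <= eta * N by rewrite mulr_ge0 ?ltW.
have /andP[j1 j2] := truncn_itv yN; have /andP[k1 k2] := truncn_itv eN.
(* [j0] indexes the last grid point at or below y. The indices j0, ..., j0 + K - 1 are counted, and
   every other summand is only bounded below by zero. *)
rewrite -/j0 in j1 j2; rewrite -/K in k1 k2.
have eN1 : 1 <= eta / 2 * N.
  by have := ler_wpM2r (ltW N0) hN; rewrite mulVf ?gt_eqF.
have jK : (j0 + K <= 4 * n.+1)%N.
  rewrite -(ler_nat R) natrD natrM -/N; apply: le_trans (lerD j1 k1) _.
  rewrite -mulrDl ler_pM2r //; lra.
rewrite -(big_mkord xpredT (fun j => (`|j%:R / N - 2 - y| <= eta)%R%:R)).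
have jL : (j0 <= 4 * n.+1)%N := leq_trans (leq_addr K j0) jK.
rewrite (@big_cat_nat _ _ _ j0 0%N _ _ _ (leq0n _) jL).
rewrite (@big_cat_nat _ _ _ (j0 + K)%N j0 _ _ _ (leq_addr K j0) jK).
set A := \sum_(0 <= _ < _) _; set B := \sum_(j0 <= _ < _) _; set C := \sum_(_ <= _ < _) _.
have A0 : 0 <= A by apply: sumr_ge0.
have C0 : 0 <= C by apply: sumr_ge0.
have BK : B = K%:R.
  rewrite /B (eq_big_nat _ _ (F2 := fun=> 1)) => [|j /andP[ja jb]].
    by rewrite big_const_nat iter_addr_0 addnC addnK.
  suff -> : `|j%:R / N - 2 - y| <= eta by [].
  have [i iK ->] : exists2 i, (i < K)%N & j = (j0 + i)%N.
    by exists (j - j0)%N; [rewrite ltn_subLR|rewrite subnKC].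
  have iK' : i%:R <= eta * N by apply: le_trans k1; rewrite ler_nat ltnW.
  have i0 : (0:R) <= i%:R by [].
  have -> : (j0 + i)%:R / N - 2 - y = (j0%:R + i%:R - (y + 2) * N) / N.
    by rewrite natrD; field; rewrite gt_eqF.
  rewrite ler_norml ler_pdivlMr // ler_pdivrMr //; apply/andP; split; last by lra.
  have : j0.+1%:R = j0%:R + 1 :> R by rewrite -natr1.
  move: j2 => /[swap] ->; lra.
have K2 : eta / 2 * N <= K%:R.
  have : K.+1%:R = K%:R + 1 :> R by rewrite -natr1.
  move: k2 => /[swap] ->; lra.
rewrite [leRHS]mulrC ler_pdivlMr // BK. rewrite /=; lra.
Qed.

(** The weighted extension exceeds a positive constant on a small cube, and the Riemann sum of the
    indicator of a cube is a product of four one-dimensional counts. *)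
Lemma sint_gt0 u p : contS u -> (forall q, 0 <= u q) -> 0 < u p -> 0 < sint u.
Proof.
move=> cu u0 up.
(* At this point |x|^2 = 9/4 lies strictly between 1 and 4, so the cutoff is positive. *)
pose x0 : V4 := (3/2) *: val p.
have x00 : punctured x0 by rewrite /punctured /= scaler_eq0 negb_or (S3_neq0 p) andbT; lra.
have w0 : 0 < wext u x0.
  rewrite /wext extsZ ?exts_val ?divr_gt0 // mulr_gt0 //.
  by apply: psi_gt0; rewrite dotpZl dotpZr S3_dotp; lra.
have x0i i : `|x0 0 i| <= 3/2.
  have h32 : (0 : R) <= 3 / 2 by lra.
  rewrite -(@ler_pXn2r _ 2) ?nnegrE //.
  rewrite real_normK ?num_real //.
  have -> : (3/2) ^+ 2 = dotp x0 x0 by rewrite dotpZl dotpZr S3_dotp mulr1 expr2.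
  rewrite /dotp (bigD1 i) //= -expr2.
  by rewrite lerDl sumr_ge0 // => k _; rewrite -expr2 sqr_ge0.
have cw : {for x0, continuous (wext u)}.
  apply: continuousM; last exact: cu.
  by apply: differentiable_continuous; have [+ _] := @Cn1_phi R; apply.
pose c := wext u x0 / 2; have c0 : 0 < c by rewrite divr_gt0.
move/cvgrPdist_lt : cw => /(_ _ c0) /(@nbhs_normP R V4) [d /= d0 hd].
pose eta := Num.min (d / 2) (1 / 4).
have eta0 : 0 < eta by rewrite lt_min; apply/andP; split; lra.
have etad : eta < d by rewrite gt_min; apply/orP; left; lra.
have eta1 : eta <= 1/4 by rewrite ge_min lexx orbT.
have lb (x : V4) : c * \prod_i (`|x 0 i - x0 0 i| <= eta)%R%:R <= wext u x.
  have [h|h] := pselect (forall i, `|x 0 i - x0 0 i| <= eta); last first.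
    move/existsNP : h => [i /negP hi].
    rewrite (bigD1 i) //= (negbTE hi) mul0r mulr0.
    by rewrite mulr_ge0 ?phi_ge0 //; exact: u0.
  rewrite big1 => [|i _]; last by rewrite h.
  rewrite mulr1; have := hd x; rewrite /ball_ /= => hx.
  have xd : `|x0 - x| < d.
    apply: le_lt_trans etad; rewrite distrC /Num.Def.normr /= mx_normrE.
    apply: bigmax_le => [|[a i] _ /=]; first exact: ltW.
    by rewrite ord1 mxE [(- x0) 0 i]mxE; exact: h.
  have := hx xd; rewrite ltr_norml => /andP[_]; rewrite /c; lra.
have lim_ge : c * (eta / 2) ^+ 4 <= sint u.
  apply: limr_ge; first by apply/cvg_ex; exists (sint u); exact: sint_cvg.
  apply: oo_sub_ultra_oo; near=> n.
  have hn : n.+1%:R^-1 <= eta / 2.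
    near: n; have /cvgrPdist_lt /(_ (eta / 2)) := @cvg_harmonic R.
    rewrite divr_gt0 // => /(_ isT); apply: filterS => n.
    by rewrite sub0r normrN ger0_norm /harmonic ?invr_ge0 // => /ltW.
  apply: le_trans (_ : gsum n (fun x : V4 => c * \prod_i (`|x 0 i - x0 0 i| <= eta)%R%:R) <= _); last first.
    rewrite -subr_ge0.
    have -> : gsum n (wext u) - gsum n (fun x : V4 => c * \prod_i (`|x 0 i - x0 0 i| <= eta)%R%:R)
      = gsum n (fun x : V4 => wext u x + (-1) * (c * \prod_i (`|x 0 i - x0 0 i| <= eta)%R%:R)).
      by rewrite gsumD (gsumZ n (-1)) mulN1r.
    by apply: gsum_ge0 => x; rewrite mulN1r subr_ge0.
  rewrite gsumZ ler_pM2l //.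
  have -> : gsum n (fun x : V4 => \prod_i (`|x 0 i - x0 0 i| <= eta)%R%:R) =
     \prod_(i < 4) (n.+1%:R^-1 * \sum_(j < 4 * n.+1) (`|(j%:R / n.+1%:R - 2 : R) - x0 0 i| <= eta)%R%:R).
    rewrite big_split /= prodr_const card_ord exprVn bigA_distr_bigA /gsum /=.
    congr (_ * _); apply: eq_bigr => k _; apply: eq_bigr => i _.
    by rewrite !mxE.
  have -> : (eta / 2) ^+ 4 = \prod_(i < 4) (eta / 2) by rewrite prodr_const card_ord.
  apply: ler_prod => i _; apply/andP; split; first by rewrite divr_ge0 // ltW.
  by apply: grid_count => //; rewrite eta0.
apply: lt_le_trans lim_ge; rewrite mulr_gt0 // exprn_gt0 // divr_gt0 //.
Unshelve. all: by end_near. Qed.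
End Functional.

(** * Harmonic polynomials *)

Section ComplexFunctions.
Variable R : realType.
Local Notation V4 := 'rV[R]_4.
Local Notation S := (S3 R).
Local Notation C := R[i].
Local Notation re := (@complex.Re R).
Local Notation im := (@complex.Im R).
Implicit Types (h g : S -> C).

Definition imc : C := Complex 0 1.

Definition sfunC h := sfun (fun p => re (h p)) /\ sfun (fun p => im (h p)).
Definition lieC M h : S -> C :=
  fun p => Complex (lie M (fun q => re (h q)) p) (lie M (fun q => im (h q)) p).

Lemma complexP (a b : C) : re a = re b -> im a = im b -> a = b.
Proof. by case: a => a1 a2; case: b => b1 b2 /= -> ->. Qed.
Lemma reD (a b : C) : re (a + b) = re a + re b. Proof. by case: a; case: b. Qed.
Lemma imD (a b : C) : im (a + b) = im a + im b. Proof. by case: a; case: b. Qed.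
Lemma reM (a b : C) : re (a * b) = re a * re b - im a * im b.
Proof. by case: a; case: b. Qed.
Lemma imM (a b : C) : im (a * b) = re a * im b + im a * re b.
Proof. by case: a => a1 a2; case: b => b1 b2. Qed.

Lemma sfunC_cst c : sfunC (fun=> c). Proof. by split; exact: sfun_cst. Qed.
Lemma sfunCD h g : sfunC h -> sfunC g -> sfunC (fun p => h p + g p).
Proof.
move=> [h1 h2] [g1 g2]; split.
  by have := sfunD h1 g1; congr sfun; apply/funext => p; rewrite reD.
by have := sfunD h2 g2; congr sfun; apply/funext => p; rewrite imD.
Qed.
Lemma sfunCM h g : sfunC h -> sfunC g -> sfunC (fun p => h p * g p).
Proof.
move=> [h1 h2] [g1 g2]; split.
  have := sfunB (sfunM h1 g1) (sfunM h2 g2); congr sfun.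
  by apply/funext => p; rewrite reM.
have := sfunD (sfunM h1 g2) (sfunM h2 g1); congr sfun.
by apply/funext => p; rewrite imM.
Qed.
Lemma sfunC_sum n (h : 'I_n -> S -> C) :
  (forall i, sfunC (h i)) -> sfunC (fun p => \sum_i h i p).
Proof.
elim: n h => [|n IH] h sh.
  have -> : (fun p => \sum_i h i p) = fun=> 0 by apply/funext => p; rewrite big_ord0.
  exact: sfunC_cst.
have -> : (fun p => \sum_i h i p) =
  (fun p => (\sum_(i < n) h (widen_ord (leqnSn n) i) p) + h ord_max p).
  by apply/funext => p; rewrite big_ord_recr.
by apply: sfunCD => //; apply: IH.
Qed.

Section Derivation.
Variable M : 'M[R]_4.

Lemma sfunC_lieC h : sfunC h -> sfunC (lieC M h).
Proof. by move=> [h1 h2]; split; exact: sfun_lie. Qed.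
Lemma lieC_cst c : lieC M (fun=> c) = fun=> 0.
Proof. by apply/funext => p; apply: complexP; rewrite /= lie_cst. Qed.
Lemma lieCD h g : sfunC h -> sfunC g ->
  lieC M (fun p => h p + g p) = fun p => lieC M h p + lieC M g p.
Proof.
move=> [h1 h2] [g1 g2]; apply/funext => p; apply: complexP; rewrite ?reD ?imD /=.
  rewrite (_ : (fun q => _) = fun q => re (h q) + re (g q)) ?lieD //.
  by apply/funext => q; rewrite reD.
rewrite (_ : (fun q => _) = fun q => im (h q) + im (g q)) ?lieD //.
by apply/funext => q; rewrite imD.
Qed.
Lemma lieCM h g : sfunC h -> sfunC g ->
  lieC M (fun p => h p * g p) = fun p => lieC M h p * g p + h p * lieC M g p.
Proof.
move=> [h1 h2] [g1 g2]; apply/funext => p; apply: complexP;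
  rewrite ?reD ?imD ?reM ?imM /=.
  rewrite (_ : (fun q => _) = fun q => re (h q) * re (g q) - im (h q) * im (g q)).
    by rewrite lieB ?lieM //; [ring|exact: sfunM|exact: sfunM].
  by apply/funext => q; rewrite reM.
rewrite (_ : (fun q => _) = fun q => re (h q) * im (g q) + im (h q) * re (g q)).
  by rewrite lieD ?lieM //; [ring|exact: sfunM|exact: sfunM].
by apply/funext => q; rewrite imM.
Qed.
Lemma lieCZ c h : sfunC h -> lieC M (fun p => c * h p) = fun p => c * lieC M h p.
Proof.
move=> sh; rewrite lieCM //; last exact: sfunC_cst.
by rewrite lieC_cst; apply/funext => p; rewrite mul0r add0r.
Qed.
Lemma lieC_sum n (h : 'I_n -> S -> C) : (forall i, sfunC (h i)) ->
  lieC M (fun p => \sum_i h i p) = fun p => \sum_i lieC M (h i) p.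
Proof.
elim: n h => [|n IH] h sh.
  have -> : (fun p => \sum_i h i p) = fun=> 0 by apply/funext => p; rewrite big_ord0.
  by rewrite lieC_cst; apply/funext => p; rewrite big_ord0.
have -> : (fun p => \sum_i h i p) =
  (fun p => (\sum_(i < n) h (widen_ord (leqnSn n) i) p) + h ord_max p).
  by apply/funext => p; rewrite big_ord_recr.
rewrite lieCD // ?IH //; last exact: sfunC_sum.
by apply/funext => p; rewrite big_ord_recr.
Qed.

(** States that [P'] is the coefficientwise derivative of the polynomial-valued function [P] along x
    |-> x M. One Leibniz rule for generating polynomials then handles all coefficients at once. *)
Definition pderiv (P P' : S -> {poly C}) :=
  forall m, sfunC (fun p => (P p)`_m) /\ lieC M (fun p => (P p)`_m) = fun p => (P' p)`_m.

Lemma pderiv_cst c : pderiv (fun=> c) (fun=> 0).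
Proof.
move=> m; split; first exact: sfunC_cst.
by rewrite lieC_cst; apply/funext => p; rewrite coef0.
Qed.

Lemma pderiv_mul P P' Q Q' : pderiv P P' -> pderiv Q Q' ->
  pderiv (fun p => P p * Q p) (fun p => P' p * Q p + P p * Q' p).
Proof.
move=> dP dQ m.
have -> : (fun p => (P p * Q p)`_m) = (fun p => \sum_(j < m.+1) (P p)`_j * (Q p)`_(m - j)).
  by apply/funext => p; rewrite coefM.
have s (j : 'I_m.+1) : sfunC (fun p => (P p)`_j * (Q p)`_(m - j)).
  by apply: sfunCM; [have [] := dP j|have [] := dQ (m - j)%N].
split; first exact: sfunC_sum.
rewrite lieC_sum //; apply/funext => p; rewrite coefD !coefM -big_split /=.
apply: eq_bigr => j _; have [sj ej] := dP j; have [sk ek] := dQ (m - j)%N.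
by rewrite lieCM // ej ek.
Qed.

(** At n = 0 the factor [n%:R] is zero, so the truncated exponent [n.-1] does no harm. The same
    convention gives sense to [p.-1] and [q.-1] in the formulas for [harm]. *)
Lemma pderiv_exp P P' n : pderiv P P' ->
  pderiv (fun p => P p ^+ n) (fun p => n%:R * P' p * P p ^+ n.-1).
Proof.
move=> dP; elim: n => [|n IH].
  have := pderiv_cst 1; congr pderiv; apply/funext => p; by rewrite ?expr0 ?mul0r.
have := pderiv_mul dP IH; congr pderiv; apply/funext => p; rewrite ?exprS //=.
by case: n {IH} => [|n]; rewrite ?exprS -?natr1 /=; ring.
Qed.

Lemma pderiv_lin a b : sfunC a -> sfunC b ->
  pderiv (fun p => (a p)%:P + b p *: 'X) (fun p => (lieC M a p)%:P + lieC M b p *: 'X).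
Proof.
move=> sa sb m; have e c d : (c%:P + d *: 'X : {poly C})`_m =
   if m == 0%N then c else if m == 1%N then d else 0.
  rewrite coefD coefC coefZ coefX; case: m => [|[|m]] /=.
  - by rewrite mulr0 addr0.
  - by rewrite mulr1 add0r.
  - by rewrite mulr0 addr0.
under eq_fun => p do rewrite e.
have -> : (fun p => ((lieC M a p)%:P + lieC M b p *: 'X)`_m) =
   fun p => if m == 0%N then lieC M a p else if m == 1%N then lieC M b p else 0.
  by apply/funext => p; rewrite e.
case: (m == 0%N) => //; case: (m == 1%N) => //.
by split; [exact: sfunC_cst|exact: lieC_cst].
Qed.
End Derivation.

Section Basis.
Variable O : 'M[R]_4.
Hypothesis OO : O *m O^T = 1%:M.

(** Coordinates with respect to the basis rotated by [O], in which [Mo O k] acts as [Iq k]. *)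
Definition yc i (p : S) : R := (val p *m O^T) 0 i.

Lemma sfun_yc i : sfun (yc i).
Proof. by have := sfield_mul O^T (@sfield_val R) i. Qed.

Lemma lie_yc k i p : lie (Mo O k) (yc i) p = (val p *m O^T *m Iq R k) 0 i.
Proof.
have sv := @sfield_val R.
have := lieVE (Mo O k) p i (sfield_mul O^T sv); rewrite lieV_mul // lieV_val ?Mo_sk //.
rewrite -[RHS]/(lie (Mo O k) (yc i) p) => <-.
by rewrite /Mo !mulmxA -(mulmxA _ O O^T) OO mulmx1.
Qed.

Lemma yc_sum p : yc 0 p ^+ 2 + yc 1 p ^+ 2 + yc 2 p ^+ 2 + yc 3 p ^+ 2 = 1.
Proof.
have : dotp (val p *m O^T) (val p *m O^T) = 1.
  by rewrite dotp_mulmx trmxK -mulmxA (mulmx1C OO) mulmx1 S3_dotp.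
rewrite /dotp !big_ord_recl big_ord0 addr0 => h; rewrite -[RHS]h /yc !expr2 !addrA.
by congr (_ * _ + _ * _ + _ * _ + _ * _); congr ((_ *m _) _ _); exact: val_inj.
Qed.

Definition z1 p : C := Complex (yc 0 p) (yc 1 p).
Definition z2 p : C := Complex (yc 2 p) (yc 3 p).
(** [w1] and [w2] are the complex conjugates of [z1] and [z2]. *)
Definition w1 p : C := Complex (yc 0 p) (- yc 1 p).
Definition w2 p : C := Complex (yc 2 p) (- yc 3 p).

Lemma sfunC_z1 : sfunC z1. Proof. by split; exact: sfun_yc. Qed.
Lemma sfunC_z2 : sfunC z2. Proof. by split; exact: sfun_yc. Qed.
Lemma sfunC_w1 : sfunC w1. Proof. by split; [exact: sfun_yc|apply: sfunN; exact: sfun_yc]. Qed.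
Lemma sfunC_w2 : sfunC w2. Proof. by split; [exact: sfun_yc|apply: sfunN; exact: sfun_yc]. Qed.

Lemma zw1 p : z1 p * w1 p + z2 p * w2 p = 1.
Proof.
have h := yc_sum p.
apply: complexP; rewrite ?reD ?imD ?reM ?imM /=; last by ring.
by rewrite -[RHS]h; ring.
Qed.

Lemma IqE k p : (val p *m O^T *m Iq R k) =
  nth 0 [:: \row_(j < 4) nth 0 [:: - yc 1 p; yc 0 p; - yc 3 p; yc 2 p] j;
            \row_(j < 4) nth 0 [:: - yc 2 p; yc 3 p; yc 0 p; - yc 1 p] j;
            \row_(j < 4) nth 0 [:: - yc 3 p; - yc 2 p; yc 1 p; yc 0 p] j] k.
Proof.
rewrite /yc; move: (val p *m O^T) => y.
have e1 : lift ord0 ord0 = 1 :> 'I_4 by exact: val_inj.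
have e2 : lift ord0 (lift ord0 ord0) = 2 :> 'I_4 by exact: val_inj.
have e3 : lift ord0 (lift ord0 (lift ord0 ord0)) = 3 :> 'I_4 by exact: val_inj.
move: k; apply: I3P; apply/rowP; case=> [[|[|[|[|//]]]] i4];
  rewrite !mxE !big_ord_recl big_ord0 !mxE /= ?e1 ?e2 ?e3; ring.
Qed.

Lemma lie_Nyc k i p : lie (Mo O k) (fun q => - yc i q) p = - lie (Mo O k) (yc i) p.
Proof. by rewrite lieN //; exact: sfun_yc. Qed.

Ltac solveL := apply/funext => p; apply: complexP;
  rewrite ?reD ?imD ?reM ?imM /= ?lie_Nyc !lie_yc !IqE /= ?mxE /=; ring.

Lemma L0z1 : lieC (Mo O 0) z1 = fun p => imc * z1 p. Proof. solveL. Qed.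
Lemma L0z2 : lieC (Mo O 0) z2 = fun p => imc * z2 p. Proof. solveL. Qed.
Lemma L0w1 : lieC (Mo O 0) w1 = fun p => - imc * w1 p. Proof. solveL. Qed.
Lemma L0w2 : lieC (Mo O 0) w2 = fun p => - imc * w2 p. Proof. solveL. Qed.
Lemma L1z1 : lieC (Mo O 1) z1 = fun p => (-1) * w2 p. Proof. solveL. Qed.
Lemma L1z2 : lieC (Mo O 1) z2 = fun p => w1 p. Proof. solveL. Qed.
Lemma L1w1 : lieC (Mo O 1) w1 = fun p => (-1) * z2 p. Proof. solveL. Qed.
Lemma L1w2 : lieC (Mo O 1) w2 = fun p => z1 p. Proof. solveL. Qed.
Lemma L2z1 : lieC (Mo O 2) z1 = fun p => - imc * w2 p. Proof. solveL. Qed.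
Lemma L2z2 : lieC (Mo O 2) z2 = fun p => imc * w1 p. Proof. solveL. Qed.
Lemma L2w1 : lieC (Mo O 2) w1 = fun p => imc * z2 p. Proof. solveL. Qed.
Lemma L2w2 : lieC (Mo O 2) w2 = fun p => - imc * z1 p. Proof. solveL. Qed.
End Basis.
End ComplexFunctions.

(** * The generating polynomials X^p Y^q and their coefficients *)

Section Basis.
Variable R : realType.
Local Notation V4 := 'rV[R]_4.
Local Notation S := (S3 R).
Local Notation C := R[i].
Local Notation imc := (@imc R).
Implicit Types (h g : S -> C).
Variable O : 'M[R]_4.
Hypothesis OO : O *m O^T = 1%:M.

Local Notation z1 := (z1 O).
Local Notation z2 := (z2 O).
Local Notation w1 := (w1 O).
Local Notation w2 := (w2 O).
Local Notation D k := (lieC (Mo O k)).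

Lemma imc2 : imc ^+ 2 = -1.
Proof.
by apply: complexP; rewrite expr2 ?reM ?imM /= ?mulr0 ?mulr1 ?mul0r ?add0r ?addr0 ?sub0r ?oppr0.
Qed.

Definition Xp (p : S) : {poly C} := (z1 p)%:P + z2 p *: 'X.
Definition Yp (p : S) : {poly C} := (w2 p)%:P + ((-1) * w1 p) *: 'X.

Let sfunC_Nw1 : sfunC (fun p => (-1) * w1 p).
Proof. by apply: sfunCM; [exact: sfunC_cst|exact: sfunC_w1]. Qed.

Lemma pderiv_Xp k P : (fun p => (D k z1 p)%:P + D k z2 p *: 'X) = P -> pderiv (Mo O k) Xp P.
Proof. by move=> <-; apply: pderiv_lin; [exact: sfunC_z1|exact: sfunC_z2]. Qed.
Lemma pderiv_Yp k P : (fun p => (D k w2 p)%:P + ((-1) * D k w1 p) *: 'X) = P -> pderiv (Mo O k) Yp P.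
Proof.
move=> <-; have := pderiv_lin (Mo O k) (sfunC_w2 O) sfunC_Nw1.
by rewrite lieCZ //; exact: sfunC_w1.
Qed.

Ltac solveXY := apply/funext => p;
  rewrite /Xp /Yp -!mul_polyC !(polyCM, polyCN, polyCD); ring.

Lemma DX0 : pderiv (Mo O 0) Xp (fun p => imc%:P * Xp p).
Proof. apply: pderiv_Xp; rewrite L0z1 // L0z2 //; solveXY. Qed.
Lemma DY0 : pderiv (Mo O 0) Yp (fun p => - imc%:P * Yp p).
Proof. apply: pderiv_Yp; rewrite L0w1 // L0w2 //; solveXY. Qed.
Lemma DX1 : pderiv (Mo O 1) Xp (fun p => - Yp p).
Proof. apply: pderiv_Xp; rewrite L1z1 // L1z2 //; solveXY. Qed.
Lemma DY1 : pderiv (Mo O 1) Yp Xp.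
Proof. apply: pderiv_Yp; rewrite L1w1 // L1w2 //; solveXY. Qed.
Lemma DX2 : pderiv (Mo O 2) Xp (fun p => - imc%:P * Yp p).
Proof. apply: pderiv_Xp; rewrite L2z1 // L2z2 //; solveXY. Qed.
Lemma DY2 : pderiv (Mo O 2) Yp (fun p => - imc%:P * Xp p).
Proof. apply: pderiv_Yp; rewrite L2w1 // L2w2 //; solveXY. Qed.

(* The coefficients of t^m in (z1 + t z2)^p (conj z2 - t conj z1)^q, 0 <= m <= p + q,
   span the harmonic polynomials of bidegree (p, q). *)
Definition hgen (p q : nat) (x : S) : {poly C} := Xp x ^+ p * Yp x ^+ q.
Definition harm (p q m : nat) (x : S) : C := (hgen p q x)`_m.

Lemma pderiv_hgen k X' Y' p q : pderiv (Mo O k) Xp X' -> pderiv (Mo O k) Yp Y' ->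
  pderiv (Mo O k) (hgen p q) (fun x => p%:R * X' x * Xp x ^+ p.-1 * Yp x ^+ q +
                           Xp x ^+ p * (q%:R * Y' x * Yp x ^+ q.-1)).
Proof. by move=> dX dY; apply: pderiv_mul; exact: pderiv_exp. Qed.

Lemma sfunC_harm p q m : sfunC (harm p q m).
Proof. by have [] := pderiv_hgen p q DX0 DY0 m. Qed.

Lemma D0_harm p q m : D 0 (harm p q m) = fun x => (imc * (p%:R - q%:R)) * harm p q m x.
Proof.
have [_ ->] := pderiv_hgen p q DX0 DY0 m; apply/funext => x.
rewrite -coefCM; congr ((_ : {poly C})`_m).
rewrite /hgen polyCM polyCB !polyC_natr.
by case: p => [|p]; case: q => [|q]; rewrite ?exprS -?natr1 /=; ring.
Qed.

Lemma D1_harm p q m : D 1 (harm p q m) =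
  fun x => (- p%:R) * harm p.-1 q.+1 m x + q%:R * harm p.+1 q.-1 m x.
Proof.
have [_ ->] := pderiv_hgen p q DX1 DY1 m; apply/funext => x.
rewrite -!coefCM -coefD; congr ((_ : {poly C})`_m).
by rewrite /hgen polyCN !polyC_natr !exprS; ring.
Qed.

Lemma D2_harm p q m : D 2 (harm p q m) =
  fun x => (- imc * p%:R) * harm p.-1 q.+1 m x + (- imc * q%:R) * harm p.+1 q.-1 m x.
Proof.
have [_ ->] := pderiv_hgen p q DX2 DY2 m; apply/funext => x.
rewrite -!coefCM -coefD; congr ((_ : {poly C})`_m).
by rewrite /hgen !polyCM polyCN !polyC_natr !exprS; ring.
Qed.

(* The vertical Jacobi operator, read on h = f + i g for the field vf M f g. *)
Definition jacC h : S -> C :=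
  fun x => - (D 0 (D 0 h) x + D 1 (D 1 h) x + D 2 (D 2 h) x) + 2 * imc * D 0 h x.

Definition jeigC (p q : nat) : C := ((p + q) * (p + q + 2))%:R + 2 * (q%:R - p%:R).

(** In D_1^2 + D_2^2 the contributions of bidegree (p-2, q+2) and (p+2, q-2) cancel and - (4pq + 2p
    + 2q) remains. With D_0^2 = - (p-q)^2 the Laplacian gives n(n+2), n = p + q, and 2 i D_0 gives
    2(q-p). *)
Lemma jacC_harm p q m x : jacC (harm p q m) x = jeigC p q * harm p q m x.
Proof.
have sf := sfunC_harm.
have lieC2 k a b f1 f2 : sfunC f1 -> sfunC f2 ->
   D k (fun y => a * f1 y + b * f2 y) = fun y => a * D k f1 y + b * D k f2 y.
  move=> s1 s2; rewrite lieCD ?lieCZ //; by apply: sfunCM => //; exact: sfunC_cst.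
rewrite /jacC D0_harm lieCZ // D0_harm D1_harm lieC2 // !D1_harm D2_harm lieC2 // !D2_harm /jeigC.
rewrite natrM !natrD.
by case: p => [|p]; case: q => [|q]; rewrite /= -?natr1; ring: imc2.
Qed.

Lemma wzXY x : (w1 x)%:P * Xp x + (z2 x)%:P * Yp x = 1.
Proof.
have e := congr1 (fun c : C => c%:P) (zw1 OO x); rewrite polyCD !polyCM polyC1 in e.
rewrite -e.
by rewrite /Xp /Yp -!mul_polyC polyCM polyCN; ring.
Qed.

Lemma deriv_Xp x : (Xp x)^`() = (z2 x)%:P.
Proof. by rewrite /Xp derivD derivC derivZ derivX add0r -alg_polyC. Qed.
Lemma deriv_Yp x : (Yp x)^`() = - (w1 x)%:P.
Proof. by rewrite /Yp derivD derivC derivZ derivX add0r mulN1r -alg_polyC scaleNr. Qed.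

(** The derivative in t of X^(p+1) Y^q is (p+1) z2 X^p Y^q - q w1 X^(p+1) Y^(q-1); substituting w1 X
    = 1 - z2 Y collects the factor p + q + 1. [w1_hgen] comes from X^p Y^(q+1) in the same way. *)
Lemma z2_hgen p q x :
  (p + q).+1%:R * ((z2 x)%:P * hgen p q x) = (hgen p.+1 q x)^`() + q%:R * hgen p q.-1 x.
Proof.
rewrite /hgen derivM !deriv_exp deriv_Xp deriv_Yp /=.
rewrite -[_ *+ p.+1]mulr_natr -[_ *+ q]mulr_natr -!natr1 natrD.
case: q => [|q] /=; first by rewrite !expr0; ring.
rewrite exprS exprS -natr1.
move: (Xp x ^+ p) (Yp x ^+ q) (wzXY x) => U V h.
have -> : (q%:R + 1) * (U * V) =
  (q%:R + 1) * (U * V) * ((w1 x)%:P * Xp x + (z2 x)%:P * Yp x).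
  by rewrite h mulr1.
ring.
Qed.

Lemma w1_hgen p q x :
  (p + q).+1%:R * ((w1 x)%:P * hgen p q x) = p%:R * hgen p.-1 q x - (hgen p q.+1 x)^`().
Proof.
rewrite /hgen derivM !deriv_exp deriv_Xp deriv_Yp /=.
rewrite -[_ *+ q.+1]mulr_natr -[_ * _ *+ p]mulr_natr -!natr1 natrD.
case: p => [|p] /=; first by rewrite !expr0; ring.
rewrite exprS exprS -natr1.
move: (Xp x ^+ p) (Yp x ^+ q) (wzXY x) => U V h.
have -> : (p%:R + 1) * (U * V) =
  (p%:R + 1) * (U * V) * ((w1 x)%:P * Xp x + (z2 x)%:P * Yp x).
  by rewrite h mulr1.
ring.
Qed.

Lemma z2_harm p q m x : z2 x * harm p q m x =
  (m.+1%:R / (p + q).+1%:R) * harm p.+1 q m.+1 x + (q%:R / (p + q).+1%:R) * harm p q.-1 m x.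
Proof.
have n0 : (p + q).+1%:R != 0 :> C by rewrite pnatr_eq0.
apply: (mulfI n0).
have := congr1 (fun P : {poly C} => P`_m) (z2_hgen p q x).
rewrite -!polyC_natr coefCM coefCM coefD coef_deriv coefCM -/(harm p q m x) -/(harm _ _ _ _) -/(harm _ _ _ _).
by move=> ->; rewrite -mulr_natl; field.
Qed.

Lemma w1_harm p q m x : w1 x * harm p q m x =
  (p%:R / (p + q).+1%:R) * harm p.-1 q m x + (- (m.+1%:R / (p + q).+1%:R)) * harm p q.+1 m.+1 x.
Proof.
have n0 : (p + q).+1%:R != 0 :> C by rewrite pnatr_eq0.
apply: (mulfI n0).
have := congr1 (fun P : {poly C} => P`_m) (w1_hgen p q x).
rewrite -!polyC_natr coefCM coefCM coefB coef_deriv coefCM -/(harm p q m x) -/(harm _ _ _ _) -/(harm _ _ _ _).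
by move=> ->; rewrite -mulr_natl; field.
Qed.

(** Read off from z1 = X - t z2, the factor t shifting the coefficient index by one; [w2_harm] uses
    w2 = Y + t w1. *)
Lemma z1_harm p q m x : z1 x * harm p q m x =
  harm p.+1 q m x + (-1) * (if m is m'.+1 then z2 x * harm p q m' x else 0).
Proof.
have h : (z1 x)%:P * hgen p q x = hgen p.+1 q x + (-1) * ((z2 x)%:P * ('X * hgen p q x)).
  by rewrite /hgen exprS /Xp -mul_polyC; ring.
rewrite /harm -coefCM h coefD; congr (_ + _).
by rewrite mulN1r coefN coefCM coefXM mulN1r; case: m => [|m] //=; rewrite mulr0.
Qed.

Lemma w2_harm p q m x : w2 x * harm p q m x =
  harm p q.+1 m x + (if m is m'.+1 then w1 x * harm p q m' x else 0).
Proof.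
have h : (w2 x)%:P * hgen p q x = hgen p q.+1 x + ((w1 x)%:P * ('X * hgen p q x)).
  by rewrite /hgen exprS /Yp -mul_polyC polyCM polyCN; ring.
rewrite /harm -coefCM h coefD; congr (_ + _).
by rewrite coefCM coefXM; case: m => [|m] //=; rewrite mulr0.
Qed.

(** The complex linear span of the family, in a form suited to induction on membership. *)
Inductive hspan : (S -> C) -> Prop :=
| hspan_gen p q m c : hspan (fun x => c * harm p q m x)
| hspan_add h g : hspan h -> hspan g -> hspan (fun x => h x + g x).

Lemma hspan_scale c h : hspan h -> hspan (fun x => c * h x).
Proof.
elim=> [p q m d|h1 h2 _ I1 _ I2].
  have := hspan_gen p q m (c * d); congr hspan; apply/funext => x; by rewrite mulrA.
have := hspan_add I1 I2; congr hspan; apply/funext => x; by rewrite mulrDr.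
Qed.

Lemma hspan_0 : hspan (fun=> 0).
Proof. have := hspan_gen 0 0 0 0; congr hspan; apply/funext => x; by rewrite mul0r. Qed.

Lemma hspan_ext u : (forall p q m, hspan (fun x => u x * harm p q m x)) ->
  forall h, hspan h -> hspan (fun x => u x * h x).
Proof.
move=> hu h; elim=> [p q m d|h1 h2 _ I1 _ I2].
  have := hspan_scale d (hu p q m); congr hspan; apply/funext => x; by rewrite mulrCA.
have := hspan_add I1 I2; congr hspan; apply/funext => x; by rewrite mulrDr.
Qed.

Lemma hspan_z2_harm p q m : hspan (fun x => z2 x * harm p q m x).
Proof.
have := hspan_add (hspan_gen p.+1 q m.+1 (m.+1%:R / (p + q).+1%:R)) (hspan_gen p q.-1 m (q%:R / (p + q).+1%:R)).
by congr hspan; apply/funext => x; rewrite z2_harm.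
Qed.
Lemma hspan_w1_harm p q m : hspan (fun x => w1 x * harm p q m x).
Proof.
have := hspan_add (hspan_gen p.-1 q m (p%:R / (p + q).+1%:R)) (hspan_gen p q.+1 m.+1 (- (m.+1%:R / (p + q).+1%:R))).
by congr hspan; apply/funext => x; rewrite w1_harm.
Qed.
Lemma hspan_harm p q m : hspan (harm p q m).
Proof. by have := hspan_gen p q m 1; congr hspan; apply/funext => x; rewrite mul1r. Qed.
Lemma hspan_z1_harm p q m : hspan (fun x => z1 x * harm p q m x).
Proof.
have h : hspan (fun x => if m is m'.+1 then z2 x * harm p q m' x else 0).
  by case: m => [|m]; [exact: hspan_0|exact: hspan_z2_harm].
have := hspan_add (hspan_harm p.+1 q m) (hspan_scale (-1) h).
by congr hspan; apply/funext => x; rewrite z1_harm.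
Qed.
Lemma hspan_w2_harm p q m : hspan (fun x => w2 x * harm p q m x).
Proof.
have h : hspan (fun x => if m is m'.+1 then w1 x * harm p q m' x else 0).
  by case: m => [|m]; [exact: hspan_0|exact: hspan_w1_harm].
have := hspan_add (hspan_harm p q.+1 m) h.
by congr hspan; apply/funext => x; rewrite w2_harm.
Qed.

Definition realc (a : R) : C := Complex a 0.

Lemma hspan_yc i h : hspan h -> hspan (fun x => realc (yc O i x) * h x).
Proof.
move=> wh; have c2 : (2 : C) != 0 by rewrite pnatr_eq0.
have a2 : realc (1/2) + realc (1/2) = 1.
  by apply: complexP; rewrite /= ?addr0 // -splitr.
have W1 := hspan_ext hspan_z1_harm wh; have W2 := hspan_ext hspan_z2_harm wh.
have W3 := hspan_ext hspan_w1_harm wh; have W4 := hspan_ext hspan_w2_harm wh.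
have half1 c u v : hspan (fun x => u x * h x) -> hspan (fun x => v x * h x) ->
   hspan (fun x => realc (1/2) * c * (u x + v x) * h x).
  move=> Wu Wv; have := hspan_scale (realc (1/2) * c) (hspan_add Wu Wv); congr hspan.
  by apply/funext => x; ring.
have half2 c u v : hspan (fun x => u x * h x) -> hspan (fun x => v x * h x) ->
   hspan (fun x => realc (1/2) * c * (u x - v x) * h x).
  move=> Wu Wv; have := hspan_scale (realc (1/2) * c) (hspan_add Wu (hspan_scale (-1) Wv)); congr hspan.
  by apply/funext => x; ring.
have h12 (a : R) : 1 / 2 * (a + a) = a by rewrite -mulr2n -[a *+ 2]mulr_natr; field.
have e0 x : realc (yc O 0 x) = realc (1/2) * 1 * (z1 x + w1 x).
  apply: complexP; rewrite mulr1 ?reM ?imM ?reD ?imD /=; first by rewrite -[LHS]h12; ring.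
  by ring.
have e1 x : realc (yc O 1 x) = realc (1/2) * (- imc) * (z1 x - w1 x).
  apply: complexP; rewrite !(reM,imM) ?reD ?imD /=; first by rewrite -[LHS]h12; ring.
  by ring.
have e2 x : realc (yc O 2 x) = realc (1/2) * 1 * (z2 x + w2 x).
  apply: complexP; rewrite mulr1 ?reM ?imM ?reD ?imD /=; first by rewrite -[LHS]h12; ring.
  by ring.
have e3 x : realc (yc O 3 x) = realc (1/2) * (- imc) * (z2 x - w2 x).
  apply: complexP; rewrite !(reM,imM) ?reD ?imD /=; first by rewrite -[LHS]h12; ring.
  by ring.
case: i => [[|[|[|[|//]]]] hi].
- have -> : Ordinal hi = 0 by exact: val_inj.
  by have := half1 1 _ _ W1 W3; congr hspan; apply/funext => x; rewrite e0.
- have -> : Ordinal hi = 1 by exact: val_inj.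
  by have := half2 (- imc) _ _ W1 W3; congr hspan; apply/funext => x; rewrite e1.
- have -> : Ordinal hi = 2 by exact: val_inj.
  by have := half1 1 _ _ W2 W4; congr hspan; apply/funext => x; rewrite e2.
- have -> : Ordinal hi = 3 by exact: val_inj.
  by have := half2 (- imc) _ _ W2 W4; congr hspan; apply/funext => x; rewrite e3.
Qed.

Lemma realcD a b : realc (a + b) = realc a + realc b.
Proof. by apply: complexP; rewrite /= ?addr0. Qed.
Lemma realcM a b : realc (a * b) = realc a * realc b.
Proof. by apply: complexP; rewrite ?reM ?imM /=; ring. Qed.

Lemma hspan_dotp v h : hspan h -> hspan (fun x => realc (dotp (val x) v) * h x).
Proof.
move=> wh.
have e x : dotp (val x) v = \sum_i yc O i x * (v *m O^T) 0 i.
  rewrite -[RHS]/(dotp (val x *m O^T) (v *m O^T)) dotp_mulmx trmxK -mulmxA.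
  by rewrite (mulmx1C OO) mulmx1.
have W i : hspan (fun x => realc (yc O i x * (v *m O^T) 0 i) * h x).
  have := hspan_scale (realc ((v *m O^T) 0 i)) (hspan_yc i wh); congr hspan; apply/funext => x.
  by rewrite realcM; ring.
have := hspan_add (hspan_add (hspan_add (hspan_add (W 0) (W 1)) (W 2)) (W 3)) hspan_0.
congr hspan; apply/funext => x; rewrite e !big_ord_recl big_ord0 !realcD.
have e1 : lift ord0 ord0 = 1 :> 'I_4 by exact: val_inj.
have e2 : lift ord0 (lift ord0 ord0) = 2 :> 'I_4 by exact: val_inj.
have e3 : lift ord0 (lift ord0 (lift ord0 ord0)) = 3 :> 'I_4 by exact: val_inj.
have e0 : ord0 = 0 :> 'I_4 by exact: val_inj.
rewrite e1 e2 e3 e0 (_ : realc 0 = 0) //; ring.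
Qed.

(** The complex factor [c] is taken to be 1 or i later, to isolate the real or the imaginary part of
    an orthogonal function. *)
Lemma hspan_peak v c n : hspan (fun x => c * realc ((1 + dotp (val x) v) ^+ n)).
Proof.
elim: n => [|n IH].
  have := hspan_gen 0 0 0 c; congr hspan; apply/funext => x.
  by rewrite /harm /hgen !expr0 mulr1 coef1.
have := hspan_add IH (hspan_dotp v IH); congr hspan; apply/funext => x.
by rewrite exprS realcM realcD (_ : realc 1 = 1) //; ring.
Qed.
End Basis.

(** * Completeness *)

Section Density.
Variable R : realType.
Local Notation V4 := 'rV[R]_4.
Local Notation S := (S3 R).
Implicit Types (u f v : S -> R) (p : S).

Lemma contSZ c u : contS u -> contS (fun p => c * u p).
Proof. by move=> cu; exact: (contSM (@contS_cst R c) cu). Qed.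

Lemma contSN u : contS u -> contS (fun p => - u p).
Proof.
move=> cu; have -> : (fun p => - u p) = (fun p => (-1) * u p).
  by apply/funext => p; rewrite mulN1r.
exact: contSZ.
Qed.

Lemma sintB u v : contS u -> contS v -> sint (fun p => u p - v p) = sint u - sint v.
Proof.
move=> cu cv; rewrite (sintD cu (contSN cv)).
have -> : (fun p => - v p) = (fun p => (-1) * v p).
  by apply/funext => p; rewrite mulN1r.
by rewrite (@sintZ R (-1) _ cv) mulN1r.
Qed.

Lemma sint_le u v : contS u -> contS v -> (forall p, u p <= v p) -> sint u <= sint v.
Proof.
move=> cu cv uv; rewrite -subr_ge0 -(sintB cv cu); apply: sint_ge0.
  exact: (contSD cv (contSN cu)).
by move=> p; rewrite subr_ge0.
Qed.

Lemma sfun_dotp_val (v : V4) : sfun (fun x : S => dotp (val x) v).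
Proof. by apply: sfun_sum => i; apply: sfunM; [exact: sfun_coordS|exact: sfun_cst]. Qed.

Lemma sfun_exp u n : sfun u -> sfun (fun x => u x ^+ n).
Proof.
move=> su; elim: n => [|n IH].
  have -> : (fun x => u x ^+ 0) = fun=> 1 by apply/funext => x; rewrite expr0.
  exact: sfun_cst.
have -> : (fun x => u x ^+ n.+1) = fun x => u x * u x ^+ n.
  by apply/funext => x; rewrite exprS.
exact: sfunM.
Qed.

Lemma sup_norm_dotp (x : V4) : `|x| ^+ 2 <= dotp x x.
Proof.
have d0 := dotp_ge0 x.
rewrite -[leRHS]sqr_sqrtr // lerXn2r ?nnegrE ?sqrtr_ge0 ?normr_ge0 //.
rewrite /Num.Def.normr /= mx_normrE; apply: bigmax_le => [|[a i] _ /=]; first exact: sqrtr_ge0.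
rewrite ord1 -(@ler_pXn2r _ 2) ?nnegrE ?sqrtr_ge0 // sqr_sqrtr // real_normK ?num_real //.
rewrite /dotp (bigD1 i) //= -expr2 lerDl.
by apply: sumr_ge0 => j _; rewrite -expr2 sqr_ge0.
Qed.

(* The powers of 1 + <x,p> concentrate at p. *)
Lemma peak_le0 f p : contS f ->
  (forall n, sint (fun x => f x * (1 + dotp (val x) (val p)) ^+ n) = 0) -> f p <= 0.
Proof.
move=> cf hI; rewrite leNgt; apply/negP => fp.
have [M fM] := contS_bounded cf.
pose T (x : S) := 1 + dotp (val x) (val p).
have T0 x : 0 <= T x by have := dotp_S3_ge x p; rewrite /T; lra.
have T2 x : T x <= 2.
  have := dotp_ge0 (val x - val p).
  by rewrite /T !(dotpDl, dotpDr, dotpNl, dotpNr) !S3_dotp (dotpC (val p)); lra.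
have M0 : 0 <= M by apply: le_trans (fM p).
pose c := f p / 2; have c0 : 0 < c by rewrite divr_gt0.
have := cf _ (S3_neq0 p) => /cvgrPdist_lt /(_ _ c0) /(@nbhs_normP R V4) [d /= d0 hd].
(* With T = 1 + <x, p> one has |x - p|^2 = 4 - 2T, so T >= 2 - del forces |x - p|^2 <= d^2 / 2. *)
pose del := Num.min (d ^+ 2 / 4) (1 / 2).
have del0 : 0 < del by rewrite lt_min divr_gt0 ?exprn_gt0 //; lra.
have del1 : del <= 1/2 by rewrite ge_min lexx orbT.
have deld : del <= d ^+ 2 / 4 by rewrite ge_min lexx.
have near_p x : 2 - del <= T x -> c <= f x.
  move=> Tx; have := hd (val x); rewrite /ball_ /= !exts_val => hx.
  have /hx : `|val p - val x| < d.
    rewrite -(@ltr_pXn2r _ 2) ?nnegrE ?normr_ge0 ?(ltW d0) //.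
    apply: le_lt_trans (sup_norm_dotp _) _.
    rewrite !(dotpDl, dotpDr, dotpNl, dotpNr) !S3_dotp (dotpC (val p)).
    have := exprn_gt0 2 d0; move: Tx; rewrite /T; lra.
  by rewrite /= ?exts_val ltr_norml => /andP[_]; rewrite /c; lra.
(* A continuous bump at p, at most 1 and supported where T >= 2 - del / 2; on its support T^n
   dominates a^n, while T < b < a away from p. *)
pose v (x : S) := Num.max 0 (T x - (2 - del / 2)).
have sT : sfun T by apply: sfunD; [exact: sfun_cst|exact: sfun_dotp_val].
have cv : contS v.
  apply: contS_max; first exact: contS_cst.
  by apply: sfun_cont; apply: sfunB => //; exact: sfun_cst.
have v0 x : 0 <= v x by rewrite le_max lexx.
have Iv : 0 < sint v.
  apply: (sint_gt0 (p := p)) => //; rewrite lt_max; apply/orP; right.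
  by rewrite /T S3_dotp; lra.
pose a := 2 - del / 2; pose b := 2 - del.
have a0 : 0 < a by rewrite /a; lra.
have b0 : 0 < b by rewrite /b; lra.
have ba : `|b / a| < 1 by rewrite ger0_norm ?divr_ge0 ?ltW // ltr_pdivrMr // mul1r /a /b; lra.
pose K := M + c.
have low n x : c * a ^+ n * v x - K * b ^+ n <= f x * T x ^+ n.
  have av : a ^+ n * v x <= T x ^+ n.
    rewrite /v; have [h|h] := leP (T x - a) 0.
      by rewrite mulr0 exprn_ge0.
    have h1 : a ^+ n <= T x ^+ n by rewrite lerXn2r ?nnegrE ?ltW //; lra.
    apply: le_trans h1; rewrite ler_piMr ?exprn_ge0 ?ltW //.
    have := T2 x; rewrite /a; lra.
  have bn : 0 <= b ^+ n by rewrite exprn_ge0 // ltW.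
  have K0 : 0 <= K by rewrite /K addr_ge0 // ltW.
  have Tn : 0 <= T x ^+ n by rewrite exprn_ge0.
  have cav : c * a ^+ n * v x <= c * T x ^+ n by rewrite -mulrA ler_pM2l.
  have [h|h] := leP b (T x).
    have fc := near_p _ h.
    have : c * T x ^+ n <= f x * T x ^+ n by rewrite ler_wpM2r.
    have := mulr_ge0 K0 bn; lra.
  have Tb : T x ^+ n <= b ^+ n by rewrite lerXn2r ?nnegrE ?T0 ?(ltW b0) ?(ltW h).
  have : - M <= f x by have := fM x; rewrite ler_norml => /andP[].
  move=> /(ler_wpM2r Tn) h1; have h2 := ler_wpM2l K0 Tb.
  move: cav h1 h2; rewrite /K; lra.
have cT n : contS (fun x => T x ^+ n) by apply: sfun_cont; exact: sfun_exp.
have cc r : contS (fun=> r) := @contS_cst R r.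
(* Integrating [low] bounds a fixed positive number by a multiple of (b / a)^n, which tends to
   zero. *)
have main n : c * sint v <= K * sint (fun=> 1) * (b / a) ^+ n.
  have := @sint_le _ _ _ _ (low n); rewrite hI.
  have -> : (fun x => c * a ^+ n * v x - K * b ^+ n) = 
            (fun x => (c * a ^+ n) * v x - (K * b ^+ n) * 1) by apply/funext => x; rewrite mulr1.
  rewrite sintB; [|by apply: contSM|by apply: contSM].
  rewrite !sintZ // subr_le0 => h.
  have an : 0 < a ^+ n by rewrite exprn_gt0.
  rewrite exprMn exprVn mulrA ler_pdivlMr //.
  have : c * a ^+ n * sint v <= K * b ^+ n * sint (fun=> 1).
    apply: h; last by apply: contSM.
    exact: (contSD (contSM (cc (c * a ^+ n)) cv) (contSN (contSM (cc (K * b ^+ n)) (cc 1)))).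
  by congr (_ <= _); ring.
have := cvg_expr ba => /cvgrPdist_lt.
set B := K * sint (fun=> 1) in main.
have A0 : 0 < c * sint v by rewrite mulr_gt0.
have B0 : 0 < B.
  rewrite /B mulr_gt0 ?ltr_wpDl //; apply: (sint_gt0 (p := p)) => //.
move=> /(_ (c * sint v / B)); rewrite divr_gt0 // => /(_ isT) [n _ /(_ n (leqnn n))] /=.
rewrite sub0r normrN normrX ger0_norm ?divr_ge0 ?ltW // ltr_pdivlMr //.
by rewrite mulrC ltNge main.
Qed.
End Density.

(** * Inner product, symmetry of the operator, density and projections *)

Section Hilbert.
Variable R : realType.
Local Notation V4 := 'rV[R]_4.
Local Notation S := (S3 R).
Local Notation C := R[i].
Local Notation imc := (@imc R).
Local Notation re := (@complex.Re R).
Local Notation im := (@complex.Im R).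
Local Notation realc := (@realc R).
Implicit Types (h g : S -> C).

(** The real part of the hermitian product: the eigenspaces are counted over the reals, so real
    bilinearity is what is used. *)
Definition inner h g : R := sint (fun x => re (h x) * re (g x) + im (h x) * im (g x)).

Lemma contS_inner h g : sfunC h -> sfunC g ->
  contS (fun x => re (h x) * re (g x) + im (h x) * im (g x)).
Proof. by move=> [h1 h2] [g1 g2]; apply: sfun_cont; apply: sfunD; exact: sfunM. Qed.

Lemma innerC h g : inner h g = inner g h.
Proof. by congr sint; apply/funext => x; rewrite mulrC [X in _ + X]mulrC. Qed.

Lemma re_rcM a (z : C) : re (realc a * z) = a * re z.
Proof. by rewrite reM /= mul0r subr0. Qed.
Lemma im_rcM a (z : C) : im (realc a * z) = a * im z.
Proof. by rewrite imM /= mul0r addr0. Qed.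

Lemma innerD h1 h2 g : sfunC h1 -> sfunC h2 -> sfunC g ->
  inner (fun x => h1 x + h2 x) g = inner h1 g + inner h2 g.
Proof.
move=> s1 s2 sg; rewrite /inner -sintD; try exact: contS_inner.
by congr sint; apply/funext => x; rewrite reD imD; ring.
Qed.
Lemma innerZ a h g : sfunC h -> sfunC g -> inner (fun x => realc a * h x) g = a * inner h g.
Proof.
move=> sh sg; rewrite /inner -sintZ; last exact: contS_inner.
by congr sint; apply/funext => x; rewrite re_rcM im_rcM; ring.
Qed.

Lemma inner0l h : sfunC h -> inner (fun=> 0) h = 0.
Proof.
move=> sh; have e : (fun x : S => realc 0 * (0 : C)) = fun=> 0.
  by apply/funext => x; rewrite mulr0.
have e0 := innerZ 0 (sfunC_cst 0) sh; rewrite (mul0r (inner _ _)) in e0.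
by rewrite -[RHS]e0 e.
Qed.

Lemma inner_eq0 h : sfunC h -> inner h h = 0 -> h = fun=> 0.
Proof.
move=> sh h0; apply/funext => p; apply/eqP; apply: contraT => hp.
have : 0 < inner h h; last by rewrite h0 ltxx.
apply: (sint_gt0 (p := p)); first exact: contS_inner.
  by move=> q; rewrite -!expr2 addr_ge0 ?sqr_ge0.
rewrite -!expr2 lt_def addr_ge0 ?sqr_ge0 // andbT paddr_eq0 ?sqr_ge0 // !sqrf_eq0.
apply: contra hp => /andP[/eqP r0 /eqP i0]; apply/eqP; exact: complexP.
Qed.

Section Jacobi.
Variable O : 'M[R]_4.
Hypothesis OO : O *m O^T = 1%:M.
Local Notation jacC := (jacC O).
Local Notation hspan := (hspan O).
Local Notation harm := (harm O).

Lemma sfunC_jacC h : sfunC h -> sfunC (jacC h).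
Proof.
move=> sh; have s k : sfunC (lieC (Mo O k) h) by exact: sfunC_lieC.
have s2 k : sfunC (lieC (Mo O k) (lieC (Mo O k) h)) by exact: sfunC_lieC.
have := sfunCD (sfunCM (sfunC_cst (-1)) (sfunCD (sfunCD (s2 0) (s2 1)) (s2 2))) (sfunCM (sfunC_cst (2 * imc)) (s 0)).
by congr sfunC; apply/funext => x; rewrite mulN1r.
Qed.

Lemma jacCD h g : sfunC h -> sfunC g -> jacC (fun x => h x + g x) = fun x => jacC h x + jacC g x.
Proof.
move=> sh sg; have s k f (sf : sfunC f) : sfunC (lieC (Mo O k) f) by exact: sfunC_lieC.
have e k := lieCD (Mo O k) sh sg; have e2 k := lieCD (Mo O k) (s k _ sh) (s k _ sg).
rewrite /jacC (e 0) (e 1) (e 2) (e2 0) (e2 1) (e2 2); apply/funext => x.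
move: (lieC (Mo O 0)) (lieC (Mo O 1)) (lieC (Mo O 2)) => D0 D1 D2; ring.
Qed.
Lemma jacCZ c h : sfunC h -> jacC (fun x => c * h x) = fun x => c * jacC h x.
Proof.
move=> sh; have s k f (sf : sfunC f) : sfunC (lieC (Mo O k) f) by exact: sfunC_lieC.
have e k := lieCZ (Mo O k) c sh; have e2 k := lieCZ (Mo O k) c (s k _ sh).
rewrite /jacC (e 0) (e 1) (e 2) (e2 0) (e2 1) (e2 2); apply/funext => x.
move: (lieC (Mo O 0)) (lieC (Mo O 1)) (lieC (Mo O 2)) => D0 D1 D2; ring.
Qed.

Lemma reN (z : C) : re (- z) = - re z. Proof. by case: z. Qed.
Lemma imN (z : C) : im (- z) = - im z. Proof. by case: z. Qed.
Lemma two_imcM (z : C) : 2 * imc * z = Complex (- 2 * im z) (2 * re z).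
Proof.
by apply: complexP; rewrite !(reM, imM) /= ?mulr0 ?mulr1 ?add0r ?addr0 ?subr0; ring.
Qed.

Lemma re_jacC h x : re (jacC h x) = lap (Mo O) (fun q => re (h q)) x
  - 2 * lie (Mo O 0) (fun q => im (h q)) x.
Proof.
rewrite /jacC two_imcM reD reN !reD /lap sum_I3 mulNr.
by congr (- (_ + _ + _) - _).
Qed.
Lemma im_jacC h x : im (jacC h x) = lap (Mo O) (fun q => im (h q)) x
  + 2 * lie (Mo O 0) (fun q => re (h q)) x.
Proof.
rewrite /jacC two_imcM imD imN !imD /lap sum_I3.
by congr (- (_ + _ + _) + _).
Qed.

Lemma sint_divergence (A B E : 'M[R]_4) (u v w z : S -> R) :
  A^T = - A -> B^T = - B -> E^T = - E -> sfun u -> sfun v -> sfun w -> sfun z ->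
  sint (fun p => ((lie A u p + lie B v p) + lie E w p) + 2 * lie A z p) = 0.
Proof.
move=> sA sB sE su sv sw sz.
have cL (N : 'M[R]_4) (f : S -> R) : sfun f -> contS (lie N f) by move=> sf; exact: sfun_cont (sfun_lie N sf).
have cu := cL A _ su; have cv := cL B _ sv; have cw := cL E _ sw; have cz := cL A _ sz.
rewrite (sintD (contSD (contSD cu cv) cw) (@contSZ R 2 _ cz)).
rewrite (sintD (contSD cu cv) cw) (sintD cu cv) (@sintZ R 2 _ cz).
by rewrite (sint_lie sA su) (sint_lie sB sv) (sint_lie sE sw) (sint_lie sA sz) mulr0 !addr0.
Qed.

(** The difference of the two integrands is a sum of derivatives along the fields x M_k, on which
    the functional vanishes. *)
Lemma jacC_sym h g : sfunC h -> sfunC g -> inner (jacC h) g = inner h (jacC g).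
Proof.
move=> sh sg; apply/eqP; rewrite -subr_eq0 /inner.
have cJ f k : sfunC f -> sfunC k -> contS (fun x => re (jacC f x) * re (k x) + im (jacC f x) * im (k x)).
  by move=> sf sk; apply: contS_inner => //; exact: sfunC_jacC.
have cJ' : contS (fun x => re (h x) * re (jacC g x) + im (h x) * im (jacC g x)).
  by apply: contS_inner => //; exact: sfunC_jacC.
rewrite -sintB //; last exact: cJ.
case: sh sg {cJ cJ'} => [sa sb] [sa' sb'].
set a := (fun p => re (h p)) in sa; set b := (fun p => im (h p)) in sb.
set a' := (fun p => re (g p)) in sa'; set b' := (fun p => im (g p)) in sb'.
(* W is the real part of conj(h) Dg - conj(Dh) g, whose derivative produces the second-order terms;
   Z, the imaginary part of conj(h) g, accounts for the term 2 i D_0. *)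
pose W (N : 'M[R]_4) p := (a p * lie N a' p - lie N a p * a' p) + (b p * lie N b' p - lie N b p * b' p).
pose Z p := a p * b' p - b p * a' p.
have sL (N : 'M[R]_4) (u : S -> R) : sfun u -> sfun (lie N u) by exact: sfun_lie.
have sW N : sfun (W N) by apply: sfunD; apply: sfunB; apply: sfunM; auto.
have sZ : sfun Z by apply: sfunB; apply: sfunM.
have LW N p : lie N (W N) p = (a p * lie N (lie N a') p - lie N (lie N a) p * a' p) +
    (b p * lie N (lie N b') p - lie N (lie N b) p * b' p).
  have P1 u v : sfun u -> sfun v -> lie N (fun q => u q * lie N v q - lie N u q * v q) p =
      u p * lie N (lie N v) p - lie N (lie N u) p * v p.
    move=> su sv; have su' := sL N _ su; have sv' := sL N _ sv.
    rewrite (lieB _ (sfunM su sv') (sfunM su' sv)) (lieM _ su sv') (lieM _ su' sv).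
    move: (lie N (lie N u) p) (lie N (lie N v) p) (lie N u p) (lie N v p) (u p) (v p).
    by move=> *; ring.
  have sD u v : sfun u -> sfun v -> sfun (fun q => u q * lie N v q - lie N u q * v q).
    by move=> su sv; apply: sfunB; apply: sfunM; auto.
  by rewrite /W (lieD _ (sD _ _ sa sa') (sD _ _ sb sb')) !P1.
have LZ0 N p : lie N Z p = (a p * lie N b' p + b' p * lie N a p) -
     (b p * lie N a' p + a' p * lie N b p).
  by rewrite /Z (lieB _ (sfunM sa sb') (sfunM sb sa')) (lieM _ sa sb') (lieM _ sb sa').
have key A B E : (fun p =>
     (- (lie A (lie A a) p + lie B (lie B a) p + lie E (lie E a) p) - 2 * lie A b p) * a' p +
     (- (lie A (lie A b) p + lie B (lie B b) p + lie E (lie E b) p) + 2 * lie A a p) * b' p -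
     (a p * (- (lie A (lie A a') p + lie B (lie B a') p + lie E (lie E a') p) - 2 * lie A b' p) +
      b p * (- (lie A (lie A b') p + lie B (lie B b') p + lie E (lie E b') p) + 2 * lie A a' p))) =
   (fun p => ((lie A (W A) p + lie B (W B) p) + lie E (W E) p) + 2 * lie A Z p).
  apply/funext => p; rewrite (LW A p) (LW B p) (LW E p) (LZ0 A p).
  move: (a p) (b p) (a' p) (b' p) => xa xb xa' xb'.
  move: (lie A (lie A a) p) (lie B (lie B a) p) (lie E (lie E a) p) (lie A (lie A b) p) (lie B (lie B b) p)
    (lie E (lie E b) p) (lie A (lie A a') p) (lie B (lie B a') p) (lie E (lie E a') p)
    (lie A (lie A b') p) (lie B (lie B b') p) (lie E (lie E b') p)
    (lie A a p) (lie A b p) (lie A a' p) (lie A b' p).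
  by move=> *; ring.
have e : (fun p => re (jacC h p) * re (g p) + im (jacC h p) * im (g p) -
     (re (h p) * re (jacC g p) + im (h p) * im (jacC g p))) =
   (fun p => ((lie (Mo O 0) (W (Mo O 0)) p + lie (Mo O 1) (W (Mo O 1)) p)
      + lie (Mo O 2) (W (Mo O 2)) p) + 2 * lie (Mo O 0) Z p).
  rewrite -key; apply/funext => p.
  congr (_ * _ + _ * _ - (_ * _ + _ * _)).
  - by rewrite re_jacC /lap sum_I3.
  - by rewrite im_jacC /lap sum_I3.
  - by rewrite re_jacC /lap sum_I3.
  - by rewrite im_jacC /lap sum_I3.
rewrite e; apply/eqP; apply: sint_divergence; auto; exact: Mo_sk.
Qed.

Lemma hspan_SmC g : hspan g -> sfunC g.
Proof.
elim=> [p q m c|h1 h2 _ s1 _ s2]; last exact: sfunCD.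
by apply: sfunCM; [exact: sfunC_cst|exact: sfunC_harm].
Qed.

Definition jeig (p q : nat) : R := ((p + q) * (p + q + 2))%:R + 2 * (q%:R - p%:R).

Lemma jeigCE p q : jeigC R p q = realc (jeig p q).
Proof.
have rcn n : realc n%:R = n%:R.
  elim: n => [|n IH]; first by [].
  by rewrite -[n.+1]addn1 !natrD realcD IH.
have rcN a : realc (- a) = - realc a by apply: complexP; rewrite /= ?oppr0.
by rewrite /jeigC /jeig realcD realcM (realcD q%:R) rcN !rcn.
Qed.

Lemma eigen_orth l h p q m c : sfunC h -> (forall x, jacC h x = realc l * h x) ->
  l != jeig p q -> inner h (fun x => c * harm p q m x) = 0.
Proof.
move=> sh eh lpq; set g := fun x => _.
have sg : sfunC g by apply: hspan_SmC; exact: hspan_gen.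
have eg : jacC g = fun x => realc (jeig p q) * g x.
  rewrite jacCZ; last exact: sfunC_harm.
  by apply/funext => x; rewrite jacC_harm // jeigCE /g mulrCA.
have := jacC_sym sh sg; rewrite eg [inner h _]innerC innerZ // (_ : jacC h = fun x => realc l * h x).
  rewrite innerZ // [inner g h]innerC => /eqP; rewrite -subr_eq0 -mulrBl mulf_eq0 subr_eq0 (negbTE lpq).
  by move=> /eqP.
by apply/funext.
Qed.

(** Orthogonality to the peaks at p, applied to a real function and to its opposite, gives the value
    zero at p; real and imaginary parts are treated separately. *)
Lemma hspan_dense h : sfunC h -> (forall g, hspan g -> inner h g = 0) -> h = fun=> 0.
Proof.
move=> [s1 s2] hg; apply/funext => p.
have peak (f : S -> R) : sfun f ->
  (forall n, sint (fun x => f x * (1 + dotp (val x) (val p)) ^+ n) = 0) -> f p = 0.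
  move=> sf hf; apply/eqP; rewrite eq_le (peak_le0 (sfun_cont sf)) //=.
  rewrite -oppr_le0; apply: (@peak_le0 _ (fun x => - f x)) => [|n].
    by apply: sfun_cont; exact: sfunN.
  have cfT : contS (fun x => f x * (1 + dotp (val x) (val p)) ^+ n).
    apply: sfun_cont; apply: sfunM => //; apply: sfun_exp.
    by apply: sfunD; [exact: sfun_cst|exact: sfun_dotp_val].
  have := @sintZ R (-1) _ cfT; rewrite hf mulr0 => <-; congr sint.
  by apply/funext => x; rewrite mulN1r mulNr.
apply: complexP => /=.
  apply: (peak (fun x => re (h x))) => // n.
  have := hg _ (hspan_peak OO (val p) 1 n) => <-; congr sint.
  by apply/funext => x; rewrite mul1r /= mulr0 addr0.
apply: (peak (fun x => im (h x))) => // n.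
have := hg _ (hspan_peak OO (val p) imc n) => <-; congr sint.
by apply/funext => x; rewrite reM imM /=; ring.
Qed.

Fixpoint rspan (bs : seq (S -> C)) h : Prop :=
  if bs is b :: bs' then
    exists r g, rspan bs' g /\ h = fun x => realc r * b x + g x
  else h = fun=> 0.

Definition all_sfunC (bs : seq (S -> C)) := forall i, (i < size bs)%N -> sfunC (nth (fun=> 0) bs i).

Lemma all_sfunC_cons b bs : all_sfunC (b :: bs) <-> sfunC b /\ all_sfunC bs.
Proof.
split=> [h|[hb h] [|i] //]; last by move=> ?; exact: h.
by split=> [|i hi]; [exact: (h 0%N)|exact: (h i.+1)].
Qed.

Lemma span_SmC bs h : all_sfunC bs -> rspan bs h -> sfunC h.
Proof.
elim: bs h => [|b bs IH] h /=; first by move=> _ ->; exact: sfunC_cst.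
move=> /all_sfunC_cons[sb sbs] [r [g [hg ->]]].
by apply: sfunCD; [apply: sfunCM => //; exact: sfunC_cst|exact: IH].
Qed.

Lemma span_lin bs h g a : rspan bs h -> rspan bs g -> rspan bs (fun x => realc a * h x + g x).
Proof.
elim: bs h g => [|b bs IH] h g /=.
  by move=> -> ->; apply/funext => x; rewrite mulr0 addr0.
move=> [r [h' [sh' ->]]] [t [g' [sg' ->]]].
exists (a * r + t), (fun x => realc a * h' x + g' x); split; first exact: IH.
by apply/funext => x; rewrite realcD realcM; ring.
Qed.

Definition orth bs h := forall i, (i < size bs)%N -> inner h (nth (fun=> 0) bs i) = 0.

Lemma orth_cons b bs h : orth (b :: bs) h <-> inner h b = 0 /\ orth bs h.
Proof.
split=> [h0|[hb h0] [|i] //]; last by move=> ?; exact: h0.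
by split=> [|i hi]; [exact: (h0 0%N)|exact: (h0 i.+1)].
Qed.

Lemma orth_span bs h g : all_sfunC bs -> sfunC h -> orth bs h -> rspan bs g -> inner h g = 0.
Proof.
elim: bs g => [|b bs IH] g /= ab sh.
  by move=> _ ->; rewrite innerC inner0l.
move/all_sfunC_cons: ab => [sb ab] /orth_cons[hb h0] [r [g' [sg' ->]]].
rewrite innerC innerD ?innerZ //; last 2 first.
- by apply: sfunCM => //; exact: sfunC_cst.
- exact: span_SmC sg'.
by rewrite innerC hb mulr0 add0r innerC; exact: IH.
Qed.

(** Gram-Schmidt along the list: b' is b minus its projection on the tail, and the component along
    b' is subtracted last. *)
Lemma projection bs h : all_sfunC bs -> sfunC h ->
  exists g, rspan bs g /\ orth bs (fun x => h x + realc (-1) * g x).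
Proof.
elim: bs h => [|b bs IH] h ab sh; first by exists (fun=> 0); split.
move/all_sfunC_cons: ab => [sb ab].
have [g [sg og]] := IH h ab sh; have [e [se oe]] := IH b ab sb.
have Sg := span_SmC ab sg; have Se := span_SmC ab se.
set h' := fun x => _ in og; set b' := fun x => _ in oe.
have sc a f : sfunC f -> sfunC (fun x => realc a * f x) by move=> sf; apply: sfunCM => //; exact: sfunC_cst.
have Sh' : sfunC h' by apply: sfunCD; auto.
have Sb' : sfunC b' by apply: sfunCD; auto.
(* If <b', b'> = 0 then b' = 0 and b already lies in the span of the tail, so no correction is
   due. *)
pose t := if inner b' b' == 0 then 0 else inner h' b / inner b' b'.
exists (fun x => realc t * b x + (realc (- t) * e x + g x)); split.
  by exists t, (fun x => realc (- t) * e x + g x); split=> //; apply: span_lin.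
have -> : (fun x => h x + realc (-1) * (realc t * b x + (realc (- t) * e x + g x))) =
   (fun x => h' x + realc (- t) * b' x).
  apply/funext => x; rewrite /h' /b' (_ : realc (-1) = -1); last by apply: complexP; rewrite /= ?oppr0.
  rewrite (_ : realc (- t) = - realc t); last by apply: complexP; rewrite /= ?oppr0.
  ring.
have IPt f : sfunC f -> inner (fun x => h' x + realc (- t) * b' x) f = inner h' f - t * inner b' f.
  by move=> sf; rewrite innerD ?innerZ ?mulNr //; auto.
apply/orth_cons; split; last first.
  move=> i hi; rewrite IPt; last exact: ab.
  by rewrite og // oe // mulr0 subr0.
rewrite IPt //.
have be : b = fun x => realc 1 * e x + b' x.
  by apply/funext => x; rewrite /b' (_ : realc 1 = 1) // (_ : realc (-1) = -1);
    [ring|apply: complexP; rewrite /= ?oppr0].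
have b'b : inner b' b = inner b' b'.
  rewrite [in LHS]be innerC innerD ?innerZ //; last exact: sc.
  by rewrite innerC (orth_span ab Sb' oe se) mulr0 add0r.
rewrite b'b /t; case: eqP => [b0|/eqP b0].
  rewrite mul0r subr0; have z := inner_eq0 Sb' b0.
  rewrite be z innerC.
  have -> : (fun x => realc 1 * e x + (fun=> 0) x) = e.
    by apply/funext => x; rewrite (_ : realc 1 = 1) // mul1r addr0.
  by rewrite innerC (orth_span ab Sh' og se).
by rewrite divfK // subrr.
Qed.

End Jacobi.
End Hilbert.

(** * Linear independence, description of the eigenfunctions, and dimension *)

Section Multiplicity.
Variable R : realType.
Local Notation V4 := 'rV[R]_4.
Local Notation S := (S3 R).
Local Notation C := R[i].
Local Notation imc := (@imc R).
Local Notation re := (@complex.Re R).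
Local Notation im := (@complex.Im R).
Local Notation realc := (@realc R).
Implicit Types (h g : S -> C).
Variable O : 'M[R]_4.
Hypothesis OO : O *m O^T = 1%:M.
Local Notation jacC := (jacC O).
Local Notation hspan := (hspan O).
Local Notation harm := (harm O).

Lemma realc_inj : injective realc. Proof. by move=> a b []. Qed.
(** The point has coordinates proportional to (-s, 0, 1, 0), so that w2 = r and w1 = - r s are real.
    It turns a relation among the coefficients of Y^q into a polynomial identity in s. *)
Lemma Yp_point (s : R) : exists x : S, exists2 r : R, r != 0 &
  Yp O x = (realc r)%:P * (1 + realc s *: 'X).
Proof.
pose v : V4 := \row_(j < 4) nth 0 [:: - s; 0; 1; 0] j.
have v0 : punctured (v *m O).
  apply/eqP => vO; have : v = 0.
    by rewrite -[v]mulmx1 -OO mulmxA vO mul0mx.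
  move=> /rowP /(_ (2 : 'I_4)); rewrite !mxE /=; apply/eqP; exact: oner_neq0.
pose r := (nrm (v *m O))^-1.
have y i : yc O i (retract (v *m O)) = r * v 0 i.
  by rewrite /yc val_retract // -scalemxAl -mulmxA OO mulmx1 mxE.
exists (retract (v *m O)), r; first by rewrite invr_eq0 gt_eqF // nrm_gt0.
rewrite /Yp /w1 /w2 !y !mxE /=.
have -> : Complex (r * 1) (- (r * 0)) = realc r by apply: complexP; rewrite /= ?mulr1 ?mulr0 ?oppr0.
have -> : Complex (r * - s) (- (r * 0)) = realc r * (- realc s).
  by apply: complexP; rewrite ?reM ?imM /=; ring.
by rewrite -!mul_polyC !(polyCM, polyCN); ring.
Qed.

Lemma coef_expr1DX (a : C) n m : ((1 + a *: 'X) ^+ n)`_m = a ^+ m *+ 'C(n, m).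
Proof.
have -> : (1 + a *: 'X : {poly C}) ^+ n = \poly_(i < n.+1) (a ^+ i *+ 'C(n, i)).
  rewrite exprDn poly_def; apply: eq_bigr => i _.
  by rewrite expr1n mul1r exprZn scalerMnl.
rewrite coef_poly; case: ltnP => // nm.
by rewrite bin_small // mulr0n.
Qed.

(* The operator D_1 - i D_2 maps the (p, q) family to the (p-1, q+1) family, which reduces
   the claim to p = 0, where a monomial basis appears. *)
Lemma harm_free p q (c : nat -> C) :
  (forall x, \sum_(m < (p + q).+1) c m * harm p q m x = 0) ->
  forall m, (m <= p + q)%N -> c m = 0.
Proof.
elim: p q c => [|p IH] q c h.
  (* At the point of [Yp_point] the t^m coefficient of Y^q is r^q s^m times a binomial coefficient,
     so every real s is a root; the q + 1 roots 0, ..., q already exceed the degree. *)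
  pose P := \poly_(m < q.+1) (c m *+ 'C(q, m)).
  have rootP s : root P (realc s).
    have [x [r r0 Yx]] := Yp_point s.
    have rq0 : realc r ^+ q != 0 by rewrite expf_neq0 // -[0]/(realc 0) (inj_eq realc_inj).
    rewrite /root horner_poly -(mulrI_eq0 _ (mulfI rq0)) mulr_sumr.
    rewrite -[X in _ == X](h x); apply/eqP; apply: eq_bigr => m _.
    rewrite /harm /hgen expr0 mul1r Yx exprMn -polyC_exp coefCM coef_expr1DX.
    by rewrite mulrnAl !mulrnAr mulrCA.
  have P0 : P = 0.
    apply: (@roots_geq_poly_eq0 _ _ [seq realc i%:R | i <- iota 0 q.+1]).
    - by apply/allP => _ /mapP[i _ ->]; exact: rootP.
    - rewrite map_inj_uniq ?iota_uniq // => i j /realc_inj /eqP.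
      by rewrite eqr_nat => /eqP.
    - by rewrite size_map size_iota; exact: size_poly.
  move=> m mq; have : P`_m = 0 by rewrite P0 coef0.
  rewrite coef_poly ltnS mq => /eqP; rewrite mulrn_eq0.
  by rewrite -leqn0 leqNgt bin_gt0 mq /= => /eqP.
have sc k : sfunC (fun x => c k * harm p.+1 q k x).
  by apply: sfunCM; [exact: sfunC_cst|exact: sfunC_harm].
have F0 : (fun x => \sum_(m < (p.+1 + q).+1) c m * harm p.+1 q m x) = fun=> 0.
  by apply/funext => x; exact: h.
have D0 k : (fun x => \sum_(m < (p.+1 + q).+1) c m * lieC (Mo O k) (harm p.+1 q m) x) = fun=> 0.
  have := congr1 (lieC (Mo O k)) F0; rewrite lieC_cst lieC_sum; last by move=> i; exact: sc.
  move=> <-; apply/funext => x; apply: eq_bigr => i _.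
  by rewrite lieCZ //; exact: sfunC_harm.
move=> k; rewrite addSnnS; apply: (IH q.+1 c) => {k} x; rewrite addnS -addSn.
have e1 := congr1 (fun f : S -> C => f x) (D0 1).
have e2 := congr1 (fun f : S -> C => f x) (D0 2).
(* The factor by which D_1 - i D_2 sends the (p+1, q) family to the (p, q+1) family; the
   contributions of bidegree (p+2, q-1) cancel. *)
have p2 : (- 2 * p.+1%:R : C) != 0 by rewrite mulf_neq0 ?oppr_eq0 ?pnatr_eq0.
apply: (mulfI p2); rewrite mulr0 mulr_sumr.
have e3 : \sum_(m < (p.+1 + q).+1) c m * lieC (Mo O 1) (harm p.+1 q m) x
     + (- imc) * \sum_(m < (p.+1 + q).+1) c m * lieC (Mo O 2) (harm p.+1 q m) x = 0.
  have e12 (a b : C) : a = 0 -> b = 0 -> a + (- imc) * b = 0.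
    by move=> -> ->; rewrite mulr0 addr0.
  exact: e12 e1 e2.
rewrite -[RHS]e3 mulr_sumr -big_split /=; apply: eq_bigr => m _.
rewrite D1_harm // D2_harm //=; have := imc2 R.
move: imc (harm p q.+1 m x) (harm p.+2 q.-1 m x) (c m) => j u v k j2.
by ring: j2.
Qed.

Lemma harm_big p q m : (p + q < m)%N -> harm p q m = fun=> 0.
Proof.
move=> pqm; apply/funext => x; rewrite /harm /hgen nth_default //.
have s2 (a b : C) : (size (a%:P + b *: 'X)%R <= 2)%N.
  apply: leq_trans (size_polyD _ _) _; rewrite geq_max (leq_trans (size_polyC_leq1 _)) //.
  by apply: leq_trans (size_scale_leq _ _) _; rewrite size_polyX.
have se (P : {poly C}) k : (size P <= 2)%N -> (size (P ^+ k) <= k.+1)%N.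
  move=> sP; apply: leq_trans (size_poly_exp_leq _ _) _; rewrite ltnS.
  by rewrite -[leqRHS]mul1n leq_mul2r; apply/orP; right; lia.
apply: leq_trans (size_polyMleq _ _) _.
have := se _ p (s2 (z1 O x) (z2 O x)); have := se _ q (s2 (w2 O x) (-1 * w1 O x)).
rewrite -/(Xp O x) -/(Yp O x); lia.
Qed.

Definition eigenfun l h := sfunC h /\ jacC h = fun x => realc l * h x.

Lemma eigenfun_harm p q m : eigenfun (jeig R p q) (harm p q m).
Proof.
split; first exact: sfunC_harm.
by apply/funext => x; rewrite jacC_harm // jeigCE.
Qed.

Lemma eigenfunZ l c h : eigenfun l h -> eigenfun l (fun x => c * h x).
Proof.
move=> [sh eh]; split; first by apply: sfunCM => //; exact: sfunC_cst.
by rewrite jacCZ // eh; apply/funext => x; rewrite mulrCA.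
Qed.

Lemma eigenfunD l h g : eigenfun l h -> eigenfun l g -> eigenfun l (fun x => h x + g x).
Proof.
move=> [sh eh] [sg eg]; split; first exact: sfunCD.
by rewrite jacCD // eh eg; apply/funext => x; rewrite mulrDr.
Qed.

(** Generators with another eigenvalue are orthogonal by symmetry, so only those with eigenvalue [l]
    have to be tested before density applies. *)
Lemma eigenfun_eq0 l h : eigenfun l h ->
  (forall p q m c, l = jeig R p q -> inner h (fun x => c * harm p q m x) = 0) -> h = fun=> 0.
Proof.
move=> [sh eh] hff; apply: (hspan_dense OO sh) => g; elim=> [p q m c|g1 g2 w1 I1 w2 I2].
  have [lpq|lpq] := eqVneq l (jeig R p q); first exact: hff.
  have ehx x : jacC h x = realc l * h x by rewrite eh.
  exact: (eigen_orth OO m c sh ehx lpq).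
have s1 := hspan_SmC OO w1; have s2 := hspan_SmC OO w2.
by rewrite innerC innerD // innerC I1 innerC I2 addr0.
Qed.

(** The value is n^2 + 4q with n = p + q and q <= n, hence below (n + 2)^2, so two values of n could
    differ by at most one; parity rules that out. Then n and the value determine q. *)
Lemma jeig_inj p q p' q' : jeig R p q = jeig R p' q' -> p = p' /\ q = q'.
Proof.
have e a b : jeig R a b = ((a + b) ^ 2 + 4 * b)%:R.
  by rewrite /jeig !natrD natrX !natrM !natrD; ring.
rewrite !e => /eqP; rewrite eqr_nat => /eqP h.
have key a b a' b' : ((a + b) ^ 2 + 4 * b)%N = ((a' + b') ^ 2 + 4 * b')%N ->
    (a + b <= a' + b')%N -> (a + b = a' + b')%N.
  move=> {}h le; have [//|lt] := eqVneq (a + b)%N (a' + b')%N.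
  have [e1|e1] := eqVneq (a' + b')%N (a + b).+1.
    by move: h; rewrite e1 -!mulnn; lia.
  have e2 : (a + b + 2 <= a' + b')%N by lia.
  move: h; rewrite -!mulnn; nia.
have s : (p + q = p' + q')%N.
  by case: (leqP (p + q) (p' + q')) => [|/ltnW] le; [|apply/esym]; apply: key le.
by move: h; rewrite s; lia.
Qed.

Definition comb p q (c : nat -> C) : S -> C :=
  fun x => \sum_(m < (p + q).+1) c m * harm p q m x.

Lemma span_closed (bs : seq (S -> C)) (Pr : (S -> C) -> Prop) :
  Pr (fun=> 0) ->
  (forall i, (i < size bs)%N -> forall r g, Pr g ->
     Pr (fun x => realc r * nth (fun=> 0) bs i x + g x)) ->
  forall h, rspan bs h -> Pr h.
Proof.
move=> P0; elim: bs => [|b bs IH] step h /=; first by move=> ->.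
move=> [r [g [sg ->]]]; apply: (step 0%N) => //.
by apply: IH => // i hi; exact: (step i.+1).
Qed.

Lemma eigenfun_comb p q h : eigenfun (jeig R p q) h -> exists c, h = comb p q c.
Proof.
move=> eh; set l := jeig R p q in eh; pose n := (p + q)%N.
(* Over the reals each function is accompanied by its multiple by i: indices 0 to n, then n + 1 to
   2n + 1. *)
pose bs := [seq harm p q m | m <- iota 0 n.+1] ++
           [seq (fun x => imc * harm p q m x) | m <- iota 0 n.+1].
have sbs : size bs = (n.+1 + n.+1)%N by rewrite size_cat !size_map size_iota.
have nbs i : (i < n.+1 + n.+1)%N -> nth (fun=> 0) bs i =
   fun x => (if (i < n.+1)%N then 1 else imc) * harm p q (if (i < n.+1)%N then i else i - n.+1)%N x.
  move=> hi; rewrite nth_cat size_map size_iota.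
  have [lt|ge] := ltnP i n.+1.
    rewrite (nth_map 0%N) ?size_iota // nth_iota // add0n.
    by apply/funext => x; rewrite mul1r.
  have hi' : (i - n.+1 < n.+1)%N by lia.
  by rewrite (nth_map 0%N) ?size_iota // nth_iota.
have ebs i : (i < size bs)%N -> eigenfun l (nth (fun=> 0) bs i).
  by rewrite sbs => /nbs ->; apply: eigenfunZ; exact: eigenfun_harm.
have abs : all_sfunC bs by move=> i hi; have [] := ebs i hi.
have [sh _] := eh.
have [g [sg og]] := projection abs sh.
have [eg [c gc]] : eigenfun l g /\ exists c, g = comb p q c.
  move: g sg {og}; apply: span_closed.
    split.
      have := eigenfunZ 0 (eigenfun_harm p q 0); rewrite (_ : (fun x => 0 * _) = fun=> 0) //.
      by apply/funext => x; rewrite mul0r.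
    by exists (fun=> 0); apply/funext => x; rewrite /comb big1 // => m _; rewrite mul0r.
  move=> i hi r g [eg [c gc]]; split.
    by apply: eigenfunD => //; apply: eigenfunZ; exact: ebs.
  rewrite sbs in hi; rewrite nbs // gc.
  set j := (if _ then i else _)%N; set a := if _ then 1 else _.
  have jn : (j < n.+1)%N.
    rewrite /j; case E : (i < n.+1)%N; first by rewrite E.
    by rewrite ltn_subLR // leqNgt E.
  exists (fun m => (if m == j then realc r * a else 0) + c m); apply/funext => x.
  rewrite /comb; under [RHS]eq_bigr => m _ do rewrite mulrDl.
  rewrite big_split /=; congr (_ + _).
  rewrite (bigD1 (Ordinal jn)) //= eqxx big1 ?addr0 ?mulrA // => m mj.
  by rewrite -val_eqE /= in mj; rewrite (negbTE mj) mul0r.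
exists c; rewrite -gc.
have eh' : eigenfun l (fun x => h x + realc (-1) * g x).
  by apply: eigenfunD => //; exact: eigenfunZ.
(* By [jeig_inj] the eigenvalue determines p and q, so the projected family is the only one to test,
   and its coefficients with m > n are zero. *)
have h0 : (fun x => h x + realc (-1) * g x) = fun=> 0.
  apply: (eigenfun_eq0 eh') => p' q' m d /jeig_inj[<- <-].
  have [mn|mn] := ltnP n m.
    rewrite (harm_big mn) innerC (_ : (fun x => d * 0) = fun=> 0); first exact: inner0l (proj1 eh').
    by apply/funext => x; rewrite mulr0.
  have sf := sfunC_harm OO p q m.
  have sif : sfunC (fun x => imc * harm p q m x) by apply: sfunCM => //; exact: sfunC_cst.
  have dE : (fun x => d * harm p q m x) =
     fun x => realc (re d) * harm p q m x + realc (im d) * (imc * harm p q m x).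
    apply/funext => x; rewrite mulrA -mulrDl; congr (_ * _).
    by apply: complexP; rewrite ?reD ?imD ?reM ?imM /=; ring.
  have sh' := proj1 eh'.
  rewrite dE innerC innerD ?innerZ //; try by apply: sfunCM => //; exact: sfunC_cst.
  have o1 := og m; rewrite sbs nbs in o1; last by lia.
  have o2 := og (m + n.+1)%N; rewrite sbs nbs in o2; last by lia.
  rewrite ltnS mn in o1.
  have c2 : (m + n.+1 < n.+1)%N = false by lia.
  rewrite c2 addnK in o2.
  rewrite ![inner _ (fun x => h x + _)]innerC o2; last by lia.
  have -> : harm p q m = fun x => 1 * harm p q m x by apply/funext => x; rewrite mul1r.
  by rewrite o1 ?mulr0 ?addr0 //; lia.
apply/funext => x; have := congr1 (fun f : S -> C => f x) h0.
have -> : realc (-1) = -1 by apply: complexP; rewrite /= ?oppr0.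
by move=> e; apply/eqP; rewrite -subr_eq0 -mulN1r; apply/eqP.
Qed.

Local Notation M := (Mo O).

Definition fieldC h : S -> V4 := vf M (fun x => re (h x)) (fun x => im (h x)).

Lemma dotp_Mo i j p : dotp (qframe M i p) (qframe M j p) = (i == j)%:R.
Proof. exact: (dotp_qframe (Mo_sk O) (Mo_sq OO) (Mo01 OO) (Mo12 OO) (Mo20 OO)). Qed.

Lemma dotp_fieldC h p k : dotp (fieldC h p) (qframe M k p) =
  re (h p) * (1 == k)%:R + im (h p) * (2 == k)%:R.
Proof. by rewrite /fieldC /vf dotpDl !dotpZl !dotp_Mo. Qed.

Lemma fieldC_inj : injective fieldC.
Proof.
move=> h g hg; apply/funext => p.
have e k : dotp (fieldC h p) (qframe M k p) = dotp (fieldC g p) (qframe M k p) by rewrite hg.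
have := e 1; have := e 2; rewrite !dotp_fieldC /= !mulr1 !mulr0 !addr0 !add0r => ei er.
exact: complexP.
Qed.

Lemma fieldC_lin a h g : fieldC (fun x => realc a * h x + g x) = a *: fieldC h + fieldC g.
Proof.
apply/funext => p; rewrite /fieldC /vf -[RHS]/(a *: (re (h p) *: qframe M 1 p + im (h p) *: qframe M 2 p)
   + (re (g p) *: qframe M 1 p + im (g p) *: qframe M 2 p)).
rewrite reD imD re_rcM im_rcM; move: (qframe M 1 p) (qframe M 2 p) => u v.
by apply/rowP => i; rewrite !mxE; ring.
Qed.

Lemma fieldC0 : fieldC (fun=> 0) = 0.
Proof. by apply/funext => p; rewrite /fieldC /vf /= !scale0r addr0. Qed.

Lemma fieldCZ a h : fieldC (fun x => realc a * h x) = a *: fieldC h.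
Proof.
rewrite -[RHS]addr0 -fieldC0 -fieldC_lin; congr fieldC.
by apply/funext => x; rewrite addr0.
Qed.

Lemma fieldC_sum n (r : 'I_n -> R) (h : 'I_n -> S -> C) :
  fieldC (fun x => \sum_i realc (r i) * h i x) = \sum_i r i *: fieldC (h i).
Proof.
elim: n r h => [|n IH] r h.
  by rewrite big_ord0 -fieldC0; congr fieldC; apply/funext => x; rewrite big_ord0.
rewrite big_ord_recl -IH -fieldC_lin; congr fieldC.
by apply/funext => x; rewrite big_ord_recl.
Qed.

Variable E : 'I_3 -> S -> V4.
Hypothesis hE : orthonormal_frame E.

Lemma vjacobi_fieldC h : sfunC h -> vjacobi E (qframe M 0) (fieldC h) = fieldC (jacC h).
Proof.
move=> [s1 s2]; rewrite /fieldC.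
rewrite (vjacobi_vf (Mo_sk O) (Mo_sq OO) (Mo01 OO) (Mo12 OO) (Mo20 OO) hE s1 s2).
by congr vf; apply/funext => p; rewrite ?re_jacC ?im_jacC.
Qed.

Lemma vertical_fieldC h : sfunC h -> vertical (qframe M 0) (fieldC h).
Proof.
move=> [s1 s2]; split; last by move=> p; rewrite dotp_fieldC /= !mulr0 addr0.
split; last by move=> p; exact: (tangent_vf (Mo_sk O)).
by apply/smoothE; exact: sfield_vf.
Qed.

Lemma vertical_ex_fieldC a : vertical (qframe M 0) a -> exists2 h, sfunC h & a = fieldC h.
Proof.
move=> [[/smoothE sa ta] va].
exists (fun p => Complex (dotp (a p) (qframe M 1 p)) (dotp (a p) (qframe M 2 p))).
  by split; apply: sfun_dotp => //; exact: sfield_qframe.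
apply/funext => p; rewrite /fieldC /vf /=.
rewrite [LHS](tangent_expand (Mo_sk O) (Mo_sq OO) (Mo01 OO) (Mo12 OO) (Mo20 OO) (ta p)).
by rewrite sum_I3 va scale0r add0r.
Qed.

Lemma eigenspace_fieldC l a :
  eigenspace_of (vertical (qframe M 0)) (vjacobi E (qframe M 0)) l a <->
  exists2 h, eigenfun l h & a = fieldC h.
Proof.
split=> [[va ea]|[h [sh eh] ->]].
  have [h sh ah] := vertical_ex_fieldC va; exists h => //; split=> //.
  by apply: fieldC_inj; rewrite fieldCZ -vjacobi_fieldC // -ah.
split; first exact: vertical_fieldC.
by rewrite vjacobi_fieldC // eh fieldCZ.
Qed.

(** If [l] matched no pair, the test in [eigenfun_eq0] would be void and the eigenfunction zero.
    Conversely, [harm p q 0] is not zero because the family is free. *)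
Lemma eigenvalue_fieldC l :
  eigenvalue_of (vertical (qframe M 0)) (vjacobi E (qframe M 0)) l <->
  exists p q, l = jeig R p q.
Proof.
split=> [[a /eigenspace_fieldC[h eh ->] a0]|[p [q ->]]].
  apply: contrapT => hn; move/eqP: a0; apply.
  rewrite (_ : h = fun=> 0) ?fieldC0 //.
  by apply: (eigenfun_eq0 eh) => p q m c lpq; case: hn; exists p, q.
exists (fieldC (harm p q 0)).
  by apply/eigenspace_fieldC; exists (harm p q 0) => //; exact: eigenfun_harm.
apply/eqP => h0; have f0 : harm p q 0 = fun=> 0 by apply: fieldC_inj; rewrite h0 fieldC0.
have := @harm_free p q (fun m => (m == 0)%:R) _ 0 (leq0n _).
rewrite eqxx => h1; have /eqP : (1 : C) = 0; last by rewrite oner_eq0.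
apply: h1 => x; rewrite big1 // => m _.
by case: (altP eqP) => [m0|_]; rewrite ?mul0r // m0 f0 mulr0.
Qed.

Lemma has_dim_eigenspace p q :
  has_dim (eigenspace_of (vertical (qframe M 0)) (vjacobi E (qframe M 0)) (jeig R p q))
    (2 * (p + q + 1)).
Proof.
set n := (p + q)%N; have -> : (2 * (n + 1) = n.+1 + n.+1)%N by lia.
pose f (i : 'I_(n.+1 + n.+1)) : S -> C :=
  match fintype.split i with inl m => harm p q m | inr m => fun x => imc * harm p q m x end.
have fl (m : 'I_n.+1) : f (lshift _ m) = harm p q m.
  by rewrite /f (_ : fintype.split _ = inl m) //; exact: (unsplitK (inl m)).
have fr (m : 'I_n.+1) : f (rshift _ m) = fun x => imc * harm p q m x.
  by rewrite /f (_ : fintype.split _ = inr m) //; exact: (unsplitK (inr m)).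
(* The 2n + 2 real coefficients pair up as real and imaginary parts of n + 1 complex ones, which
   reduces the claim to complex freeness and generation. *)
have sumf (r : 'I_(n.+1 + n.+1) -> R) : (fun x => \sum_i realc (r i) * f i x) =
   fun x => \sum_(m < n.+1) Complex (r (lshift _ m)) (r (rshift _ m)) * harm p q m x.
  apply/funext => x; rewrite big_split_ord /= -big_split /=; apply: eq_bigr => m _.
  rewrite fl fr mulrA -mulrDl; congr (_ * _).
  by apply: complexP; rewrite ?reD ?imD ?reM ?imM /=; ring.
exists (fun i => fieldC (f i)); split=> [r|a].
  rewrite -fieldC_sum -fieldC0 sumf => /fieldC_inj h0.
  pose c (k : nat) := Complex (r (lshift _ (inord k))) (r (rshift _ (inord k))).
  have c0 k : (k <= n)%N -> c k = 0.
    apply: harm_free => x; have /= e := congr1 (fun g : S -> C => g x) h0; rewrite -[RHS]e.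
    by apply: eq_bigr => m _; rewrite /c inord_val.
  move=> i; rewrite -(splitK i); case: (fintype.split i) => m /=.
    have := c0 m; rewrite -ltnS ltn_ord => /(_ isT); rewrite /c inord_val => -[-> _] //.
  have := c0 m; rewrite -ltnS ltn_ord => /(_ isT); rewrite /c inord_val => -[_ ->] //.
split=> [/eigenspace_fieldC[h /eigenfun_comb[c ->] ->]|[r ->]].
  exists (fun i => match fintype.split i with inl m => re (c m) | inr m => im (c m) end).
  rewrite -fieldC_sum sumf; congr fieldC; apply/funext => x; apply: eq_bigr => m _.
  have -> : fintype.split (lshift n.+1 m) = inl m by exact: (unsplitK (inl m)).
  have -> : fintype.split (rshift n.+1 m) = inr m by exact: (unsplitK (inr m)).
  by congr (_ * _); case: (c m).
apply/eigenspace_fieldC; exists (fun x => \sum_i realc (r i) * f i x); last by rewrite fieldC_sum.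
rewrite sumf; pose c (k : nat) := Complex (r (lshift _ (inord k))) (r (rshift _ (inord k))).
have -> : (fun x => \sum_(m < n.+1) Complex (r (lshift _ m)) (r (rshift _ m)) * harm p q m x)
   = fun x => \sum_(m < n.+1) c m * harm p q m x.
  by apply/funext => x; apply: eq_bigr => m _; rewrite /c inord_val.
elim: (n.+1) => [|k IH].
  have := eigenfunZ 0 (eigenfun_harm p q 0); congr eigenfun.
  by apply/funext => x; rewrite mul0r big_ord0.
have := eigenfunD IH (eigenfunZ (c k) (eigenfun_harm p q k)); congr eigenfun.
by apply/funext => x; rewrite big_ord_recr.
Qed.
End Multiplicity.

(** In -n + 2j the index j is q, and p = n - q. *)
Lemma weightsP (n : nat) (k : int) :
  k \in weights n <-> exists p q : nat, n = (p + q)%N /\ k = q%:Z - p%:Z.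
Proof.
split=> [/mapP[j]|[p [q [-> ->]]]].
  rewrite mem_iota ltnS => /andP[_ jn] ->; exists (n - j)%N, j.
  by split; lia.
apply/mapP; exists q; last by lia.
by rewrite mem_iota; lia.
Qed.

Lemma jeig_weight (R : realType) (p q : nat) :
  ((p + q) * (p + q + 2))%:R + 2 * (q%:Z - p%:Z)%:~R = jeig R p q.
Proof. by rewrite /jeig rmorphB /=. Qed.

Theorem theorem2p3 (R : realType) (E : 'I_3 -> S3 R -> 'rV[R]_4)
    (s : S3 R -> 'rV[R]_4) (hE : orthonormal_frame E) (hs : hopf s) :
  (forall l : R,
     eigenvalue_of (vertical s) (vjacobi E s) l <->
     exists (n : nat) (k : int),
       k \in weights n /\ l = (n * (n + 2))%:R + 2 * k%:~R) /\
  (forall (n : nat) (k : int), k \in weights n ->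
     has_dim
       (eigenspace_of (vertical s) (vjacobi E s)
          ((n * (n + 2))%:R + 2 * k%:~R))
       (2 * (n + 1))).
Proof.
have [A AA ->] := hopf_linear hs.
split=> [l|n k /weightsP[p [q [-> ->]]]]; last first.
  by rewrite jeig_weight; exact: has_dim_eigenspace.
split=> [/(eigenvalue_fieldC AA hE)[p [q ->]]|[n [k [/weightsP[p [q [-> ->]]] ->]]]].
  exists (p + q)%N, (q%:Z - p%:Z); rewrite jeig_weight; split=> //.
  by apply/weightsP; exists p, q.
by apply/(eigenvalue_fieldC AA hE); exists p, q; rewrite jeig_weight.
Qed.
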